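(* Let $d\ge1$ and $p\in(1,2)$, $p'=\frac p{p-1}$. Then the Fourier transform $\mathscr F:L^p(\mathbb{R}^d)\to L^{p',p}(\mathbb{R}^d)$ (which is bounded) is not strictly singular.
   Context: For $f\in L^1(\mathbb{R}^d)$, $\mathscr F f(x)=\int_{\mathbb{R}^d}f(t)e^{-i\langle x,t\rangle}\,dt$, extended by density/continuity to $L^p(\mathbb{R}^d)$, $1\le p\le2$. Lorentz space $L^{p',p}(\mathbb{R}^d)$: measurable $g$ with $\|g\|_{p',p}=\big(\int_0^\infty(t^{1/p'}g^*(t))^p\frac{dt}t\big)^{1/p}<\infty$, where $g^*(t)=\inf\{\tau>0:|\{|g|>\tau\}|\le t\}$. A bounded linear operator $T:X\to Y$ is strictly singular if there is no infinite-dimensional subspace $Z\subseteq X$ such that $T|_Z$ is an isomorphism onto $T(Z)$. *)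

(* Defs.v *)
From HB Require Import structures.
From mathcomp Require Import all_boot all_order all_algebra.
From mathcomp Require Import all_classical all_reals all_analysis.
From mathcomp Require Import complex.

Set Implicit Arguments.
Unset Strict Implicit.
Unset Printing Implicit Defensive.

Import Order.TTheory GRing.Theory Num.Theory.
Import numFieldNormedType.Exports.

Local Open Scope classical_set_scope.
Local Open Scope ring_scope.

Fixpoint RM (R : realType) (n : nat) : {d : measure_display & measurableType d} :=
  match n with
  | 0 => existT (fun d => measurableType d) _ (measurableTypeR R : measurableType _)
  | m.+1 => existT (fun d => measurableType d) _
              (((projT2 (RM R m)) * measurableTypeR R)%type : measurableType _)
  end.

Definition Rn (R : realType) (n : nat) := projT2 (RM R n).

Fixpoint leb (R : realType) (n : nat) : {measure set (Rn R n) -> \bar R} :=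
  match n return {measure set (Rn R n) -> \bar R} with
  | 0 => @lebesgue_measure R
  | m.+1 => (leb R m \x @lebesgue_measure R)%E
  end.

Fixpoint dotR (R : realType) (n : nat) : Rn R n -> Rn R n -> R :=
  match n return Rn R n -> Rn R n -> R with
  | 0 => fun x t => (x : R) * (t : R)
  | m.+1 => fun x t => dotR x.1 t.1 + (x.2 : R) * (t.2 : R)
  end.

Local Open Scope complex_scope.

Section Defs.
Variable R : realType.

(** R^d (for d >= 1) with the product of d copies of Lebesgue measure. *)
Definition Rd (d : nat) := Rn R d.-1.
Definition lebd (d : nat) : {measure set (Rd d) -> \bar R} := leb R d.-1.
Definition dotd (d : nat) (x t : Rd d) : R := dotR x t.

Definition cabs (z : R[i]) : R := Num.sqrt (complex.Re z ^+ 2 + complex.Im z ^+ 2).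

Variable d : nat.
Implicit Types (f g : Rd d -> R[i]) (p q : R).

Definition Cmeasurable f :=
  measurable_fun setT (fun x => complex.Re (f x)) /\ measurable_fun setT (fun x => complex.Im (f x)).

Definition Lpnorm p f : \bar R := Lnorm (lebd d) p%:E (fun x => (cabs (f x))%:E).

Definition inLp p f : Prop := Cmeasurable f /\ (Lpnorm p f < +oo)%E.

Definition Cint f : R[i] :=
  Complex (Rintegral (lebd d) setT (fun t => complex.Re (f t)))
          (Rintegral (lebd d) setT (fun t => complex.Im (f t))).

Definition expi (theta : R) : R[i] := Complex (cos theta) (sin theta).

Definition fourier f (x : Rd d) : R[i] :=
  Cint (fun t => f t * expi (- dotd x t)).

Definition distf g (tau : R) : \bar R := lebd d [set x | tau < cabs (g x)].

Definition rearr g (t : R) : \bar R :=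
  ereal_inf [set tau%:E | tau in [set tau : R | 0 < tau /\ (distf g tau <= t%:E)%E]].

Definition lorentz_norm (q r : R) g : \bar R :=
  ((\int[@lebesgue_measure R]_(t in `]0%R, +oo[)
      (((t `^ q^-1)%:E * rearr g t) `^ r * (t^-1)%:E)) `^ r^-1)%E.

Definition inLorentz (q r : R) g : Prop := Cmeasurable g /\ (lorentz_norm q r g < +oo)%E.

Definition conjexp p : R := p / (p - 1).

(** T (acting on representatives) is the Fourier transform on L^p(R^d), i.e. a
    bounded linear operator L^p -> L^{p',p} (well defined on a.e.-classes) which
    coincides with the Fourier integral on L^1 \cap L^p. *)
Definition fourier_operator p (T : (Rd d -> R[i]) -> (Rd d -> R[i])) : Prop :=
  [/\ (forall f g, inLp p f -> inLp p g ->
         {ae lebd d, forall x, f x = g x} -> {ae lebd d, forall x, T f x = T g x}),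
      (forall (a : R[i]) f g, inLp p f -> inLp p g ->
         {ae lebd d, forall x, T (fun y => a * f y + g y) x = a * T f x + T g x}),
      (exists C : R, forall f, inLp p f ->
         inLorentz (conjexp p) p (T f) /\
         (lorentz_norm (conjexp p) p (T f) <= C%:E * Lpnorm p f)%E) &
      (forall f, inLp p f -> inLp 1 f -> {ae lebd d, forall x, T f x = fourier f x})].

Definition Lp_subspace p (Z : set (Rd d -> R[i])) : Prop :=
  [/\ Z `<=` inLp p, Z (fun _ => 0) &
      forall (a : R[i]) f g, Z f -> Z g -> Z (fun y => a * f y + g y)].

Definition infinite_dim (Z : set (Rd d -> R[i])) : Prop :=
  forall k : nat, exists fs : 'I_k -> (Rd d -> R[i]),
    (forall i, Z (fs i)) /\
    forall c : 'I_k -> R[i],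
      {ae lebd d, forall x, \sum_(i < k) c i * fs i x = 0} -> forall i, c i = 0.

Definition iso_on p q (T : (Rd d -> R[i]) -> (Rd d -> R[i])) (Z : set (Rd d -> R[i])) :=
  exists c C : R, 0 < c /\ forall f, Z f ->
    (c%:E * Lpnorm p f <= lorentz_norm q p (T f))%E /\
    (lorentz_norm q p (T f) <= C%:E * Lpnorm p f)%E.

Definition strictly_singular p q (T : (Rd d -> R[i]) -> (Rd d -> R[i])) : Prop :=
  ~ exists Z : set (Rd d -> R[i]), [/\ Lp_subspace p Z, infinite_dim Z & iso_on p q T Z].

End Defs.

(* Main.v *)
(* Existence.  The Plancherel inequality on L^1 /\ L^2 comes from a TT* argument:
   against the weight e^{-e|x|} the squared modulus of the transform is a
   quadratic form with a Poisson kernel, bounded by Schur's test, and e tends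
   to 0.  Hence the transform extends to L^2 and to L^1 + L^2.  Cutting f at
   height s bounds |{|Ff| > s/t}|; integrating in s and against dt/t^2 gives
   Paley's inequality, i.e. boundedness from L^p to L^{p',p}.

   No strict singularity.  Let E_s = [s,2s] x [0,1]^{d-1}.  The transform of its
   indicator has size about s on a box A_s of measure 1/(4s), and the transform
   of any other 1_{E_r} is at most of order min(r,s) there.  For s = sigma^m
   with sigma small, the E_s are disjoint, so the span of their indicators is an
   l^p in L^p; on A_{sigma^m} the m-th term dominates the others up to
   geometrically small errors, and because |A_{sigma^m}| grows geometrically,
   the L^{p',p} norm of the transform is bounded below by the same l^p norm. *)
Require Import Defs.
From HB Require Import structures.
From mathcomp Require Import all_boot all_order all_algebra.
From mathcomp Require Import all_classical all_reals all_analysis.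
From mathcomp Require Import measurable_realfun complex ring lra.

Set Implicit Arguments.
Unset Strict Implicit.
Unset Printing Implicit Defensive.

Import Order.TTheory GRing.Theory Num.Theory.
Import numFieldNormedType.Exports.

Local Open Scope classical_set_scope.
Local Open Scope ring_scope.

(** * One-dimensional integrals *)

(** Everything in the lower bound hinges on one choice of exponents. With [rho] small, put
    [sigma = rho^p'] and [omega = sigma / rho]. Since (p' - 1)p = p', one has [omega^p = sigma]; the
    m-th block has measure sigma^m, so [y_m = |c_m| omega^m] is exactly the L^p norm of the m-th
    term. Its transform has size rho^m y_m on A_{sigma^m}, while t^{1/p'} is of order rho^{-m} for t
    comparable to |A_{sigma^m}|: the powers of rho cancel, and as the second Lorentz index is p,
    each m contributes a multiple of y_m^p. The bound min(r,s) turns into a relative error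
    rho^{|l-m|}; this is where sigma <= rho^2, that is p' >= 2, enters. For a given operator the
    lower bound rests on its agreement with the Fourier integral on the span, which consists of
    integrable functions. In the existence part every height s gives another splitting of f, so
    uniqueness of the transform on L^1 + L^2 has to precede Paley's inequality. Only inequalities up
    to constants occur; neither inversion nor a sharp constant is used. *)

Section OneDim.
Variable R : realType.
Local Notation lam := (@lebesgue_measure R).

Lemma cvg_expRM (e : R) : 0 < e -> expR (- (e * x)) @[x --> +oo] --> (0 : R).
Proof.
move=> e0.
apply: (@cvg_comp _ _ _ (fun x : R => e * x) (fun y => expR (- y)) _ (+oo)); last exact: cvgr_expR.
exact: gt0_cvgMry.
Qed.

(** The substitution y = (s - t)/e reduces this to the arctangent integral. That the mass depends on
    neither [e] nor [t] makes Schur's test uniform in [e]. *)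
Lemma integral_cauchy (e t : R) : 0 < e ->
  (\int[lam]_s (2 * e / (e ^+ 2 + (s - t) ^+ 2))%:E = (2 * pi)%:E)%E.
Proof.
move=> e0.
pose G (y : R) := 2 * (oneDsqr y)^-1.
pose F (x : R) := e^-1 * (x - t).
have cG : continuous G.
  by move=> x; apply: cvgM; [exact: cvg_cst|exact: continuous_oneDsqrV].
have G0 y : 0 <= G y by rewrite mulr_ge0// invr_ge0 ltW// oneDsqr_gt0.
have dF (x : R) : is_derive x 1 F e^-1.
  by rewrite /F; apply: is_derive_eq; rewrite subr0 /GRing.scale/= mulr1.
have F' : F^`()%classic = cst e^-1.
  by apply/funext => x; rewrite derive1E; have [] := dF x.
transitivity (\int[lam]_x (((G \o F) * F^`()%classic) x)%:E)%E.
  apply: eq_integral => s _; congr EFin.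
  rewrite (_ : _ s = G (F s) * F^`()%classic s)// F' /= /G /F /oneDsqr.
  have h1 : e ^+ 2 + (s - t) ^+ 2 != 0.
    by rewrite gt_eqF// ltr_pwDl ?exprn_gt0 ?sqr_ge0.
  have h2 : 1 + (e^-1 * (s - t)) ^+ 2 != 0.
    by rewrite gt_eqF// ltr_pwDl ?sqr_ge0.
  have h3 : e != 0 by rewrite gt_eqF.
  by field; rewrite h3.
rewrite -increasing_ge0_integration_by_substitutionT//.
- rewrite ge0_symfun_integralT//; last by move=> x; rewrite /G/= /oneDsqr sqrrN.
  rewrite -set_itvcy /G.
  under eq_integral do rewrite EFinM.
  rewrite ge0_integralZl_EFin//; last first.
  - apply/measurable_EFinP; apply: measurable_funTS.
    by apply: continuous_measurable_fun; exact: continuous_oneDsqrV.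
  by rewrite integral0y_oneDsqr -!EFinM; congr EFin; field.
- by move=> x y xy; rewrite /F ltr_pM2l ?invr_gt0// ltrD2r.
- by rewrite F'; exact: cst_continuous.
- by rewrite F'; apply: is_cvg_cst.
- by rewrite F'; apply: is_cvg_cst.
- rewrite /F.
  apply: (@cvg_comp _ _ _ (fun x : R => x - t) (fun y => e^-1 * y) _ (-oo)).
    exact: cvg_addrr_Ny.
  by apply: gt0_cvgMrNy; rewrite ?invr_gt0.
- apply: (@cvg_comp _ _ _ (fun x : R => x - t) (fun y => e^-1 * y) _ (+oo)).
    exact: cvg_addrr.
  by apply: gt0_cvgMry; rewrite ?invr_gt0.
Qed.

(** The antiderivative of exp(-ex)(1 + cos(xu)) that vanishes at infinity. *)
Let Fp (e u x : R) : R := expR (- (e * x)) *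
  ((u * sin (x * u) - e * cos (x * u)) / (e ^+ 2 + u ^+ 2) - e^-1).

Lemma is_derive_Fp (e u x : R) : 0 < e -> is_derive x 1 (Fp e u)
   (expR (- (e * x)) * (1 + cos (x * u))).
Proof.
move=> e0; rewrite /Fp.
apply: is_derive_eq.
rewrite /GRing.scale/=.
have h1 : e ^+ 2 + u ^+ 2 != 0 by rewrite gt_eqF// ltr_pwDl ?exprn_gt0 ?sqr_ge0.
have h3 : e != 0 by rewrite gt_eqF.
by field; rewrite h3 h1.
Qed.

Lemma cvg_Fp (e u : R) : 0 < e -> Fp e u x @[x --> +oo] --> (0 : R).
Proof.
move=> e0.
pose C : R := (`|u| + e) / (e ^+ 2 + u ^+ 2) + e^-1.
apply: (@squeeze_cvgr _ _ _ _ (fun x => - (C * expR (- (e * x)))) (fun x => C * expR (- (e * x)))).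
- near=> x.
  rewrite -ler_norml /Fp normrM [`|expR _|]ger0_norm ?expR_ge0// mulrC ler_wpM2r ?expR_ge0//.
  rewrite (le_trans (ler_normB _ _))// /C [`|e^-1|]ger0_norm ?invr_ge0 ?(ltW e0)//.
  apply: lerD => //.
  rewrite normrM normfV [`|_ ^+ 2 + _|]ger0_norm ?addr_ge0 ?sqr_ge0//.
  rewrite ler_wpM2r ?invr_ge0 ?addr_ge0 ?sqr_ge0//.
  rewrite (le_trans (ler_normB _ _))// !normrM lerD//.
    by rewrite ler_piMr// ler_norml sin_geN1 sin_le1.
  by rewrite (gtr0_norm e0) ler_piMr ?(ltW e0)// ler_norml cos_geN1 cos_le1.
- rewrite -oppr0; apply: cvgN; rewrite -[X in _ --> X](mulr0 C).
  by apply: cvgM; [exact: cvg_cst|exact: cvg_expRM].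
- rewrite -[X in _ --> X](mulr0 C).
  by apply: cvgM; [exact: cvg_cst|exact: cvg_expRM].
Unshelve. all: by end_near. Qed.

(** The summand 1 keeps the integrand nonnegative, so the fundamental theorem on a half-line applies
    without knowing integrability beforehand. The cosine integral is recovered later by subtracting
    the pure exponential, itself obtained from [u = 0]. *)
Lemma integral_expR_1cos (e u : R) : 0 < e ->
  (\int[lam]_x (expR (- (e * `|x|)) * (1 + cos (x * u)))%:E =
   (2 * (e^-1 + e / (e ^+ 2 + u ^+ 2)))%:E)%E.
Proof.
move=> e0.
have cf (x : R) : {for x, continuous (fun x : R => expR (- (e * x)) * (1 + cos (x * u)))}.
  apply/differentiable_continuous/derivable1_diffP.
  exact: ex_derive.
rewrite ge0_symfun_integralT//=; last 2 first.
- move=> x; apply: cvgM.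
    apply: continuous_comp; last exact: continuous_expR.
    apply: cvgN; apply: cvgM; [exact: cvg_cst|exact: norm_continuous].
  apply: cvgD; first exact: cvg_cst.
  apply: continuous_comp; last exact: continuous_cos.
  by apply: cvgM; [exact: cvg_id|exact: cvg_cst].
- by move=> x /=; rewrite normrN mulNr cosN.
- rewrite -set_itvcy.
  under eq_integral => x.
    rewrite inE/= in_itv/= andbT => x0; rewrite ger0_norm//.
  over.
  rewrite (ge0_continuous_FTC2y _ _ (cvg_Fp u e0))/=.
  + rewrite -EFinB -EFinM; congr EFin.
    rewrite /Fp mulr0 oppr0 expR0 mul0r sin0 cos0.
    ring.
  + move=> x _; rewrite mulr_ge0 ?expR_ge0//; have := cos_geN1 (x * u); lra.
  + by apply: continuous_subspaceT => x; exact: cf.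
  + by move=> x _; have [] := is_derive_Fp u x e0.
  + apply: cvg_at_right_filter.
    apply/differentiable_continuous/derivable1_diffP.
    by have [] := is_derive_Fp u 0 e0.
  + by move=> x _; rewrite derive1E; have [] := is_derive_Fp u x e0.
Qed.

(** For negative [a] the integrand is unbounded at 0, so the fundamental theorem is applied on
    compact intervals exhausting []0, y]], followed by monotone convergence. *)
Lemma integral_powR_near0 (a y : R) : -1 < a -> 0 < y ->
  (\int[lam]_(s in `]0%R, y]) (s `^ a)%:E = (y `^ (a + 1) / (a + 1))%:E)%E.
Proof.
move=> a1 y0.
have a10 : 0 < a + 1 by lra.
pose G (x : R) := x `^ (a + 1) / (a + 1).
have dG (x : R) : 0 < x -> is_derive x 1 G (x `^ a).
  move=> x0; rewrite /G.
  have := is_derive1_powR (a + 1) x0; rewrite addrK => dp.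
  under eq_fun do rewrite mulrC.
  apply: is_derive_eq; rewrite /GRing.scale/=; field.
  by rewrite gt_eqF.
(* The shift by two keeps [b n] strictly below [y] already for [n = 0]. *)
pose b (n : nat) : R := y / n.+2%:R.
have b0 n : 0 < b n by rewrite divr_gt0.
have by_ n : b n < y by rewrite /b ltr_pdivrMr// ltr_pMr// ltr1n.
have intn n : (\int[lam]_(s in `[b n, y]) (s `^ a)%:E = (G y)%:E - (G (b n))%:E)%E.
  rewrite (@continuous_FTC2 _ _ G)//.
  - apply: continuous_in_subspaceT => x; rewrite inE/= in_itv/= => /andP[bx _].
    apply/differentiable_continuous/derivable1_diffP/derivable_powR.
    by rewrite in_itv/= andbT (lt_le_trans (b0 n)).
  - split.
    + move=> x; rewrite in_itv/= => /andP[bx _].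
      by have [] := dG x (lt_trans (b0 n) bx).
    + apply: cvg_at_right_filter; apply/differentiable_continuous/derivable1_diffP.
      by have [] := dG _ (b0 n).
    + apply: cvg_at_left_filter; apply/differentiable_continuous/derivable1_diffP.
      by have [] := dG _ y0.
  - move=> x; rewrite in_itv/= => /andP[bx _].
    by rewrite derive1E; have [] := dG x (lt_trans (b0 n) bx).
have -> : `]0, y]%classic = \bigcup_n `[b n, y]%classic.
  apply/seteqP; split => x /=; rewrite in_itv/=.
    move=> /andP[x0 xy]; have [n nx] : exists n : nat, y / x < n%:R.
      by exists (Num.bound (y / x)); apply: archi_boundP; rewrite ltW ?divr_gt0.
    exists n => //=; rewrite in_itv/= xy andbT /b ler_pdivrMr// mulrC -ler_pdivrMr//.
    by rewrite (le_trans (ltW nx))// ler_nat ?leqW.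
  by move=> [n _] /=; rewrite in_itv/= => /andP[bx ->]; rewrite (lt_le_trans (b0 n)).
have /cvg_lim <- // : (\int[lam]_(s in `[b n, y]) (s `^ a)%:E)%E @[n --> \oo] -->
    (\int[lam]_(s in \bigcup_n `[b n, y]%classic) (s `^ a)%:E)%E.
  apply: (@ge0_nondecreasing_set_cvg_integral _ (measurableTypeR R) _ (fun n => `[b n, y]%classic) (fun s => (s `^ a)%:E) lam).
  - apply/nondecreasing_seqP => n; rewrite subsetEset => x /=; rewrite !in_itv/= => /andP[bx ->].
    by rewrite (le_trans _ bx)// ler_pM2l// lef_pV2 ?posrE// ler_nat.
  - by move=> n; exact: measurable_itv.
  - move=> n; apply/measurable_EFinP; apply: measurable_funTS; exact: measurable_powR.
  - by move=> n x _; rewrite lee_fin powR_ge0.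
rewrite (_ : (fun n => _) = EFin \o (fun n => G y - G (b n))); last first.
  by apply/funext => n /=; rewrite intn EFinB.
apply/cvg_lim => //; rewrite -/(G y) -[X in X%:E]subr0.
apply: cvg_EFin; first by near=> n.
apply: cvgB; first exact: cvg_cst.
rewrite /G -[X in _ --> X](mul0r (a + 1)^-1); apply: cvgM; last exact: cvg_cst.
have /cvg_at_rightP := powR_cvg0 a10; apply; split=> //.
rewrite -[X in _ --> X](mulr0 y) /b; apply: cvgM; first exact: cvg_cst.
have := @cvg_harmonic R; rewrite -(cvg_shiftn 1); apply: cvg_trans.
by apply: near_eq_cvg; near=> n; rewrite /harmonic/= addn1.
Unshelve. all: by end_near. Qed.

Lemma cvg_powRNy (a : R) : a < 0 -> x `^ a @[x --> +oo] --> (0 : R).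
Proof.
move=> a0.
apply: (@cvg_trans _ ((expR (- ((- a) * ln x))) @[x --> +oo])).
  by apply: near_eq_cvg; near=> x; rewrite /powR gt_eqF// mulNr opprK.
apply: (@cvg_comp _ _ _ (fun x : R => ln x) (fun y => expR (- (- a * y))) _ (+oo)).
  apply/cvgryPge => A; near=> x.
  by rewrite -[A]expRK ler_ln ?posrE ?expR_gt0.
by apply: cvg_expRM; lra.
Unshelve. all: by end_near. Qed.

Lemma integral_powR_nearoo (a y : R) : a < -1 -> 0 < y ->
  (\int[lam]_(s in `[y, +oo[) (s `^ a)%:E = (y `^ (a + 1) / (- (a + 1)))%:E)%E.
Proof.
move=> a1 y0.
have a10 : a + 1 < 0 by lra.
pose G (x : R) := x `^ (a + 1) / (a + 1).
have dG (x : R) : 0 < x -> is_derive x 1 G (x `^ a).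
  move=> x0; rewrite /G.
  have := is_derive1_powR (a + 1) x0; rewrite addrK => dp.
  under eq_fun do rewrite mulrC.
  apply: is_derive_eq; rewrite /GRing.scale/=; field.
  by rewrite lt_eqF.
have cG : G x @[x --> +oo] --> (0 : R).
  rewrite /G -[X in _ --> X](mul0r (a + 1)^-1); apply: cvgM; last exact: cvg_cst.
  exact: cvg_powRNy.
rewrite (ge0_continuous_FTC2y _ _ cG)/=.
- by rewrite -EFinB; congr EFin; rewrite /G sub0r invrN mulrN.
- by move=> x _; rewrite powR_ge0.
- apply: continuous_in_subspaceT => x; rewrite inE/= in_itv/= andbT => yx.
  apply/differentiable_continuous/derivable1_diffP/derivable_powR.
  by rewrite in_itv/= andbT (lt_le_trans y0).
- by move=> x yx; have [] := dG x (lt_trans y0 yx).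
- apply: cvg_at_right_filter; apply/differentiable_continuous/derivable1_diffP.
  by have [] := dG _ y0.
- move=> x; rewrite in_itv/= andbT => yx.
  by rewrite derive1E; have [] := dG x (lt_trans y0 yx).
Qed.

(** Reflection preserves Lebesgue measure and exchanges the positive and negative parts, whose
    integrals are therefore equal and finite. *)
Lemma integral_odd (f : R -> R) : lam.-integrable setT (EFin \o f) ->
  (forall x, f (- x) = - f x) -> (\int[lam]_x (f x)%:E = 0)%E.
Proof.
move=> intf oddf; have mf := measurable_int _ intf.
rewrite integralE.
have -> : (\int[lam]_x (fun x => (f x)%:E)^\- x = \int[lam]_x (fun x => (f x)%:E)^\+ x)%E.
  transitivity (\int[pushforward lam (-%R : _ -> measurableTypeR R)]_x (fun x => (f x)%:E)^\- x)%E.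
    by apply: eq_measure_integral => A mA _; rewrite /pushforward/= -lebesgue_measureN.
  rewrite ge0_integral_pushforward//=.
  - apply: eq_integral => x _.
    by rewrite funeposE funenegE oddf EFinN oppeK.
  - exact: measurable_funeneg.
rewrite subee// ge0_fin_numE; first exact: integral_funepos_lt_pinfty intf.
exact: integral_ge0.
Qed.

Lemma measurable_cosM (u : R) : measurable_fun setT (fun x : R => cos (x * u)).
Proof.
apply: continuous_measurable_fun => x.
apply: continuous_comp; last exact: continuous_cos.
by apply: cvgM; [exact: cvg_id|exact: cvg_cst].
Qed.

Lemma measurable_sinM (u : R) : measurable_fun setT (fun x : R => sin (x * u)).
Proof.
apply: continuous_measurable_fun => x.
apply: continuous_comp; last exact: continuous_sin.
by apply: cvgM; [exact: cvg_id|exact: cvg_cst].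
Qed.

Lemma measurable_expR_abs (e : R) : measurable_fun setT (fun x : R => expR (- (e * `|x|))).
Proof.
apply: measurableT_comp => //; apply: measurableT_comp => //.
by apply: measurable_funM => //; exact: measurableT_comp.
Qed.

Lemma integral_expR_abs (e : R) : 0 < e ->
  (\int[lam]_x (expR (- (e * `|x|)))%:E = (2 / e)%:E)%E.
Proof.
move=> e0; have := integral_expR_1cos 0 e0.
under eq_integral do rewrite mulr0 cos0 mulrC EFinM.
rewrite ge0_integralZl_EFin//=; last first.
- by apply/measurable_EFinP; exact: measurable_expR_abs.
move=> /(congr1 (fun x => (2^-1)%:E * x)%E); rewrite muleA -!EFinM.
have -> : 2^-1 * (1 + 1) = 1 :> R by field.
rewrite mul1e => ->; congr EFin; field.
by rewrite gt_eqF.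
Qed.

Lemma integrable_expR_abs (e : R) : 0 < e ->
  lam.-integrable setT (EFin \o (fun x => expR (- (e * `|x|)))).
Proof.
move=> e0; apply/integrableP; split.
  by apply/measurable_EFinP; exact: measurable_expR_abs.
under eq_integral do rewrite /= ger0_norm ?expR_ge0//.
by rewrite integral_expR_abs// ltry.
Qed.

Lemma integrable_bounded_factor d (T : measurableType d) (mu : {measure set T -> \bar R})
    (f g : T -> R) : mu.-integrable setT (EFin \o f) ->
  measurable_fun setT g -> (forall x, `|g x| <= 1) ->
  mu.-integrable setT (EFin \o (fun x => f x * g x)).
Proof.
move=> intf mg g1; have /measurable_EFinP mf := measurable_int _ intf.
apply: (le_integrable _ _ _ intf) => //.
  by apply/measurable_EFinP; exact: measurable_funM.
by move=> x _; rewrite /= lee_fin normrM ler_piMr.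
Qed.

Lemma integral_expR_cos (e u : R) : 0 < e ->
  (\int[lam]_x (expR (- (e * `|x|)) * cos (x * u))%:E =
    (2 * e / (e ^+ 2 + u ^+ 2))%:E)%E.
Proof.
move=> e0.
have := integral_expR_1cos u e0.
under eq_integral do rewrite mulrDr mulr1 EFinD.
have ic : lam.-integrable setT (EFin \o (fun x => expR (- (e * `|x|)) * cos (x * u))).
  apply: integrable_bounded_factor; first exact: integrable_expR_abs.
    exact: measurable_cosM.
  by move=> x; rewrite ler_norml cos_geN1 cos_le1.
rewrite integralD//=; last exact: integrable_expR_abs.
rewrite integral_expR_abs// => /(congr1 (fun x => x - (2 / e)%:E)%E).
rewrite addeAC subee// add0e => ->.
by rewrite -EFinB; congr EFin; ring.
Qed.

Lemma integral_expR_sin (e u : R) : 0 < e ->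
  (\int[lam]_x (expR (- (e * `|x|)) * sin (x * u))%:E = 0)%E.
Proof.
move=> e0; apply: integral_odd.
  apply: integrable_bounded_factor; first exact: integrable_expR_abs.
    exact: measurable_sinM.
  by move=> x; rewrite ler_norml sin_geN1 sin_le1.
by move=> x; rewrite normrN mulNr sinN mulrN.
Qed.

End OneDim.

(** * Product measures *)

Section ProductSigmaFinite.
Context d1 d2 (X : measurableType d1) (Y : measurableType d2) (R : realType).
Variables (mx : {sigma_finite_measure set X -> \bar R})
  (my : {sigma_finite_measure set Y -> \bar R}).

Lemma product_measure_sigma_finite : sigma_finite setT (mx \x my)%E.
Proof.
have /sigma_finiteP[F [TF ndF Foo]] := sigma_finiteT mx.
have /sigma_finiteP[G [TG ndG Goo]] := sigma_finiteT my.
exists (fun n => F n `*` G n) => [|k].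
  rewrite -setXTT TF TG predeqE => -[x y]; split=> [[/= [n _ Fnx] [k _ Gky]]|].
    exists (maxn n k) => //; split.
    - by move: x Fnx; exact/subsetPset/ndF/leq_maxl.
    - by move: y Gky; exact/subsetPset/ndG/leq_maxr.
  by move=> [n _ []/= ? ?]; split; exists n.
have [? ?] := Foo k; have [? ?] := Goo k.
split; first exact: measurableX.
by rewrite product_measure1E// lte_mul_pinfty// ge0_fin_numE.
Qed.

(* The library's own sigma-finite instance on [mx \x my] is shadowed by the one for subprobabilities. *)
Definition prod_sigma_finite : {sigma_finite_measure set (X * Y)%type -> \bar R} :=
  HB.pack_for {sigma_finite_measure set (X * Y)%type -> \bar R} (mx \x my)%E
    (Measure_isSigmaFinite.Build _ _ _ (mx \x my)%E product_measure_sigma_finite).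

End ProductSigmaFinite.

(** Fubini and Tonelli ask for a sigma-finite structure, which the type of [leb] does not record.
    The same recursion is repeated with that structure, and [leb_sfiniteE] transports results
    between the two. *)
Fixpoint leb_sfinite (R : realType) (n : nat) : {sigma_finite_measure set (Rn R n) -> \bar R} :=
  match n return {sigma_finite_measure set (Rn R n) -> \bar R} with
  | 0 => @lebesgue_measure R
  | m.+1 => prod_sigma_finite (leb_sfinite R m) (@lebesgue_measure R)
  end.

Lemma leb_sfiniteE (R : realType) (n : nat) :
  (leb_sfinite R n : {measure set (Rn R n) -> \bar R}) = leb R n.
Proof.
elim: n => [|n IH]//=.
rewrite -IH.
reflexivity.
Qed.

Section FubiniProduct.
Context d1 d2 (X : measurableType d1) (Y : measurableType d2) (R : realType).
Variables (mx : {sigma_finite_measure set X -> \bar R})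
  (my : {sigma_finite_measure set Y -> \bar R}).

Lemma measurable_fun_prodM (f : X -> R) (g : Y -> R) :
  measurable_fun setT f -> measurable_fun setT g ->
  measurable_fun setT (fun z : X * Y => f z.1 * g z.2).
Proof.
by move=> mf mg; apply: measurable_funM; exact: measurableT_comp.
Qed.

Lemma ge0_integral_prodM (f : X -> R) (g : Y -> R) :
  measurable_fun setT f -> measurable_fun setT g ->
  (forall x, 0 <= f x) -> (forall x, 0 <= g x) ->
  (\int[mx \x my]_z (f z.1 * g z.2)%:E =
   (\int[mx]_x (f x)%:E) * (\int[my]_y (g y)%:E))%E.
Proof.
move=> mf mg f0 g0.
rewrite (fubini_tonelli1 (fun z : X * Y => (f z.1 * g z.2)%:E)); last 2 first.
- by apply/measurable_EFinP; exact: measurable_fun_prodM.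
- by move=> z; rewrite lee_fin mulr_ge0.
rewrite /fubini_F /=.
under eq_integral => x _.
  under eq_integral do rewrite EFinM.
  rewrite ge0_integralZl_EFin//; [|by move=> ? _; rewrite lee_fin|exact/measurable_EFinP].
over.
rewrite ge0_integralZr//; first exact/measurable_EFinP.
  by move=> ? _; rewrite lee_fin.
by apply: integral_ge0 => y _; rewrite lee_fin.
Qed.

Lemma integrable_prodM (f : X -> R) (g : Y -> R) :
  mx.-integrable setT (EFin \o f) -> my.-integrable setT (EFin \o g) ->
  (mx \x my)%E.-integrable setT (EFin \o (fun z : X * Y => f z.1 * g z.2)).
Proof.
move=> intf intg; apply/integrableP.
have /integrableP[/measurable_EFinP mf fy] := intf.
have /integrableP[/measurable_EFinP mg gy] := intg.
split; first by apply/measurable_EFinP; exact: measurable_fun_prodM.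
under eq_integral do rewrite /= normrM.
rewrite (ge0_integral_prodM (f := fun x => `|f x|) (g := fun x => `|g x|))//;
  try exact: measurableT_comp.
by apply: lte_mul_pinfty => //; [exact: integral_ge0|rewrite ge0_fin_numE//; exact: integral_ge0].
Qed.

Lemma integral_prodM (f : X -> R) (g : Y -> R) :
  mx.-integrable setT (EFin \o f) -> my.-integrable setT (EFin \o g) ->
  (\int[mx \x my]_z (f z.1 * g z.2)%:E =
   (Rintegral mx setT f * Rintegral my setT g)%:E)%E.
Proof.
move=> intf intg.
rewrite -(integral12_prod_meas1 (integrable_prodM intf intg)) /fubini_F/=.
under eq_integral => x _.
  under eq_integral do rewrite EFinM.
  rewrite integralZl// -[X in (_ * X)%E]fineK; last exact: integrable_fin_num.
over.
rewrite integralZr// EFinM /Rintegral; congr (_ * _)%E.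
by rewrite fineK//; exact: integrable_fin_num.
Qed.

End FubiniProduct.

(** * Fatou's lemma for almost everywhere limits *)

Section FatouBound.
Context d (T : measurableType d) (R : realType) (mu : {measure set T -> \bar R}).

(** Serves twice: it removes the exponential weight in [plancherel_le], and it carries the rate of
    convergence over to the limit in [L2_complete]. *)
Lemma fatou_le (f : (T -> \bar R)^nat) (g : T -> \bar R) (M : \bar R) :
  (forall n, measurable_fun setT (f n)) -> measurable_fun setT g ->
  (forall n x, 0 <= f n x)%E -> (forall x, 0 <= g x)%E ->
  {ae mu, forall x, f n x @[n --> \oo] --> g x} ->
  (forall n, \int[mu]_x f n x <= M)%E -> (\int[mu]_x g x <= M)%E.
Proof.
move=> mf mg f0 g0 cfg fM.
have e : (\int[mu]_x g x = \int[mu]_x limn_einf (f^~ x))%E.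
  apply: ae_eq_integral => //.
    have -> : (fun x => limn_einf (f^~ x)) = (fun x => - limn_esup (fun n => - f n x))%E.
    apply/funext => x; rewrite -limn_einfN; congr limn_einf.
    by apply/funext => n /=; rewrite oppeK.
  apply: measurableT_comp => //; apply: measurable_fun_limn_esup => n.
  exact: measurableT_comp.
  by apply: filterS cfg => x fg _; rewrite (cvg_limn_einf_sup fg).1.
rewrite e (le_trans (fatou _ _ _ _))// limn_einf_lim.
apply: lime_le; first exact: is_cvg_einfs.
near=> n; apply: ge_ereal_inf.
by exists (\int[mu]_x f n x)%E => //=; exists n => //=.
Unshelve. all: by end_near. Qed.

End FatouBound.

(** * The Plancherel inequality *)

Section TTstar.
Context d1 d2 (X : measurableType d1) (Y : measurableType d2) (R : realType).
Variables (mx : {sigma_finite_measure set X -> \bar R})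
  (my : {sigma_finite_measure set Y -> \bar R}).
Variables (C S : X * Y -> R) (k : X -> R) (K : Y * Y -> R) (B : R).
Hypotheses (mC : measurable_fun setT C) (mS : measurable_fun setT S)
  (C1 : forall z, `|C z| <= 1) (S1 : forall z, `|S z| <= 1)
  (k0 : forall x, 0 <= k x) (intk : mx.-integrable setT (EFin \o k))
  (mK : measurable_fun setT K) (K0 : forall z, 0 <= K z) (B0 : 0 <= B)
  (CSK : forall s t, (\int[mx]_x (k x * (C (x, s) * C (x, t) + S (x, s) * S (x, t)))%:E =
     (K (s, t))%:E)%E)
  (KB1 : forall t, (\int[my]_s (K (s, t))%:E <= B%:E)%E)
  (KB2 : forall s, (\int[my]_t (K (s, t))%:E <= B%:E)%E).

Let mYY := prod_sigma_finite my my.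

(** [C] and [S] stand for the cosine and the sine of the scalar product. Writing the squares as
    double integrals and exchanging the order by Fubini leaves the quadratic form of [K] in [a], to
    which Schur's test applies. *)
Lemma TTstar_bound (a : Y -> R) : my.-integrable setT (EFin \o a) ->
  (\int[mx]_x (k x * (Rintegral my setT (fun t => a t * C (x, t)) ^+ 2 +
                      Rintegral my setT (fun t => a t * S (x, t)) ^+ 2))%:E <=
    B%:E * \int[my]_t (a t ^+ 2)%:E)%E.
Proof.
move=> inta.
have /measurable_EFinP mk := measurable_int _ intk.
have /measurable_EFinP ma := measurable_int _ inta.
pose W (x : X) (z : Y * Y) := C (x, z.1) * C (x, z.2) + S (x, z.1) * S (x, z.2).
pose G (w : X * (Y * Y)) := k w.1 * (a w.2.1 * a w.2.2) * W w.1 w.2.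
have mC1 : measurable_fun setT (fun w : X * (Y * Y) => C (w.1, w.2.1)).
  apply: measurableT_comp => //; apply: measurable_fun_pair => //.
  exact: measurableT_comp.
have mC2 : measurable_fun setT (fun w : X * (Y * Y) => C (w.1, w.2.2)).
  apply: measurableT_comp => //; apply: measurable_fun_pair => //.
  exact: measurableT_comp.
have mS1 : measurable_fun setT (fun w : X * (Y * Y) => S (w.1, w.2.1)).
  apply: measurableT_comp => //; apply: measurable_fun_pair => //.
  exact: measurableT_comp.
have mS2 : measurable_fun setT (fun w : X * (Y * Y) => S (w.1, w.2.2)).
  apply: measurableT_comp => //; apply: measurable_fun_pair => //.
  exact: measurableT_comp.
have mW : measurable_fun setT (fun w : X * (Y * Y) => W w.1 w.2).
  by apply: measurable_funD; apply: measurable_funM.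
have intaa : mYY.-integrable setT (EFin \o (fun z : Y * Y => a z.1 * a z.2)).
  exact: (integrable_prodM inta inta).
have intkaa : (mx \x mYY)%E.-integrable setT
    (EFin \o (fun w : X * (Y * Y) => k w.1 * (a w.2.1 * a w.2.2))).
  exact: (integrable_prodM (g := fun z : Y * Y => a z.1 * a z.2) intk intaa).
(* [W] is bounded by 2, whereas [integrable_bounded_factor] wants a factor bounded by 1; hence the
   halving. *)
have intG : (mx \x mYY)%E.-integrable setT (EFin \o G).
  have -> : EFin \o G = (fun w => 2%:E * (k w.1 * (a w.2.1 * a w.2.2) * (W w.1 w.2 / 2))%:E)%E.
    by apply/funext => w; rewrite -EFinM /G /=; congr EFin; field.
  apply: integrableZl => //; apply: integrable_bounded_factor => //.
    exact: measurable_funM.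
  move=> w; rewrite normrM [`|2^-1|]ger0_norm// ler_pdivrMr// mul1r.
  rewrite (le_trans (ler_normD _ _))// -[2]/(1 + 1) lerD// normrM mulr_ile1//.
have intaC x : my.-integrable setT (EFin \o (fun t => a t * C (x, t))).
  by apply: integrable_bounded_factor => //; exact: measurableT_comp.
have intaS x : my.-integrable setT (EFin \o (fun t => a t * S (x, t))).
  by apply: integrable_bounded_factor => //; exact: measurableT_comp.
have inner x : (\int[mYY]_z (G (x, z))%:E = (k x *
   (Rintegral my setT (fun t => a t * C (x, t)) ^+ 2 +
    Rintegral my setT (fun t => a t * S (x, t)) ^+ 2))%:E)%E.
  transitivity (\int[mYY]_z ((k x)%:E * (((a z.1 * C (x, z.1)) * (a z.2 * C (x, z.2)))%:E
      + ((a z.1 * S (x, z.1)) * (a z.2 * S (x, z.2)))%:E)))%E.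
    by apply: eq_integral => z _; rewrite -EFinD -EFinM; congr EFin; rewrite /G /W /=; ring.
  have iC : mYY.-integrable setT (EFin \o (fun z : Y * Y => (a z.1 * C (x, z.1)) * (a z.2 * C (x, z.2)))).
    exact: (integrable_prodM (intaC x) (intaC x)).
  have iS : mYY.-integrable setT (EFin \o (fun z : Y * Y => (a z.1 * S (x, z.1)) * (a z.2 * S (x, z.2)))).
    exact: (integrable_prodM (intaS x) (intaS x)).
  rewrite integralZl//; last exact: integrableD.
  rewrite integralD//.
  have -> := integral_prodM (intaC x) (intaC x).
  have -> := integral_prodM (intaS x) (intaS x).
  by rewrite -EFinD -EFinM !expr2.
under eq_integral do rewrite -inner.
have -> : (\int[mx]_x \int[mYY]_z (G (x, z))%:E = \int[mYY]_z \int[mx]_x (G (x, z))%:E)%E.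
  exact: (Fubini intG).
have outer z : (\int[mx]_x (G (x, z))%:E = (a z.1 * a z.2 * K z)%:E)%E.
  transitivity (\int[mx]_x ((a z.1 * a z.2)%:E *
      (k x * (C (x, z.1) * C (x, z.2) + S (x, z.1) * S (x, z.2)))%:E))%E.
    by apply: eq_integral => x _; rewrite -EFinM; congr EFin; rewrite /G /W/=; ring.
  rewrite integralZl//; first by rewrite CSK -EFinM -surjective_pairing.
  have -> : (fun x => (k x * (C (x, z.1) * C (x, z.2) + S (x, z.1) * S (x, z.2)))%:E) =
      (fun x => 2%:E * (k x * ((C (x, z.1) * C (x, z.2) + S (x, z.1) * S (x, z.2)) / 2))%:E)%E.
    by apply/funext => w; rewrite -EFinM /=; congr EFin; field.
  apply: integrableZl => //; apply: integrable_bounded_factor => //.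
    apply: measurable_funM => //; apply: measurable_funD; apply: measurable_funM;
      exact: measurableT_comp.
  move=> w; rewrite normrM [`|2^-1|]ger0_norm// ler_pdivrMr// mul1r.
  by rewrite (le_trans (ler_normD _ _))// -[2]/(1 + 1) lerD// normrM mulr_ile1.
under eq_integral do rewrite outer.
have maaK : measurable_fun setT (fun z : Y * Y => a z.1 * a z.2 * K z).
  by apply: measurable_funM => //; exact: measurable_fun_prodM.
have ma2 : measurable_fun setT (fun z => a z ^+ 2) by exact: measurable_funX.
rewrite (le_trans (lee_abs _))// (le_trans (le_abse_integral _ _ _))//.
  exact/measurable_EFinP.
(* Schur's test: |a(s) a(t)| <= (a(s)^2 + a(t)^2)/2. Each half is integrated first in the variable
   that occurs only in [K], so that [KB2], respectively [KB1], bounds the inner integral. *)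
pose H1 (z : Y * Y) := 2^-1 * (a z.1 ^+ 2 * K z).
pose H2 (z : Y * Y) := 2^-1 * (a z.2 ^+ 2 * K z).
have mH1 : measurable_fun setT H1.
  by do 2!apply: measurable_funM => //; apply: measurableT_comp ma2 _.
have mH2 : measurable_fun setT H2.
  by do 2!apply: measurable_funM => //; apply: measurableT_comp ma2 _.
have H10 z : 0 <= H1 z by rewrite mulr_ge0// mulr_ge0// sqr_ge0.
have H20 z : 0 <= H2 z by rewrite mulr_ge0// mulr_ge0// sqr_ge0.
have I0 : (0 <= \int[my]_t (a t ^+ 2)%:E)%E.
  by apply: integral_ge0 => t _; rewrite lee_fin sqr_ge0.
have i1 : (\int[mYY]_z (H1 z)%:E <= (B / 2)%:E * \int[my]_t (a t ^+ 2)%:E)%E.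
  have := fubini_tonelli1 (m1 := my) (m2 := my) (fun z => (H1 z)%:E).
  move=> ->; [|exact/measurable_EFinP|by move=> z; rewrite lee_fin].
  rewrite -ge0_integralZl; [|by []|exact/measurable_EFinP| |by rewrite lee_fin divr_ge0]; last first.
    by move=> t _; rewrite lee_fin sqr_ge0.
  apply: ge0_le_integral => //.
  - by move=> x _; apply: integral_ge0 => y _; rewrite lee_fin.
  - apply: measurable_fun_fubini_tonelli_F; first exact/measurable_EFinP.
    by move=> z; rewrite lee_fin.
  - by apply/measurable_EFinP; exact: measurable_funM.
  move=> s _; rewrite /fubini_F /H1/=.
  under eq_integral do rewrite mulrA EFinM.
  rewrite ge0_integralZl_EFin; [|by []|by move=> t _; rewrite lee_fin| |]; last 2 first.
  - by apply/measurable_EFinP; exact: measurableT_comp.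
  - by rewrite mulr_ge0// sqr_ge0.
  have -> : ((B / 2)%:E * (a s ^+ 2)%:E = (2^-1 * a s ^+ 2)%:E * B%:E)%E.
    by rewrite -!EFinM; congr EFin; ring.
  by apply: lee_wpmul2l => //; rewrite lee_fin mulr_ge0// sqr_ge0.
have i2 : (\int[mYY]_z (H2 z)%:E <= (B / 2)%:E * \int[my]_t (a t ^+ 2)%:E)%E.
  have := fubini_tonelli2 (m1 := my) (m2 := my) (fun z => (H2 z)%:E).
  move=> ->; [|exact/measurable_EFinP|by move=> z; rewrite lee_fin].
  rewrite -ge0_integralZl; [|by []|exact/measurable_EFinP| |by rewrite lee_fin divr_ge0]; last first.
    by move=> t _; rewrite lee_fin sqr_ge0.
  apply: ge0_le_integral => //.
  - by move=> x _; apply: integral_ge0 => y _; rewrite lee_fin.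
  - apply: measurable_fun_fubini_tonelli_G; first exact/measurable_EFinP.
    by move=> z; rewrite lee_fin.
  - by apply/measurable_EFinP; exact: measurable_funM.
  move=> s _; rewrite /fubini_G /H2/=.
  under eq_integral do rewrite mulrA EFinM.
  rewrite ge0_integralZl_EFin; [|by []|by move=> t _; rewrite lee_fin| |]; last 2 first.
  - by apply/measurable_EFinP; exact: measurableT_comp.
  - by rewrite mulr_ge0// sqr_ge0.
  have -> : ((B / 2)%:E * (a s ^+ 2)%:E = (2^-1 * a s ^+ 2)%:E * B%:E)%E.
    by rewrite -!EFinM; congr EFin; ring.
  by apply: lee_wpmul2l => //; rewrite lee_fin mulr_ge0// sqr_ge0.
apply: (@le_trans _ _ (\int[mYY]_z ((H1 z)%:E + (H2 z)%:E))%E).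
  apply: ge0_le_integral => //.
  - by apply: measurableT_comp => //; exact/measurable_EFinP.
  - by apply/measurable_EFinP; exact: measurable_funD.
  move=> z _; rewrite -EFinD abse_EFin lee_fin /H1 /H2 !normrM (ger0_norm (K0 z)).
  rewrite -[a z.1 ^+ 2]real_normK ?num_real// -[a z.2 ^+ 2]real_normK ?num_real//.
  rewrite -mulrDr -mulrDl mulrA ler_wpM2r//.
  have := sqr_ge0 (`|a z.1| - `|a z.2|); rewrite sqrrB; lra.
rewrite ge0_integralD; [|by []|by move=> z _; rewrite lee_fin|exact/measurable_EFinP
  |by move=> z _; rewrite lee_fin|exact/measurable_EFinP].
rewrite (le_trans (leeD i1 i2))// -ge0_muleDl ?lee_fin ?divr_ge0//.
by rewrite -EFinD -splitr.
Qed.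

End TTstar.

Lemma measurable_fun_Rintegral d1 d2 (X : measurableType d1) (Y : measurableType d2)
    (R : realType) (my : {sigma_finite_measure set Y -> \bar R}) (F : X * Y -> R) :
  measurable_fun setT F -> measurable_fun setT (fun x => Rintegral my setT (fun t => F (x, t))).
Proof.
move=> mF; apply: measurableT_comp => //.
have mE : measurable_fun setT (EFin \o F) by exact/measurable_EFinP.
rewrite (_ : (fun x => _) = (fun x => (fubini_F my (EFin \o F)^\+ x - fubini_F my (EFin \o F)^\- x)%E)).
  apply: emeasurable_funB; apply: measurable_fun_fubini_tonelli_F => //.
    exact: measurable_funepos.
  exact: measurable_funeneg.
apply/funext => x; rewrite integralE; congr (_ - _)%E;
  by apply: eq_integral => t _; rewrite ?funeposE ?funenegE.
Qed.

Lemma measurable_fun_section1 d1 d2 d3 (X : measurableType d1) (Y : measurableType d2)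
    (Z : measurableType d3) (F : X * Y -> Z) (y : Y) :
  measurable_fun setT F -> measurable_fun setT (fun x => F (x, y)).
Proof.
move=> mF; apply: (@measurableT_comp _ _ _ _ _ _ F _ (fun x => (x, y))) => //.
Qed.

(** * The Poisson kernel and the Plancherel inequality for real functions *)

Section Kernel.
Variable R : realType.

(** The weight exp(-e |x|) with the l^1 norm of the n + 1 coordinates instead of the Euclidean norm:
    it factors over the coordinates, so its transform is the product [poisson] of one-dimensional
    Cauchy kernels and every computation is an induction on the dimension. *)
Fixpoint absker n (e : R) : Rn R n -> R :=
  match n return Rn R n -> R with
  | 0 => fun x => expR (- (e * `|x : R|))
  | m.+1 => fun x => absker e x.1 * expR (- (e * `|x.2 : R|))
  end.

Fixpoint poisson n (e : R) : Rn R n * Rn R n -> R :=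
  match n return Rn R n * Rn R n -> R with
  | 0 => fun z => 2 * e / (e ^+ 2 + ((z.1 : R) - (z.2 : R)) ^+ 2)
  | m.+1 => fun z => poisson e (z.1.1, z.2.1) *
                     (2 * e / (e ^+ 2 + ((z.1.2 : R) - (z.2.2 : R)) ^+ 2))
  end.

Lemma measurable_dotR n :
  measurable_fun setT (fun z : Rn R n * Rn R n => dotR z.1 z.2).
Proof.
elim: n => [|n IH] /=.
  by apply: measurable_funM; [exact: measurable_fst|exact: measurable_snd].
apply: measurable_funD.
  apply: (measurableT_comp IH (g := fun z : (Rn R n * R) * (Rn R n * R) => (z.1.1, z.2.1))).
  by apply: measurable_fun_pair; apply: measurableT_comp.
by apply: (measurable_funM (f := fun z : (Rn R n * R) * (Rn R n * R) => z.1.2));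
  apply: measurableT_comp.
Qed.

Lemma measurable_cos_dotR n :
  measurable_fun setT (fun z : Rn R n * Rn R n => cos (dotR z.1 z.2)).
Proof.
apply: measurableT_comp; last exact: measurable_dotR.
by apply: continuous_measurable_fun; exact: continuous_cos.
Qed.

Lemma measurable_sin_dotR n :
  measurable_fun setT (fun z : Rn R n * Rn R n => sin (dotR z.1 z.2)).
Proof.
apply: measurableT_comp; last exact: measurable_dotR.
by apply: continuous_measurable_fun; exact: continuous_sin.
Qed.

Lemma absker_ge0 n (e : R) (x : Rn R n) : 0 <= absker e x.
Proof.
elim: n x => [|n IH] x /=; first exact: expR_ge0.
by rewrite mulr_ge0// expR_ge0.
Qed.

Lemma integrable_absker n (e : R) : 0 < e ->
  (leb_sfinite R n).-integrable setT (EFin \o @absker n e).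
Proof.
move=> e0; elim: n => [|n IH] /=; first exact: integrable_expR_abs.
exact: (integrable_prodM (mx := leb_sfinite R n) (my := @lebesgue_measure R) IH (integrable_expR_abs e0)).
Qed.

Lemma measurable_absker n (e : R) : 0 < e -> measurable_fun setT (@absker n e).
Proof. by move=> /(integrable_absker n) /measurable_int /measurable_EFinP. Qed.

Lemma poisson_ge0 n (e : R) (z : Rn R n * Rn R n) : 0 < e -> 0 <= poisson e z.
Proof.
move=> e0; have pos (x : R) : 0 <= 2 * e / (e ^+ 2 + x ^+ 2).
  by rewrite divr_ge0 ?mulr_ge0 ?addr_ge0 ?sqr_ge0// ltW.
by elim: n z => [|n IH] z /=; [exact: pos|apply: mulr_ge0].
Qed.

Lemma measurable_cauchy (e : R) : 0 < e ->
  measurable_fun setT (fun z : R * R => 2 * e / (e ^+ 2 + (z.1 - z.2) ^+ 2)).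
Proof.
move=> e0.
apply: (measurableT_comp (f := fun x : R => 2 * e / (e ^+ 2 + x ^+ 2))
  (g := fun z : R * R => z.1 - z.2)); last exact: measurable_funB.
apply: continuous_measurable_fun => x; apply: cvgM; first exact: cvg_cst.
apply: cvgV; first by rewrite gt_eqF// ltr_pwDl ?exprn_gt0 ?sqr_ge0.
apply: cvgD; first exact: cvg_cst.
exact: exprn_continuous.
Qed.

Lemma measurable_poisson n (e : R) : 0 < e -> measurable_fun setT (@poisson n e).
Proof.
move=> e0; elim: n => [|n IH] /=; first exact: measurable_cauchy.
apply: measurable_funM.
  apply: (measurableT_comp IH (g := fun z : (Rn R n * R) * (Rn R n * R) => (z.1.1, z.2.1))).
  by apply: measurable_fun_pair; apply: measurableT_comp.
apply: (measurableT_comp (measurable_cauchy e0)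
   (g := fun z : (Rn R n * R) * (Rn R n * R) => (z.1.2, z.2.2))).
by apply: measurable_fun_pair; apply: measurableT_comp.
Qed.

Lemma poissonC n (e : R) (s t : Rn R n) : poisson e (s, t) = poisson e (t, s).
Proof.
elim: n s t => [|n IH] s t /=; first by rewrite -[(s - t) ^+ 2]sqrrN opprB.
by rewrite IH -[(s.2 - t.2) ^+ 2]sqrrN opprB.
Qed.

Lemma integral_poisson n (e : R) (t : Rn R n) : 0 < e ->
  (\int[leb_sfinite R n]_s (poisson e (s, t))%:E = ((2 * pi) ^+ n.+1)%:E)%E.
Proof.
move=> e0; elim: n t => [|n IH] t /=; first by rewrite expr1; exact: integral_cauchy.
have := ge0_integral_prodM (leb_sfinite R n) (@lebesgue_measure R)
  (f := fun s => poisson e (s, t.1))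
  (g := fun s : R => 2 * e / (e ^+ 2 + (s - t.2) ^+ 2)).
move=> ->.
- by rewrite IH integral_cauchy// -EFinM -exprSr.
- exact: (measurable_fun_section1 t.1 (@measurable_poisson n e e0)).
- exact: (measurable_fun_section1 t.2 (measurable_cauchy e0)).
- by move=> s; exact: poisson_ge0.
- by move=> s; exact: (@poisson_ge0 0 e (s, t.2)).
Qed.

(** The cosine of a sum is expanded at the last coordinate. The product of sines integrates to zero
    because the one-dimensional sine integral is odd, so the induction closes with cosines alone. *)
Lemma integral_absker_cos n (e : R) (s t : Rn R n) : 0 < e ->
  (\int[leb_sfinite R n]_x (absker e x * cos (dotR x s - dotR x t))%:E = (poisson e (s, t))%:E)%E.
Proof.
move=> e0; elim: n s t => [|n IH] s t /=.
  by under eq_integral do rewrite -mulrBr; exact: integral_expR_cos.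
have mdot (s' : Rn R n) : measurable_fun setT (fun x : Rn R n => dotR x s').
  exact: (measurable_fun_section1 s' (@measurable_dotR n)).
pose A (x : Rn R n) := dotR x s.1 - dotR x t.1.
have mA : measurable_fun setT A by exact: measurable_funB.
have icos : (leb_sfinite R n).-integrable setT (EFin \o (fun x => absker e x * cos (A x))).
  apply: integrable_bounded_factor; first exact: integrable_absker.
    by apply: measurableT_comp mA; apply: continuous_measurable_fun; exact: continuous_cos.
  by move=> x; rewrite ler_norml cos_geN1 cos_le1.
have isin : (leb_sfinite R n).-integrable setT (EFin \o (fun x => absker e x * sin (A x))).
  apply: integrable_bounded_factor; first exact: integrable_absker.
    by apply: measurableT_comp mA; apply: continuous_measurable_fun; exact: continuous_sin.
  by move=> x; rewrite ler_norml sin_geN1 sin_le1.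
have icos1 : (@lebesgue_measure R).-integrable setT
    (EFin \o (fun x => expR (- (e * `|x|)) * cos (x * (s.2 - t.2)))).
  apply: integrable_bounded_factor; first exact: integrable_expR_abs.
    exact: measurable_cosM.
  by move=> x; rewrite ler_norml cos_geN1 cos_le1.
have isin1 : (@lebesgue_measure R).-integrable setT
    (EFin \o (fun x => expR (- (e * `|x|)) * sin (x * (s.2 - t.2)))).
  apply: integrable_bounded_factor; first exact: integrable_expR_abs.
    exact: measurable_sinM.
  by move=> x; rewrite ler_norml sin_geN1 sin_le1.
transitivity (\int[leb_sfinite R n.+1]_z
  (((absker e z.1 * cos (A z.1)) * (expR (- (e * `|z.2 : R|)) * cos (z.2 * (s.2 - t.2))))%:E -
   ((absker e z.1 * sin (A z.1)) * (expR (- (e * `|z.2 : R|)) * sin (z.2 * (s.2 - t.2))))%:E))%E.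
  apply: eq_integral => x _; rewrite -EFinB; congr EFin.
  rewrite (_ : _ - _ = A x.1 + x.2 * (s.2 - t.2)); last by rewrite /A; ring.
  by rewrite cosD; ring.
rewrite integralB//=; last 2 first.
- exact: (integrable_prodM icos icos1).
- exact: (integrable_prodM isin isin1).
have -> := integral_prodM icos icos1.
have -> := integral_prodM isin isin1.
rewrite /Rintegral IH integral_expR_cos// integral_expR_sin// mulr0 sube0.
by rewrite /=.
Qed.

Lemma cvg_absker n (x : Rn R n) : absker (n0.+1%:R^-1) x @[n0 --> \oo] --> (1 : R).
Proof.
have h (y : R) : expR (- (n0.+1%:R^-1 * `|y|)) @[n0 --> \oo] --> (1 : R).
  have : - (n0.+1%:R^-1 * `|y|) @[n0 --> \oo] --> (0 : R).
    rewrite -oppr0 -[X in - X](mul0r `|y|).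
    by apply: cvgN; apply: cvgM; [exact: cvg_harmonic|exact: cvg_cst].
  by move=> /(continuous_cvg _ (@continuous_expR R 0)); rewrite expR0.
elim: n x => [|n IH] x /=; first exact: h.
by rewrite -[X in _ --> X]mulr1; apply: cvgM; [exact: IH|exact: h].
Qed.

Definition cos_transform n (a : Rn R n -> R) (x : Rn R n) : R :=
  Rintegral (leb R n) setT (fun t => a t * cos (dotR x t)).
Definition sin_transform n (a : Rn R n -> R) (x : Rn R n) : R :=
  Rintegral (leb R n) setT (fun t => a t * sin (dotR x t)).

Lemma measurable_cos_transform n (a : Rn R n -> R) : measurable_fun setT a ->
  measurable_fun setT (cos_transform a).
Proof.
move=> ma; rewrite /cos_transform -leb_sfiniteE.
apply: (measurable_fun_Rintegral (leb_sfinite R n) (F := fun z => a z.2 * cos (dotR z.1 z.2))).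
by apply: measurable_funM; [exact: measurableT_comp|exact: measurable_cos_dotR].
Qed.

Lemma measurable_sin_transform n (a : Rn R n -> R) : measurable_fun setT a ->
  measurable_fun setT (sin_transform a).
Proof.
move=> ma; rewrite /sin_transform -leb_sfiniteE.
apply: (measurable_fun_Rintegral (leb_sfinite R n) (F := fun z => a z.2 * sin (dotR z.1 z.2))).
by apply: measurable_funM; [exact: measurableT_comp|exact: measurable_sin_dotR].
Qed.

(** Since cos A cos B + sin A sin B = cos(A - B), the kernel of the weighted form is [poisson]. Its
    mass, the constant here, is the same for every [e] and so survives the limit. *)
Lemma plancherel_le n (a : Rn R n -> R) : (leb R n).-integrable setT (EFin \o a) ->
  (\int[leb R n]_x (cos_transform a x ^+ 2 + sin_transform a x ^+ 2)%:E <=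
   ((2 * pi) ^+ n.+1)%:E * \int[leb R n]_t (a t ^+ 2)%:E)%E.
Proof.
move=> inta.
have /measurable_EFinP ma := measurable_int _ inta.
have mcs : measurable_fun setT (fun x => cos_transform a x ^+ 2 + sin_transform a x ^+ 2).
  by apply: measurable_funD; apply: measurable_funX; [exact: measurable_cos_transform|exact: measurable_sin_transform].
pose e (n : nat) : R := n.+1%:R^-1.
have e0 m : 0 < e m by rewrite invr_gt0.
apply: (@fatou_le _ _ _ _ (fun m x => (absker (e m) x * (cos_transform a x ^+ 2 + sin_transform a x ^+ 2))%:E)).
- by move=> m; apply/measurable_EFinP; apply: measurable_funM => //; exact: measurable_absker.
- exact/measurable_EFinP.
- by move=> m x; rewrite lee_fin mulr_ge0 ?absker_ge0// addr_ge0 ?sqr_ge0.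
- by move=> x; rewrite lee_fin addr_ge0 ?sqr_ge0.
- apply: aeW => x; apply: cvg_EFin; first by near=> m.
  rewrite -[X in _ --> X]mul1r; apply: cvgM; [exact: cvg_absker|exact: cvg_cst].
move=> m.
rewrite /cos_transform /sin_transform -leb_sfiniteE in inta *.
apply: (@TTstar_bound _ _ _ _ _ (leb_sfinite R n) (leb_sfinite R n)
   (fun z => cos (dotR z.1 z.2)) (fun z => sin (dotR z.1 z.2)) (absker (e m)) (@poisson n (e m))) => //.
- exact: measurable_cos_dotR.
- exact: measurable_sin_dotR.
- by move=> z; rewrite ler_norml cos_geN1 cos_le1.
- by move=> z; rewrite ler_norml sin_geN1 sin_le1.
- exact: integrable_absker.
- exact: measurable_poisson.
- by move=> z; exact: poisson_ge0.
- by rewrite exprn_ge0// mulr_ge0// pi_ge0.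
- by move=> s t /=; under eq_integral do rewrite -cosB; exact: integral_absker_cos.
- by move=> t; rewrite integral_poisson.
- by move=> t; under eq_integral do rewrite poissonC; rewrite integral_poisson.
Unshelve. all: by end_near. Qed.

End Kernel.

(** * Monotonicity of integrals, cut-offs and the decreasing rearrangement *)

Section IntegralMisc.
Context d (T : measurableType d) (R : realType).
Variable mu : {measure set T -> \bar R}.

(** A nonnegative integral is a supremum over the simple functions below the integrand, which is
    monotone for arbitrary functions. This covers integrands built from the rearrangement without a
    study of their measurability. *)
Lemma ge0_le_integral_nomeas (f g : T -> \bar R) :
  (forall x, 0 <= f x)%E -> (forall x, f x <= g x)%E ->
  (\int[mu]_x f x <= \int[mu]_x g x)%E.
Proof.
move=> f0 fg; rewrite !ge0_integralTE//; last by move=> x; exact: le_trans (f0 x) (fg x).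
apply: le_ereal_sup.
by move=> _ [h hf <-]; exists h => //= x; exact: le_trans (hf x) (fg x).
Qed.

Lemma measurable_fun_natb (b : T -> bool) :
  measurable_fun setT b -> measurable_fun setT (fun x => (b x)%:R : R).
Proof.
move=> mb; rewrite (_ : (fun x => _) = (fun x => if b x then 1 else 0 : R)).
  exact: measurable_fun_ifT.
by apply/funext => x; case: (b x).
Qed.

Lemma integral_natb (D : set T) (b : T -> bool) (f : T -> R) :
  (forall x, D x <-> b x) ->
  (\int[mu]_(x in D) (f x)%:E = \int[mu]_x (f x * (b x)%:R)%:E)%E.
Proof.
move=> Db; rewrite integral_mkcond; apply: eq_integral => x _.
rewrite patchE; case: ifPn => [/set_mem/Db ->|/negP nD]; first by rewrite mulr1.
by rewrite (_ : b x = false) ?mulr0//; apply/negbTE/negP => /Db/mem_set.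
Qed.

Lemma integral_natb1 (D : set T) (b : T -> bool) : measurable D ->
  (forall x, D x <-> b x) -> (\int[mu]_x ((b x)%:R : R)%:E = mu D)%E.
Proof.
move=> mD Db; rewrite -[X in mu X]setIT -integral_indic//; apply: eq_integral => x _.
by rewrite indicE; congr ((nat_of_bool _)%:R%:E); apply/idP/idP => [/Db/mem_set|/set_mem/Db].
Qed.

(** For [u] the modulus of [w] and Lebesgue measure this is [rearr w] by conversion; the
    interpolation argument runs on an arbitrary sigma-finite space. *)
Definition decr_rearr (u : T -> R) (t : R) : \bar R :=
  ereal_inf [set tau%:E | tau in [set tau : R | 0 < tau /\ (mu [set x | (tau < u x)%R] <= t%:E)%E]].

Lemma decr_rearr_ge0 u t : (0 <= decr_rearr u t)%E.
Proof.
by apply/ereal_infP => _ [tau /= [tau0 _] <-]; rewrite lee_fin ltW.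
Qed.

Lemma lt_decr_rearr u t s : 0 < s -> (s%:E < decr_rearr u t)%E -> (t%:E < mu [set x | (s < u x)%R])%E.
Proof.
move=> s0 srear; rewrite ltNge; apply/negP => h.
move: srear; rewrite ltNge => /negP; apply.
by apply: ge_ereal_inf; exists s%:E => //; exists s.
Qed.

End IntegralMisc.

(** * Real interpolation into the Lorentz space *)

Section Marcinkiewicz.
Context d (X : measurableType d) (R : realType).
Variable mu : {sigma_finite_measure set X -> \bar R}.
Local Notation lam := (@lebesgue_measure R).
Variables (u phi : X -> R) (p M K : R).
Hypotheses (mu_ : measurable_fun setT u) (mphi : measurable_fun setT phi)
  (u0 : forall x, 0 <= u x) (phi0 : forall x, 0 <= phi x)
  (p1 : 1 < p) (p2 : p < 2) (M0 : 0 < M) (K0 : 0 <= K).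

(** With [phi = |f|], [A s] is the L^1 norm of the part of f above height s, and [B s] the squared
    L^2 norm of the part below. In the hypothesis [split], [M * A s] bounds the transform of the
    first part uniformly and [v] is the modulus of the transform of the second. *)
Let A (s : R) : \bar R := (\int[mu]_x (phi x * (s < phi x)%R%:R)%:E)%E.
Let B (s : R) : \bar R := (\int[mu]_x (phi x ^+ 2 * (phi x <= s)%R%:R)%:E)%E.

Hypothesis split : forall s, 0 < s -> exists v : X -> R,
  [/\ measurable_fun setT v, (forall x, 0 <= v x),
      {ae mu, forall x, ((u x)%:E <= M%:E * A s + (v x)%:E)%E} &
      (\int[mu]_x (v x ^+ 2)%:E <= K%:E * B s)%E].

(** With z = (t, s): Paley's measure dt/t^2 times the layer-cake density p s^(p-1) ds, on the region
    t < |{t u > s}|. Integrated in s it dominates the Lorentz integrand; integrated in t it involves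
    only the distribution function of [u], which the splitting at height s controls. *)
Let layer (z : R * R) : R := p * z.2 `^ (p - 1) * z.1 `^ (-2) *
  [&& 0 < z.1, 0 < z.2 & (z.1%:E < mu [set x | (z.2 < z.1 * u x)%R])%E]%:R.

Lemma layer_ge0 z : 0 <= layer z.
Proof. by rewrite !mulr_ge0 ?powR_ge0// ltW// (lt_trans _ p1). Qed.

Lemma measurable_scaled_distf :
  measurable_fun setT (fun z : R * R => mu [set x | (z.2 < z.1 * u x)%R]).
Proof.
rewrite (_ : (fun z => _) = fubini_F mu (fun w : (R * R) * X => ((w.1.2 < w.1.1 * u w.2)%R%:R)%:E)).
  apply: measurable_fun_fubini_tonelli_F; last by move=> w; rewrite lee_fin.
  apply/measurable_EFinP; apply: measurable_fun_natb; apply: measurable_fun_ltr.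
    by apply: (measurableT_comp (f := snd)).
  apply: measurable_funM.
    by apply: (measurableT_comp (f := fst)).
  exact: measurableT_comp.
apply/funext => z; rewrite /fubini_F/=.
have mS : measurable [set x | (z.2 < z.1 * u x)%R].
  rewrite -[X in measurable X]setTI.
  apply: (measurable_fun_ltr (f := cst z.2) (g := fun x => z.1 * u x)) => //.
  exact: measurable_funM.
by rewrite (integral_natb1 mu mS).
Qed.

Lemma measurable_layer : measurable_fun setT layer.
Proof.
apply: measurable_funM.
  apply: measurable_funM.
    apply: measurable_funM => //.
    exact: (measurableT_comp (measurable_powR _) (measurable_snd)).
  exact: (measurableT_comp (measurable_powR _) (measurable_fst)).
apply: measurable_fun_natb; apply: measurable_and.
  by apply: measurable_fun_ltr => //; exact: measurable_fst.
apply: measurable_and.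
  by apply: measurable_fun_ltr => //; exact: measurable_snd.
apply: measurable_fun_lte; last exact: measurable_scaled_distf.
by apply/measurable_EFinP; exact: measurable_fst.
Qed.

(** If 0 < s < z, then s/t lies below the rearrangement at t, hence {u > s/t} has measure above t
    and (t, s) belongs to the region of [layer]. Integrating p s^(p-1) over ]0, z[ gives z^p. *)
Lemma layer_cake t z : 0 < t -> 0 <= z -> (z%:E <= t%:E * decr_rearr mu u t)%E ->
  ((z `^ p * t `^ (-2))%:E <= \int[lam]_s (layer (t, s))%:E)%E.
Proof.
move=> t0; rewrite le_eqVlt => /predU1P[<- _|z0 zt].
  rewrite powR0 ?gt_eqF ?(lt_trans _ p1)// mul0r.
  by apply: integral_ge0 => s _; rewrite lee_fin layer_ge0.
apply: (@le_trans _ _ (\int[lam]_s ((p * s `^ (p - 1) * t `^ (-2)) * ((0 < s) && (s < z))%R%:R)%:E)%E).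
  rewrite -(integral_natb lam (D := `]0, z[%classic)); last first.
    by move=> s /=; rewrite in_itv/=.
  rewrite (@integral_itv_bndo_bndc _ (BRight 0) z (fun s => (p * s `^ (p - 1) * t `^ (-2))%:E)); last first.
    by apply/measurable_EFinP; apply: measurable_funTS; do 2!apply: measurable_funM => //; exact: measurable_powR.
  under eq_integral do rewrite mulrAC EFinM.
  rewrite ge0_integralZl_EFin//; last 3 first.
  - by move=> s _; rewrite lee_fin powR_ge0.
  - by apply/measurable_EFinP; apply: measurable_funTS; exact: measurable_powR.
  - by rewrite mulr_ge0 ?powR_ge0// ltW// (lt_trans _ p1).
  rewrite integral_powR_near0//; last by rewrite ltrBrDr addNr (lt_trans _ p1).
  rewrite -EFinM lee_fin subrK le_eqVlt; apply/orP; left; apply/eqP; field.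
  by rewrite gt_eqF// (lt_trans _ p1).
apply: ge0_le_integral => //.
- by move=> s _; rewrite lee_fin !mulr_ge0 ?powR_ge0// ltW// (lt_trans _ p1).
- apply/measurable_EFinP; apply: measurable_funM.
    by do 2!apply: measurable_funM => //; exact: measurable_powR.
  by apply: measurable_fun_natb; apply: measurable_and; apply: measurable_fun_ltr.
- apply/measurable_EFinP.
  exact: (measurableT_comp measurable_layer (measurable_pair1 t)).
move=> s _; rewrite lee_fin /layer/= t0/=.
apply: ler_wpM2l; first by rewrite !mulr_ge0 ?powR_ge0// ltW// (lt_trans _ p1).
have [s0|] := ltP 0 s => //=; case: (ltP s z) => //= sz.
rewrite (_ : (_ < _)%E = true)//.
have : ((s / t)%:E < decr_rearr mu u t)%E.
  rewrite -(@lte_pmul2l _ t%:E)// ?lte_fin//; apply: (lt_le_trans _ zt).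
  by rewrite -EFinM lte_fin mulrC divfK ?gt_eqF.
move=> /lt_decr_rearr; rewrite divr_gt0// => /(_ isT) h.
rewrite (_ : [set x | _] = [set x | s / t < u x])//.
by apply/seteqP; split => x /=; rewrite ltr_pdivrMr// mulrC.
Qed.

(** Since p/p' = p - 1, the Lorentz integrand equals (t u*(t))^p / t^2, which is the left side of
    [layer_cake] for z = t u*(t). *)
Lemma lorentz_integrand t : 0 < t ->
  (((t `^ (conjexp p)^-1)%:E * decr_rearr mu u t) `^ p * (t^-1)%:E <= \int[lam]_s (layer (t, s))%:E)%E.
Proof.
move=> t0.
have pe : ((t `^ (conjexp p)^-1) `^ p * t^-1) = t `^ p * t `^ (-2).
  rewrite -(powR_inv1 (ltW t0)) -powRrM -!powRD ?(gt_eqF t0) ?implybT//; congr (_ `^ _).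
  rewrite /conjexp invf_div; field.
  by rewrite gt_eqF// (lt_trans _ p1).
have [y0 U] := (decr_rearr_ge0 mu u t, erefl (decr_rearr mu u t)).
case: {-1}(decr_rearr mu u t) U y0 => [y| |] Uy; [|move=> _|by []]; last first.
  rewrite [leRHS](_ : _ = +oo%E) ?leey//; apply: eq_infty => r.
  (* Where the rearrangement is infinite every finite z is admissible; this one gives z^p t^(-2) =
     |r|, with r arbitrary. *)
  pose z := (`|r| * t `^ 2) `^ p^-1.
  have pN0 : p != 0 by rewrite gt_eqF// (lt_trans _ p1).
  apply: le_trans (@layer_cake t z t0 (powR_ge0 _ _) _); last first.
    by rewrite Uy gt0_muley ?leey// lte_fin.
  rewrite lee_fin /z -powRrM mulVf// powRr1 ?mulr_ge0 ?powR_ge0// -mulrA -powRD ?(gt_eqF t0) ?implybT//.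
  by rewrite subrr powRr0 mulr1 ler_norm.
rewrite lee_fin => y0.
rewrite (_ : (_%:E * y%:E)%E = (t `^ (conjexp p)^-1 * y)%:E)// poweR_EFin -EFinM.
apply: le_trans (@layer_cake t (t * y) t0 (mulr_ge0 (ltW t0) y0) _); last by rewrite Uy EFinM.
by rewrite lee_fin !powRM ?powR_ge0 ?(ltW t0)// mulrAC pe mulrAC.
Qed.

Lemma ae_le_measure (S S' : set X) : measurable S -> measurable S' ->
  {ae mu, forall x, S x -> S' x} -> (mu S <= mu S')%E.
Proof.
move=> mS mS' SS'; rewrite -[X in mu X]setIT -[X in (_ <= mu X)%E]setIT -!integral_indic//.
apply: ae_ge0_le_integral => //.
- exact/measurable_EFinP.
- exact/measurable_EFinP.
apply: filterS SS' => x h _; rewrite lee_fin !indicE.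
by case: (boolP (x \in S)) => // /set_mem /h /mem_set ->.
Qed.

Lemma measurable_superlevel (f : X -> R) (s t : R) : measurable_fun setT f ->
  measurable [set x | s < t * f x].
Proof.
move=> mf; rewrite -[X in measurable X]setTI.
apply: (measurable_fun_ltr (f := cst s) (g := fun x => t * f x)) => //.
exact: measurable_funM.
Qed.

Lemma tail_powR (a y : R) : a < -1 -> 0 < y ->
  (\int[lam]_t (t `^ a * (y <= t)%R%:R)%:E = (y `^ (a + 1) / - (a + 1))%:E)%E.
Proof.
move=> a1 y0; rewrite -integral_powR_nearoo// (integral_natb lam (D := `[y, +oo[%classic) (b := fun t => y <= t))//.
by move=> t /=; rewrite in_itv/= andbT.
Qed.

(** If 2tM A(s) > s, then t is at least s / (2M A(s)), and the tail of t^(-2) gives the first term.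
    Otherwise t u > s forces 2tv > s almost everywhere, and the second term is a Chebyshev-type
    estimate with the L^2 bound on v. [f1] and [f2] are the two cases. *)
Lemma scaled_distf_bound s : 0 < s ->
  (\int[lam]_t (t `^ (-2) * [&& 0 < t & (t%:E < mu [set x | (s < t * u x)%R])%E]%R%:R)%:E <=
   (2 * M / s)%:E * A s + (2 * K / s ^+ 2)%:E * B s)%E.
Proof.
move=> s0; have [v [mv v0 uv vB]] := split s0.
have A0 : (0 <= A s)%E by apply: integral_ge0 => x _; rewrite lee_fin mulr_ge0.
pose f1 (t : R) : \bar R := (t `^ (-2) * [&& 0 < t & (s%:E < (2 * t)%:E * (M%:E * A s))%E]%R%:R)%:E.
pose F2 (z : R * X) := z.1 `^ (-3) * ((0 < z.1) && (s < 2 * z.1 * v z.2))%R%:R.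
pose f2 (t : R) : \bar R := (\int[mu]_x (F2 (t, x))%:E)%E.
have F20 z : 0 <= F2 z by rewrite mulr_ge0 ?powR_ge0.
have mF2 : measurable_fun setT F2.
  apply: measurable_funM; first exact: (measurableT_comp (measurable_powR _) measurable_fst).
  apply: measurable_fun_natb; apply: measurable_and.
    by apply: measurable_fun_ltr => //; exact: measurable_fst.
  apply: measurable_fun_ltr => //; apply: measurable_funM; last exact: measurableT_comp.
  by apply: measurable_funM => //; exact: measurable_fst.
have f20 t : (0 <= f2 t)%E by apply: integral_ge0 => x _; rewrite lee_fin.
have f10 t : (0 <= f1 t)%E by rewrite lee_fin mulr_ge0 ?powR_ge0.
have mf1 : measurable_fun setT f1.
  apply/measurable_EFinP; apply: measurable_funM; first exact: measurable_powR.
  apply: measurable_fun_natb; apply: measurable_and.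
    by apply: measurable_fun_ltr.
  apply: measurable_fun_lte => //; apply: emeasurable_funM => //.
  by apply/measurable_EFinP; exact: measurable_funM.
have mf2 : measurable_fun setT f2.
  apply: (measurable_fun_fubini_tonelli_F (m2 := mu) (fun z => (F2 z)%:E)) => //.
  exact/measurable_EFinP.
apply: (@le_trans _ _ (\int[lam]_t (f1 t + f2 t))%E).
  apply: ge0_le_integral_nomeas => t; first by rewrite lee_fin mulr_ge0 ?powR_ge0.
  have [t0|_] := ltP 0 t; last by rewrite mulr0 adde_ge0.
  case: (boolP (_ < mu _)%E) => [tu|_]; last by rewrite mulr0 adde_ge0.
  rewrite mulr1 /f1 t0/=.
  case: ltP => [_|sA]; first by rewrite mulr1 leeDl.
  rewrite mulr0 add0e /f2 /F2/= t0/=.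
  (* One factor t is traded for the measure of {2tv > s}, which exceeds t here. Tonelli then
     integrates t^(-3) over t > s/(2v), which produces v^2. *)
  have t3 : t `^ (-2) = t `^ (-3) * t.
    by rewrite -{3}[t]powRr1 ?(ltW t0)// -powRD ?(gt_eqF t0) ?implybT//; congr (_ `^ _); ring.
  rewrite t3 EFinM; under eq_integral do rewrite EFinM.
  rewrite ge0_integralZl_EFin ?powR_ge0//; last 1 first.
  - apply/measurable_EFinP; apply: measurable_fun_natb; apply: measurable_fun_ltr => //.
    exact: measurable_funM.
  apply: lee_wpmul2l; first by rewrite lee_fin powR_ge0.
  rewrite (integral_natb1 mu (D := [set x | s < 2 * t * v x]))//.
    rewrite (le_trans (ltW tu))// ae_le_measure//; try exact: measurable_superlevel.
    apply: filterS uv => x uv /= su.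
    have : ((t * u x)%:E <= t%:E * (M%:E * A s) + (t * v x)%:E)%E.
      rewrite !EFinM -ge0_muleDr ?mule_ge0 ?lee_fin ?(ltW M0)//.
      by apply: lee_wpmul2l => //; rewrite lee_fin ltW.
    move: sA; rewrite EFinM -muleA.
    case: (M%:E * A s)%E => [r| |].
    - rewrite -!EFinM -EFinD !lee_fin; lra.
    - by rewrite gt0_muley ?lte_fin// gt0_muley ?lte_fin//.
    - by rewrite gt0_muleNy ?lte_fin// gt0_muleNy ?lte_fin//.
  exact: measurable_superlevel.
rewrite ge0_integralD//; apply: leeD.
- move Aa : (A s) A0 => [a| |//]; last first.
    by move=> _; rewrite gt0_muley ?leey// lte_fin !mulr_gt0 ?invr_gt0.
  rewrite lee_fin le_eqVlt => /predU1P[a0|a0].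
    rewrite -a0 mule0 (_ : (\int[lam]_t f1 t = 0)%E)//; apply: integral0_eq => t _.
    by rewrite /f1 Aa -a0 !mule0 lte_fin [s < 0]ltNge (ltW s0) andbF mulr0.
  pose y := s / (2 * M * a).
  have y0 : 0 < y by rewrite divr_gt0// !mulr_gt0.
  apply: (@le_trans _ _ (\int[lam]_t (t `^ (-2) * (y <= t)%R%:R)%:E)%E).
    apply: ge0_le_integral_nomeas => // t.
    rewrite lee_fin ler_wpM2l ?powR_ge0// Aa -!EFinM lte_fin.
    case: ltP => //= t0; case: ltP => //= st; rewrite (_ : (y <= t) = true)//.
    by rewrite /y ler_pdivrMr ?mulr_gt0// ltW//; lra.
  rewrite tail_powR//; last by lra.
  rewrite -EFinM lee_fin.
  rewrite (_ : -2 + 1 = -1); last by ring.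
  by rewrite powR_inv1 ?(ltW y0)// opprK divr1 /y invf_div; lra.
- rewrite (fubini_tonelli (m1 := lam) (m2 := mu) (fun z => (F2 z)%:E)) => [| |z]; last 2 first.
  - exact/measurable_EFinP.
  - by rewrite lee_fin.
  apply: (@le_trans _ _ ((2 / s ^+ 2)%:E * \int[mu]_x (v x ^+ 2)%:E)%E); last first.
    rewrite (_ : 2 * K / s ^+ 2 = 2 / s ^+ 2 * K); last by rewrite mulrAC.
    rewrite [in leRHS]EFinM -[leRHS]muleA.
    by apply: lee_wpmul2l => //; rewrite lee_fin divr_ge0// sqr_ge0.
  rewrite -ge0_integralZl_EFin//; last 3 first.
  - by move=> x _; rewrite lee_fin sqr_ge0.
  - by apply/measurable_EFinP; exact: measurable_funX.
  - by rewrite divr_ge0// sqr_ge0.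
  apply: ge0_le_integral_nomeas => x.
    by apply: integral_ge0 => t _; rewrite lee_fin.
  have := v0 x; rewrite le_eqVlt => /predU1P[vx0|vx].
    rewrite integral0_eq; first by rewrite -vx0 expr0n/= mule0.
    move=> t _; rewrite /F2/= -vx0 mulr0 [s < 0]ltNge (ltW s0)/=.
    by rewrite andbF mulr0.
  pose y := s / (2 * v x).
  have y0 : 0 < y by rewrite divr_gt0// !mulr_gt0.
  apply: (@le_trans _ _ (\int[lam]_t (t `^ (-3) * (y <= t)%R%:R)%:E)%E).
    apply: ge0_le_integral_nomeas => // t; first by rewrite lee_fin.
    rewrite lee_fin ler_wpM2l ?powR_ge0//=.
    case: ltP => //= t0; case: ltP => //= st; rewrite (_ : (y <= t) = true)//.
    by rewrite /y ler_pdivrMr ?mulr_gt0// ltW//; lra.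
  rewrite tail_powR//; last by lra.
  rewrite -EFinM lee_fin.
  rewrite (_ : -3 + 1 = - 2%:R); last by ring.
  rewrite powR_invn ?(ltW y0)// opprK /y le_eqVlt; apply/orP; left; apply/eqP; field.
  by rewrite !gt_eqF.
Qed.

(** After Tonelli the inner integral of s^(p-2) over ]0, phi[ is phi^(p-1)/(p-1); it converges at 0
    because p > 1. In [integral_B] the integral of s^(p-3) over [phi, +oo[ converges because p <
    2. *)
Lemma integral_A :
  (\int[lam]_s \int[mu]_x (s `^ (p - 2) * (0 < s)%R%:R * (phi x * (s < phi x)%R%:R))%:E
   <= (p - 1)^-1%:E * \int[mu]_x (phi x `^ p)%:E)%E.
Proof.
pose F (z : R * X) := z.1 `^ (p - 2) * (0 < z.1)%R%:R * (phi z.2 * (z.1 < phi z.2)%R%:R).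
have F0 z : 0 <= F z by rewrite !mulr_ge0 ?powR_ge0.
have mphi2 : measurable_fun setT (fun z : R * X => phi z.2) by exact: measurableT_comp.
have mF : measurable_fun setT F.
  apply: measurable_funM; apply: measurable_funM => //.
  - exact: (measurableT_comp (measurable_powR _) measurable_fst).
  - by apply: measurable_fun_natb; apply: measurable_fun_ltr => //; exact: measurable_fst.
  - by apply: measurable_fun_natb; apply: measurable_fun_ltr => //; exact: measurable_fst.
rewrite (fubini_tonelli (m1 := lam) (m2 := mu) (fun z => (F z)%:E)) => [| |z]; last 2 first.
- exact/measurable_EFinP.
- by rewrite lee_fin.
have mphip : measurable_fun setT (fun x => phi x `^ p).
  exact: (measurableT_comp (measurable_powR _) mphi).
rewrite -ge0_integralZl_EFin; [|by []|by move=> x _; rewrite lee_fin powR_ge0|exact/measurable_EFinP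
  |by rewrite invr_ge0 subr_ge0 ltW].
apply: ge0_le_integral_nomeas => x.
  by apply: integral_ge0 => t _; rewrite lee_fin.
have := phi0 x; rewrite le_eqVlt => /predU1P[vx0|vx].
  rewrite integral0_eq; first by rewrite mule_ge0// lee_fin ?powR_ge0// invr_ge0 subr_ge0 ltW.
  by move=> t _; rewrite /F/= -vx0 mul0r mulr0.
apply: (@le_trans _ _ (\int[lam]_s ((phi x)%:E * (s `^ (p - 2) * (0 < s <= phi x)%R%:R)%:E))%E).
  apply: ge0_le_integral_nomeas => s; first by rewrite lee_fin.
  rewrite -EFinM lee_fin /F/= mulrACA [leRHS]mulrCA [leRHS]mulrA.
  apply: ler_wpM2l; first by rewrite mulr_ge0 ?powR_ge0.
  by case: (ltP 0 s) => //= s0; rewrite ?mul0r// mul1r; case: (ltgtP s (phi x)).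
rewrite ge0_integralZl_EFin; [|by []|by move=> s _; rewrite lee_fin mulr_ge0 ?powR_ge0| |exact: ltW]; last first.
  apply/measurable_EFinP; apply: measurable_funM; first exact: measurable_powR.
  by apply: measurable_fun_natb; apply: measurable_and; [apply: measurable_fun_ltr|apply: measurable_fun_ler].
rewrite -(integral_natb lam (D := `]0, phi x]%classic)); last first.
  by move=> s /=; rewrite in_itv/=.
rewrite integral_powR_near0//; last by rewrite ltrBrDr (_ : -1 + 2 = 1)//; ring.
rewrite -!EFinM lee_fin (_ : p - 2 + 1 = p - 1); last by ring.
by rewrite mulrA mulr_powRB1 ?(ltW vx)// ?(lt_trans _ p1)// mulrC.
Qed.

Lemma integral_B :
  (\int[lam]_s \int[mu]_x (s `^ (p - 3) * (0 < s)%R%:R * (phi x ^+ 2 * (phi x <= s)%R%:R))%:E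
   <= (2 - p)^-1%:E * \int[mu]_x (phi x `^ p)%:E)%E.
Proof.
pose F (z : R * X) := z.1 `^ (p - 3) * (0 < z.1)%R%:R * (phi z.2 ^+ 2 * (phi z.2 <= z.1)%R%:R).
have F0 z : 0 <= F z by rewrite !mulr_ge0 ?powR_ge0 ?sqr_ge0.
have mphi2 : measurable_fun setT (fun z : R * X => phi z.2) by exact: measurableT_comp.
have mF : measurable_fun setT F.
  apply: measurable_funM; apply: measurable_funM => //.
  - exact: (measurableT_comp (measurable_powR _) measurable_fst).
  - by apply: measurable_fun_natb; apply: measurable_fun_ltr => //; exact: measurable_fst.
  - exact: measurable_funX.
  - by apply: measurable_fun_natb; apply: measurable_fun_ler => //; exact: measurable_fst.
rewrite (fubini_tonelli (m1 := lam) (m2 := mu) (fun z => (F z)%:E)) => [| |z]; last 2 first.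
- exact/measurable_EFinP.
- by rewrite lee_fin.
have mphip : measurable_fun setT (fun x => phi x `^ p).
  exact: (measurableT_comp (measurable_powR _) mphi).
rewrite -ge0_integralZl_EFin; [|by []|by move=> x _; rewrite lee_fin powR_ge0|exact/measurable_EFinP
  |by rewrite invr_ge0 subr_ge0 ltW].
apply: ge0_le_integral_nomeas => x.
  by apply: integral_ge0 => t _; rewrite lee_fin.
have := phi0 x; rewrite le_eqVlt => /predU1P[vx0|vx].
  rewrite integral0_eq; first by rewrite mule_ge0// lee_fin ?powR_ge0// invr_ge0 subr_ge0 ltW.
  by move=> t _; rewrite /F/= -vx0 expr0n/= mul0r mulr0.
apply: (@le_trans _ _ (\int[lam]_s ((phi x ^+ 2)%:E * (s `^ (p - 3) * (phi x <= s)%R%:R)%:E))%E).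
  apply: ge0_le_integral_nomeas => s; first by rewrite lee_fin.
  rewrite -EFinM lee_fin /F/= mulrACA [leRHS]mulrCA [leRHS]mulrA.
  apply: ler_wpM2l; first by rewrite mulr_ge0 ?powR_ge0 ?sqr_ge0.
  by rewrite ler_piMl//; case: (0 < s).
rewrite ge0_integralZl_EFin; [|by []|by move=> s _; rewrite lee_fin mulr_ge0 ?powR_ge0| |exact: sqr_ge0]; last first.
  apply/measurable_EFinP; apply: measurable_funM; first exact: measurable_powR.
  by apply: measurable_fun_natb; apply: measurable_fun_ler.
rewrite tail_powR//; last by rewrite ltrBlDr (lt_le_trans p2)// (_ : -1 + 3 = 2)//; ring.
rewrite -!EFinM lee_fin (_ : p - 3 + 1 = p - 2); last by ring.
rewrite opprB mulrA -powR_mulrn ?(ltW vx)// -powRD ?(gt_eqF vx) ?implybT//.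
by rewrite addrC subrK mulrC.
Qed.

(** Tonelli on [layer]: multiplied by p s^(p-1), the two terms of [scaled_distf_bound] become the
    integrands s^(p-2) A(s) and s^(p-3) B(s). *)
Lemma marcinkiewicz :
  (\int[lam]_(t in `]0%R, +oo[)
     (((t `^ (conjexp p)^-1)%:E * decr_rearr mu u t) `^ p * (t^-1)%:E) <=
   (2 * M * p / (p - 1) + 2 * K * p / (2 - p))%:E * \int[mu]_x (phi x `^ p)%:E)%E.
Proof.
have pp : 0 < p by exact: lt_trans p1.
apply: (@le_trans _ _ (\int[lam]_t \int[lam]_s (layer (t, s))%:E)%E).
  rewrite integral_mkcond; apply: ge0_le_integral_nomeas => t.
    rewrite patchE; case: ifPn => // /set_mem/=; rewrite in_itv/= andbT => t0.
    by rewrite mule_ge0 ?poweR_ge0// lee_fin invr_ge0 ltW.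
  rewrite patchE; case: ifPn => [/set_mem/=|_].
    by rewrite in_itv/= andbT => t0; exact: lorentz_integrand.
  by apply: integral_ge0 => s _; rewrite lee_fin layer_ge0.
rewrite (fubini_tonelli (m1 := lam) (m2 := lam) (fun z => (layer z)%:E)) => [| |z]; last 2 first.
- by apply/measurable_EFinP; exact: measurable_layer.
- by rewrite lee_fin layer_ge0.
pose GA s := (\int[mu]_x (s `^ (p - 2) * (0 < s)%R%:R * (phi x * (s < phi x)%R%:R))%:E)%E.
pose GB s := (\int[mu]_x (s `^ (p - 3) * (0 < s)%R%:R * (phi x ^+ 2 * (phi x <= s)%R%:R))%:E)%E.
have GA0 s : (0 <= GA s)%E by apply: integral_ge0 => x _; rewrite lee_fin !mulr_ge0 ?powR_ge0.
have GB0 s : (0 <= GB s)%E by apply: integral_ge0 => x _; rewrite lee_fin !mulr_ge0 ?powR_ge0 ?sqr_ge0.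
have mphi2 : measurable_fun setT (fun z : R * X => phi z.2) by exact: measurableT_comp.
have mGA : measurable_fun setT GA.
  apply: (measurable_fun_fubini_tonelli_F (m2 := mu)
    (fun z => (z.1 `^ (p - 2) * (0 < z.1)%R%:R * (phi z.2 * (z.1 < phi z.2)%R%:R))%:E)).
    apply/measurable_EFinP; apply: measurable_funM; apply: measurable_funM => //.
    - exact: (measurableT_comp (measurable_powR _) measurable_fst).
    - by apply: measurable_fun_natb; apply: measurable_fun_ltr => //; exact: measurable_fst.
    - by apply: measurable_fun_natb; apply: measurable_fun_ltr => //; exact: measurable_fst.
  by move=> z; rewrite lee_fin !mulr_ge0 ?powR_ge0.
have mGB : measurable_fun setT GB.
  apply: (measurable_fun_fubini_tonelli_F (m2 := mu)
    (fun z => (z.1 `^ (p - 3) * (0 < z.1)%R%:R * (phi z.2 ^+ 2 * (phi z.2 <= z.1)%R%:R))%:E)).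
    apply/measurable_EFinP; apply: measurable_funM; apply: measurable_funM => //.
    - exact: (measurableT_comp (measurable_powR _) measurable_fst).
    - by apply: measurable_fun_natb; apply: measurable_fun_ltr => //; exact: measurable_fst.
    - exact: measurable_funX.
    - by apply: measurable_fun_natb; apply: measurable_fun_ler => //; exact: measurable_fst.
  by move=> z; rewrite lee_fin !mulr_ge0 ?powR_ge0 ?sqr_ge0.
have cA0 : 0 <= 2 * M * p by rewrite !mulr_ge0// ltW.
have cB0 : 0 <= 2 * K * p by rewrite !mulr_ge0// ltW.
apply: (@le_trans _ _ (\int[lam]_s ((2 * M * p)%:E * GA s + (2 * K * p)%:E * GB s))%E).
  apply: ge0_le_integral_nomeas => s.
    by apply: integral_ge0 => t _; rewrite lee_fin layer_ge0.
  have [s0|s0] := ltP 0 s; last first.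
    rewrite integral0_eq; first by rewrite adde_ge0// mule_ge0.
    by move=> t _; rewrite /layer/= [0 < s]ltNge s0/= andbF mulr0.
  under eq_integral => t _ do rewrite /layer/= s0/= -mulrA EFinM.
  rewrite ge0_integralZl_EFin; [|by []|by move=> t _; rewrite lee_fin mulr_ge0 ?powR_ge0| |]; last 2 first.
  - apply/measurable_EFinP; apply: measurable_funM; first exact: measurable_powR.
    apply: measurable_fun_natb; apply: measurable_and.
      by apply: measurable_fun_ltr.
    apply: measurable_fun_lte => //.
    exact: (measurable_fun_section1 s measurable_scaled_distf).
  - by rewrite mulr_ge0 ?powR_ge0// ltW.
  apply: (@le_trans _ _ ((p * s `^ (p - 1))%:E * ((2 * M / s)%:E * A s + (2 * K / s ^+ 2)%:E * B s))%E).
    by apply: lee_wpmul2l; [rewrite lee_fin mulr_ge0 ?powR_ge0// ltW|exact: scaled_distf_bound].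
  have A0 : (0 <= A s)%E by apply: integral_ge0 => x _; rewrite lee_fin mulr_ge0.
  have B0 : (0 <= B s)%E by apply: integral_ge0 => x _; rewrite lee_fin mulr_ge0 ?sqr_ge0.
  rewrite ge0_muleDr ?mule_ge0// ?lee_fin ?divr_ge0 ?mulr_ge0 ?sqr_ge0 ?(ltW s0) ?(ltW M0)//.
  rewrite /GA /GB; under eq_integral do rewrite s0 mulr1 EFinM.
  rewrite ge0_integralZl_EFin; [|by []|by move=> x _; rewrite lee_fin mulr_ge0| |exact: powR_ge0]; last first.
    apply/measurable_EFinP; apply: measurable_funM => //.
    by apply: measurable_fun_natb; apply: measurable_fun_ltr.
  under [X in (_ <= _ + _ * X)%E]eq_integral do rewrite s0 mulr1 EFinM.
  rewrite ge0_integralZl_EFin; [|by []|by move=> x _; rewrite lee_fin mulr_ge0 ?sqr_ge0| |exact: powR_ge0]; last first.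
    apply/measurable_EFinP; apply: measurable_funM; first exact: measurable_funX.
    by apply: measurable_fun_natb; apply: measurable_fun_ler.
  have sN0 : s != 0 by rewrite gt_eqF.
  have e1 : s `^ (p - 1) = s `^ (p - 2) * s.
    by rewrite -{3}[s]powRr1 ?(ltW s0)// -powRD ?sN0 ?implybT//; congr (_ `^ _); ring.
  have e2 : s `^ (p - 1) = s `^ (p - 3) * s ^+ 2.
    by rewrite -powR_mulrn ?(ltW s0)// -powRD ?sN0 ?implybT//; congr (_ `^ _); ring.
  rewrite !muleA -!EFinM le_eqVlt; apply/orP; left; apply/eqP; congr (_%:E * _ + _%:E * _)%E.
    by rewrite e1; field.
  by rewrite e2; field.
rewrite ge0_integralD//; last 4 first.
- by move=> s _; rewrite mule_ge0.
- exact: emeasurable_funM.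
- by move=> s _; rewrite mule_ge0.
- exact: emeasurable_funM.
rewrite !ge0_integralZl_EFin//.
rewrite EFinD ge0_muleDl ?lee_fin ?divr_ge0 ?subr_ge0 ?(ltW p1) ?(ltW p2)//.
by apply: leeD; rewrite [in leRHS]EFinM -[leRHS]muleA; apply: lee_wpmul2l => //; [exact: integral_A|exact: integral_B].
Qed.

End Marcinkiewicz.

(** * Rapidly Cauchy sequences in L^2 *)

Section L2Completeness.
Context d (T : measurableType d) (R : realType) (mu : {measure set T -> \bar R}).

(** The rate 8^(-k) leaves room for the weights 4^k: D = sum 4^k |u_{k+1} - u_k|^2 has integral at
    most sum 2^(-k), so it is finite almost everywhere, and there the increments are at most (1 + D)
    2^(-k). The error bound [eps k] passes to the limit by Fatou. *)
Lemma L2_complete (u : nat -> T -> R) (eps : nat -> R) :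
  (forall k, measurable_fun setT (u k)) ->
  (forall k, eps k <= (8 ^+ k)^-1) ->
  (forall k m, (k <= m)%N -> \int[mu]_x ((u m x - u k x) ^+ 2)%:E <= (eps k)%:E)%E ->
  exists2 v : T -> R, measurable_fun setT v &
    forall k, (\int[mu]_x ((v x - u k x) ^+ 2)%:E <= (eps k)%:E)%E.
Proof.
move=> mu_ epsle cau.
pose t k x := 4 ^+ k * (u k.+1 x - u k x) ^+ 2.
have mt k : measurable_fun setT (t k).
  by apply: measurable_funM => //; apply: measurable_funX; exact: measurable_funB.
have t0 k x : 0 <= t k x by rewrite mulr_ge0 ?sqr_ge0 ?exprn_ge0.
pose D x := (\sum_(0 <= k <oo) (t k x)%:E)%E.
have mD : measurable_fun setT D.
  by apply: ge0_emeasurable_sum => [k x _ _|k _]; [rewrite lee_fin|exact/measurable_EFinP].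
have D0 x : (0 <= D x)%E by apply: nneseries_ge0 => k _ _; rewrite lee_fin.
have Dfin : {ae mu, forall x, (D x < +oo)%E}.
  have : mu.-integrable setT D.
    apply/integrableP; split=> //.
    under eq_integral do rewrite gee0_abs//.
    rewrite integral_nneseries//; last 2 first.
    - by move=> k; exact/measurable_EFinP.
    - by move=> k x _; rewrite lee_fin.
    apply: (@le_lt_trans _ _ (\sum_(0 <= k <oo) (2 / (2 ^ (k + 1))%:R : R)%:E)%E).
      apply: lee_nneseries => [k _ _|k _].
        by apply: integral_ge0 => x _; rewrite lee_fin.
      rewrite /t; under eq_integral do rewrite EFinM.
      rewrite ge0_integralZl_EFin; [|by []|by move=> x _; rewrite lee_fin sqr_ge0| |by rewrite exprn_ge0]; last first.
        by apply/measurable_EFinP; apply: measurable_funX; exact: measurable_funB.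
      apply: (@le_trans _ _ ((4 ^+ k)%:E * ((8 ^+ k)^-1)%:E)%E).
        apply: lee_wpmul2l; first by rewrite lee_fin exprn_ge0.
        by rewrite (le_trans (cau k k.+1 _))// lee_fin.
      rewrite -EFinM lee_fin natrX exprD expr1 le_eqVlt; apply/orP; left; apply/eqP.
      rewrite (_ : 8 ^+ k = 4 ^+ k * 2 ^+ k); last by rewrite -exprMn -natrM.
      by field; rewrite !expf_neq0 ?pnatr_eq0.
    have := @cvg_geometric_eseries_half R 2 0.
    move=> /cvg_lim -> //; exact: ltry.
  move=> /(integrable_ae measurableT); apply: filterS => x /(_ I).
  by rewrite ge0_fin_numE.
have cvgu x : (D x < +oo)%E -> cvgn (u ^~ x).
  move=> Dx.
  have Dfx : D x \is a fin_num by rewrite ge0_fin_numE.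
  pose r := fine (D x).
  have tr k : t k x <= r.
    rewrite -lee_fin fineK//; apply: le_trans (nneseries_lim_ge k.+1 _); last by move=> j _ _; rewrite lee_fin.
    by rewrite big_nat_recr//= leeDr// sume_ge0// => j _; rewrite lee_fin.
  have r0 : 0 <= r by rewrite fine_ge0.
  have dle k : `|u k.+1 x - u k x| <= geometric (1 + r) (2^-1) k.
    have : (2 ^+ k * `|u k.+1 x - u k x|) ^+ 2 <= (1 + r) ^+ 2.
      rewrite exprMn real_normK ?num_real// -exprM mulnC exprM -[2 ^+ 2]/(2 * 2).
      rewrite -natrM; apply: le_trans (tr k) _.
      by rewrite expr2; nra.
    rewrite ler_pXn2r ?nnegrE ?mulr_ge0 ?exprn_ge0 ?addr_ge0// => h.
    by rewrite /geometric/= exprVn ler_pdivlMr ?exprn_gt0// mulrC.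
  have : cvgn (series (fun k => `|telescope (u ^~ x) k|)).
    apply: (series_le_cvg (v_ := geometric (1 + r) (2^-1))).
    - by move=> k.
    - by move=> k; rewrite /geometric/= mulr_ge0 ?addr_ge0 ?exprn_ge0 ?invr_ge0.
    - by move=> k; exact: dle.
    - by apply: is_cvg_geometric_series; rewrite ger0_norm// invf_lt1// ltr1n.
  move=> /normed_cvg; rewrite telescopeK => cs.
  have -> : u ^~ x = (fun n => (u n x - u 0%N x) + u 0%N x) by apply/funext => n; rewrite subrK.
  by apply: is_cvgD => //; exact: is_cvg_cst.
(* Setting the sequence to 0 where D is infinite makes it converge everywhere, so that the limit is
   measurable. *)
pose h n x := u n x * (D x < +oo)%E%:R.
pose v x := limn (h ^~ x).
have hv x : h n x @[n --> \oo] --> v x.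
  suff : cvgn (h ^~ x) by [].
  rewrite /h; case: (boolP (D x < +oo)%E) => [Dx|_].
    by under eq_fun do rewrite mulr1; exact: cvgu.
  by under eq_fun do rewrite mulr0; exact: is_cvg_cst.
have mv : measurable_fun setT v.
  apply: (measurable_fun_cvg (h := h)) => [m|x _]; last exact: hv.
  apply: measurable_funM => //; apply: measurable_fun_natb.
  exact: measurable_fun_lte.
exists v => // k.
apply: (@fatou_le _ _ _ _ (fun m x => ((u (m + k)%N x - u k x) ^+ 2)%:E)).
- move=> m; apply/measurable_EFinP; apply: measurable_funX; exact: measurable_funB.
- by apply/measurable_EFinP; apply: measurable_funX; exact: measurable_funB.
- by move=> m x; rewrite lee_fin sqr_ge0.
- by move=> x; rewrite lee_fin sqr_ge0.
- apply: filterS Dfin => x Dx; apply: cvg_EFin; first by near=> m.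
  have -> : fine \o (fun m => ((u (m + k)%N x - u k x) ^+ 2)%:E) =
     (fun m => (u (m + k)%N x - u k x) * (u (m + k)%N x - u k x)).
    by apply/funext => m /=; rewrite expr2.
  have cvv : u (m + k)%N x @[m --> \oo] --> v x.
    rewrite (cvg_shiftn k (u ^~ x)).
    have := hv x; rewrite /h Dx; apply: cvg_trans.
    by apply: near_eq_cvg; near=> m; rewrite mulr1.
  by rewrite expr2; apply: cvgM; (apply: cvgB; [exact: cvv|exact: cvg_cst]).
- by move=> m; apply: cau; rewrite leq_addl.
Unshelve. all: by end_near. Qed.

End L2Completeness.

Lemma eq_measurable_funT d1 d2 (X : measurableType d1) (Y : measurableType d2) (f g : X -> Y) :
  f =1 g -> measurable_fun setT g -> measurable_fun setT f.
Proof. by move=> /funext ->. Qed.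

(** * The modulus of complex numbers *)

Section ComplexModulus.
Variable R : realType.
Implicit Types z w : R[i].
Local Open Scope complex_scope.

Lemma cabsE z : cabs z = Normc.normc z. Proof. by case: z. Qed.

Lemma cabs_ge0 z : 0 <= cabs z. Proof. exact: sqrtr_ge0. Qed.

Lemma cabsM z w : cabs (z * w) = cabs z * cabs w.
Proof. by rewrite !cabsE Normc.normcM. Qed.

Lemma cabsD z w : cabs (z + w) <= cabs z + cabs w.
Proof. by rewrite !cabsE le_normcD. Qed.

Lemma cabs0 : cabs (0 : R[i]) = 0.
Proof. by rewrite cabsE Normc.normc0. Qed.

Lemma cabs_eq0 z : cabs z = 0 -> z = 0.
Proof. by rewrite cabsE => /Normc.eq0_normc. Qed.

Lemma sqr_cabs z : cabs z ^+ 2 = complex.Re z ^+ 2 + complex.Im z ^+ 2.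
Proof. by rewrite sqr_sqrtr// addr_ge0 ?sqr_ge0. Qed.

Lemma Re_le_cabs z : `|complex.Re z| <= cabs z.
Proof. by rewrite -sqrtr_sqr ler_wsqrtr// lerDl sqr_ge0. Qed.

Lemma Im_le_cabs z : `|complex.Im z| <= cabs z.
Proof. by rewrite -sqrtr_sqr ler_wsqrtr// lerDr sqr_ge0. Qed.

Lemma cabs_le z : cabs z <= `|complex.Re z| + `|complex.Im z|.
Proof.
rewrite -[leRHS]ger0_norm ?addr_ge0// -sqrtr_sqr ler_wsqrtr// sqrrD.
rewrite !real_normK ?num_real//.
by rewrite addrAC lerDl mulrn_wge0// mulr_ge0.
Qed.

Lemma cabs_expi (t : R) : cabs (expi t) = 1.
Proof. by rewrite /cabs/= cos2Dsin2 sqrtr1. Qed.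

Lemma ReD z w : complex.Re (z + w) = complex.Re z + complex.Re w.
Proof. by case: z; case: w. Qed.
Lemma ImD z w : complex.Im (z + w) = complex.Im z + complex.Im w.
Proof. by case: z; case: w. Qed.
Lemma ReM z w : complex.Re (z * w) =
  complex.Re z * complex.Re w - complex.Im z * complex.Im w.
Proof. by case: z; case: w. Qed.
Lemma ImM z w : complex.Im (z * w) =
  complex.Re z * complex.Im w + complex.Im z * complex.Re w.
Proof. by case: z; case: w. Qed.
Lemma ReN z : complex.Re (- z) = - complex.Re z. Proof. by case: z. Qed.
Lemma ImN z : complex.Im (- z) = - complex.Im z. Proof. by case: z. Qed.
Lemma complex_ext z w : complex.Re z = complex.Re w ->
  complex.Im z = complex.Im w -> z = w.
Proof. by case: z => a b; case: w => c e /= -> ->. Qed.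
Lemma cabsN z : cabs (- z) = cabs z.
Proof. by rewrite /cabs ReN ImN !sqrrN. Qed.

Lemma sqr_cabsD z w : cabs (z + w) ^+ 2 <= 2 * cabs z ^+ 2 + 2 * cabs w ^+ 2.
Proof.
rewrite !sqr_cabs ReD ImD.
have := sqr_ge0 (complex.Re z - complex.Re w).
have := sqr_ge0 (complex.Im z - complex.Im w).
move: (complex.Re z) (complex.Re w) (complex.Im z) (complex.Im w) => a b a' b'.
lra.
Qed.

End ComplexModulus.

(** * The Fourier transform on L^1 *)

Section FourierL1.
Variables (R : realType) (d : nat).
Local Notation mu := (lebd R d).
Implicit Types f g h u : Rd R d -> R[i].
Local Open Scope complex_scope.

Definition N1 f : \bar R := (\int[mu]_x (cabs (f x))%:E)%E.
(** The squared norm, kept without a root; the triangle inequality is replaced by |z + w|^2 <=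
    2|z|^2 + 2|w|^2, whence the factors 2 and 4 in later constants. *)
Definition N2 f : \bar R := (\int[mu]_x (cabs (f x) ^+ 2)%:E)%E.

Lemma measurable_cabs f : Cmeasurable f -> measurable_fun setT (fun x => cabs (f x)).
Proof.
move=> [mr mi].
rewrite (_ : (fun x => _) = (fun x => (complex.Re (f x) ^+ 2 + complex.Im (f x) ^+ 2) `^ 2^-1)).
  apply: (measurableT_comp (measurable_powR _)).
  by apply: measurable_funD; exact: measurable_funX.
by apply/funext => x; rewrite powR12_sqrt// addr_ge0 ?sqr_ge0.
Qed.

Lemma CmeasurableD f g : Cmeasurable f -> Cmeasurable g -> Cmeasurable (fun x => f x + g x).
Proof.
move=> [fr fi] [gr gi]; split.
  by apply: (eq_measurable_funT (fun x => ReD _ _)); exact: measurable_funD.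
by apply: (eq_measurable_funT (fun x => ImD _ _)); exact: measurable_funD.
Qed.

Lemma CmeasurableZ a f : Cmeasurable f -> Cmeasurable (fun x => a * f x).
Proof.
move=> [fr fi]; split.
  by apply: (eq_measurable_funT (fun x => ReM _ _)); apply: measurable_funB; exact: measurable_funM.
by apply: (eq_measurable_funT (fun x => ImM _ _)); apply: measurable_funD; exact: measurable_funM.
Qed.

Lemma CmeasurableB f g : Cmeasurable f -> Cmeasurable g -> Cmeasurable (fun x => f x - g x).
Proof.
move=> mf mg; apply: CmeasurableD => //.
rewrite (_ : (fun x => - g x) = (fun x => -1 * g x)); first exact: CmeasurableZ.
by apply/funext => x; rewrite mulN1r.
Qed.

Lemma Cmeasurable_if (b : Rd R d -> bool) f : measurable_fun setT b -> Cmeasurable f ->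
  Cmeasurable (fun x => if b x then f x else 0).
Proof.
move=> mb [fr fi]; split.
  rewrite (_ : (fun x => _) = (fun x => if b x then complex.Re (f x) else 0)).
    exact: measurable_fun_ifT.
  by apply/funext => x; case: (b x).
rewrite (_ : (fun x => _) = (fun x => if b x then complex.Im (f x) else 0)).
  exact: measurable_fun_ifT.
by apply/funext => x; case: (b x).
Qed.

Lemma Re_integrable f : Cmeasurable f -> (N1 f < +oo)%E ->
  mu.-integrable setT (EFin \o (fun x => complex.Re (f x))).
Proof.
move=> mf f1; apply/integrableP; split; first by apply/measurable_EFinP; case: mf.
apply: le_lt_trans f1; apply: ge0_le_integral => //.
- by apply/measurable_EFinP; apply: measurableT_comp => //; case: mf.
- by apply/measurable_EFinP; exact: measurable_cabs.
- by move=> x _; rewrite /= lee_fin Re_le_cabs.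
Qed.

Lemma Im_integrable f : Cmeasurable f -> (N1 f < +oo)%E ->
  mu.-integrable setT (EFin \o (fun x => complex.Im (f x))).
Proof.
move=> mf f1; apply/integrableP; split; first by apply/measurable_EFinP; case: mf.
apply: le_lt_trans f1; apply: ge0_le_integral => //.
- by apply/measurable_EFinP; apply: measurableT_comp => //; case: mf.
- by apply/measurable_EFinP; exact: measurable_cabs.
- by move=> x _; rewrite /= lee_fin Im_le_cabs.
Qed.

Lemma measurable_dotR1 n (x : Rn R n) : measurable_fun setT (fun t => dotR x t).
Proof.
exact: (measurableT_comp (@measurable_dotR R n) (measurable_pair1 x)).
Qed.

Lemma integrable_Mcos (a : Rd R d -> R) (x : Rd R d) : mu.-integrable setT (EFin \o a) ->
  mu.-integrable setT (EFin \o (fun t => a t * cos (dotR x t))).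
Proof.
move=> ia; apply: integrable_bounded_factor => //.
  apply: measurableT_comp (measurable_dotR1 x).
  by apply: continuous_measurable_fun; exact: continuous_cos.
by move=> y; rewrite ler_norml cos_geN1 cos_le1.
Qed.

Lemma integrable_Msin (a : Rd R d -> R) (x : Rd R d) : mu.-integrable setT (EFin \o a) ->
  mu.-integrable setT (EFin \o (fun t => a t * sin (dotR x t))).
Proof.
move=> ia; apply: integrable_bounded_factor => //.
  apply: measurableT_comp (measurable_dotR1 x).
  by apply: continuous_measurable_fun; exact: continuous_sin.
by move=> y; rewrite ler_norml sin_geN1 sin_le1.
Qed.

Lemma Re_fourier f x : Cmeasurable f -> (N1 f < +oo)%E ->
  complex.Re (fourier f x) =
  cos_transform (fun t => complex.Re (f t)) x + sin_transform (fun t => complex.Im (f t)) x.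
Proof.
move=> mf f1; rewrite /cos_transform /sin_transform -RintegralD//.
- by apply: eq_Rintegral => t _; rewrite ReM /= sinN cosN mulrN opprK.
- exact: integrable_Mcos (Re_integrable mf f1).
- exact: integrable_Msin (Im_integrable mf f1).
Qed.

Lemma Im_fourier f x : Cmeasurable f -> (N1 f < +oo)%E ->
  complex.Im (fourier f x) =
  cos_transform (fun t => complex.Im (f t)) x - sin_transform (fun t => complex.Re (f t)) x.
Proof.
move=> mf f1; rewrite /cos_transform /sin_transform -RintegralB//.
- by apply: eq_Rintegral => t _; rewrite ImM /= sinN cosN mulrN addrC.
- exact: integrable_Mcos (Im_integrable mf f1).
- exact: integrable_Msin (Re_integrable mf f1).
Qed.

Lemma Cmeasurable_fourier f : Cmeasurable f -> (N1 f < +oo)%E -> Cmeasurable (fourier f).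
Proof.
move=> mf f1; have [mr mi] := mf; split.
  apply: (eq_measurable_funT (fun x => Re_fourier x mf f1)).
  by apply: measurable_funD; [exact: measurable_cos_transform|exact: measurable_sin_transform].
apply: (eq_measurable_funT (fun x => Im_fourier x mf f1)).
by apply: measurable_funB; [exact: measurable_cos_transform|exact: measurable_sin_transform].
Qed.

(** Real and imaginary parts are each bounded by the L^1 norm; adding them costs the factor 2, which
    only affects constants. *)
Lemma fourier_bound f x : Cmeasurable f -> (N1 f < +oo)%E ->
  ((cabs (fourier f x))%:E <= 2%:E * N1 f)%E.
Proof.
move=> mf f1.
have mfe : Cmeasurable (fun t => f t * expi (- dotd x t)).
  have [mr mi] := mf.
  have mc : measurable_fun setT (fun t : Rd R d => cos (- dotd x t)).
    apply: (eq_measurable_funT (fun t => cosN _)).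
    apply: measurableT_comp (measurable_dotR1 x).
    by apply: continuous_measurable_fun; exact: continuous_cos.
  have ms : measurable_fun setT (fun t : Rd R d => sin (- dotd x t)).
    apply: (eq_measurable_funT (fun t => sinN _)).
    apply: measurableT_comp => //; apply: measurableT_comp (measurable_dotR1 x).
    by apply: continuous_measurable_fun; exact: continuous_sin.
  split.
    by apply: (eq_measurable_funT (fun x => ReM _ _)); apply: measurable_funB; exact: measurable_funM.
  by apply: (eq_measurable_funT (fun x => ImM _ _)); apply: measurable_funD; exact: measurable_funM.
have N1e : N1 (fun t => f t * expi (- dotd x t)) = N1 f.
  by apply: eq_integral => t _; rewrite cabsM cabs_expi mulr1.
have ibound (a : Rd R d -> R) : mu.-integrable setT (EFin \o a) ->
    (forall t, `|a t| <= cabs (f t)) -> (`|Rintegral mu setT a|%:E <= N1 f)%E.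
  move=> ia af; rewrite EFin_normr_Rintegral//.
  apply: le_trans (le_abse_integral _ _ _) _ => //; first exact: measurable_int ia.
  apply: ge0_le_integral => //.
  - by apply: measurableT_comp => //; exact: measurable_int ia.
  - by apply/measurable_EFinP; exact: measurable_cabs.
  - by move=> t _; rewrite abse_EFin lee_fin.
apply: (@le_trans _ _ (`|complex.Re (fourier f x)| + `|complex.Im (fourier f x)|)%:E).
  by rewrite lee_fin cabs_le.
rewrite EFinD mule_natl mule2n; apply: leeD; apply: ibound.
- by apply: Re_integrable => //; rewrite N1e.
- by move=> t; rewrite (le_trans (Re_le_cabs _))// cabsM cabs_expi mulr1.
- by apply: Im_integrable => //; rewrite N1e.
- by move=> t; rewrite (le_trans (Im_le_cabs _))// cabsM cabs_expi mulr1.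
Qed.

Lemma N1_linear a f g : Cmeasurable f -> Cmeasurable g -> (N1 f < +oo)%E -> (N1 g < +oo)%E ->
  (N1 (fun x => a * f x + g x)%R < +oo)%E.
Proof.
move=> mf mg f1 g1.
apply: (@le_lt_trans _ _ (\int[mu]_x ((cabs a)%:E * (cabs (f x))%:E + (cabs (g x))%:E))%E).
  apply: ge0_le_integral_nomeas => x; first by rewrite lee_fin cabs_ge0.
  by rewrite -EFinM -EFinD lee_fin (le_trans (cabsD _ _))// cabsM.
have mcf := measurable_cabs mf; have mcg := measurable_cabs mg.
rewrite ge0_integralD//; [|by move=> x _; rewrite mule_ge0 ?lee_fin ?cabs_ge0| | |]; last 3 first.
- by apply/measurable_EFinP; exact: measurable_funM.
- by move=> x _; rewrite lee_fin cabs_ge0.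
- exact/measurable_EFinP.
rewrite ge0_integralZl_EFin ?cabs_ge0//; [|by move=> x _; rewrite lee_fin cabs_ge0|exact/measurable_EFinP].
apply: lte_add_pinfty => //; apply: lte_mul_pinfty => //; rewrite ?lee_fin ?cabs_ge0//.
Qed.

Lemma cos_transformD (c1 c2 : R) (h1 h2 h3 : Rd R d -> R) x :
  mu.-integrable setT (EFin \o h1) -> mu.-integrable setT (EFin \o h2) ->
  mu.-integrable setT (EFin \o h3) ->
  cos_transform (fun t => c1 * h1 t + c2 * h2 t + h3 t) x =
  c1 * cos_transform h1 x + c2 * cos_transform h2 x + cos_transform h3 x.
Proof.
move=> /(integrable_Mcos x) i1 /(integrable_Mcos x) i2 /(integrable_Mcos x) i3.
rewrite /cos_transform -RintegralZl// -RintegralZl// -RintegralD//; last 2 first.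
- exact: (integrableZl measurableT c1 i1).
- exact: (integrableZl measurableT c2 i2).
rewrite -RintegralD//; last first.
  exact: (integrableD measurableT (integrableZl measurableT c1 i1) (integrableZl measurableT c2 i2)).
by apply: eq_Rintegral => t _; ring.
Qed.

Lemma sin_transformD (c1 c2 : R) (h1 h2 h3 : Rd R d -> R) x :
  mu.-integrable setT (EFin \o h1) -> mu.-integrable setT (EFin \o h2) ->
  mu.-integrable setT (EFin \o h3) ->
  sin_transform (fun t => c1 * h1 t + c2 * h2 t + h3 t) x =
  c1 * sin_transform h1 x + c2 * sin_transform h2 x + sin_transform h3 x.
Proof.
move=> /(integrable_Msin x) i1 /(integrable_Msin x) i2 /(integrable_Msin x) i3.
rewrite /sin_transform -RintegralZl// -RintegralZl// -RintegralD//; last 2 first.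
- exact: (integrableZl measurableT c1 i1).
- exact: (integrableZl measurableT c2 i2).
rewrite -RintegralD//; last first.
  exact: (integrableD measurableT (integrableZl measurableT c1 i1) (integrableZl measurableT c2 i2)).
by apply: eq_Rintegral => t _; ring.
Qed.

Lemma fourier_linear a f g x : Cmeasurable f -> Cmeasurable g ->
  (N1 f < +oo)%E -> (N1 g < +oo)%E ->
  fourier (fun y => a * f y + g y) x = a * fourier f x + fourier g x.
Proof.
move=> mf mg f1 g1.
have ms : Cmeasurable (fun y => a * f y + g y) by apply: CmeasurableD => //; exact: CmeasurableZ.
have s1 := N1_linear a mf mg f1 g1.
have rf := Re_integrable mf f1; have jf := Im_integrable mf f1.
have rg := Re_integrable mg g1; have jg := Im_integrable mg g1.
have eR : (fun t => complex.Re (a * f t + g t)) = (fun t => complex.Re a * complex.Re (f t) +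
    (- complex.Im a) * complex.Im (f t) + complex.Re (g t)).
  by apply/funext => t; rewrite ReD ReM mulNr.
have eI : (fun t => complex.Im (a * f t + g t)) = (fun t => complex.Re a * complex.Im (f t) +
    complex.Im a * complex.Re (f t) + complex.Im (g t)).
  by apply/funext => t; rewrite ImD ImM.
apply: complex_ext.
  rewrite ReD ReM !Re_fourier// Im_fourier// eR eI cos_transformD// sin_transformD//; ring.
rewrite ImD ImM !Im_fourier// Re_fourier// eR eI cos_transformD// sin_transformD//; ring.
Qed.

Lemma fourier0 (x : Rd R d) : fourier ((fun=> 0) : Rd R d -> R[i]) x = 0.
Proof.
have m0 : Cmeasurable ((fun=> 0) : Rd R d -> R[i]) by split; exact: measurable_cst.
have N10 : N1 ((fun=> 0) : Rd R d -> R[i]) = 0%E.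
  by apply: integral0_eq => y _; rewrite cabs0.
apply: cabs_eq0; apply/eqP; rewrite eq_le cabs_ge0 andbT -lee_fin.
by apply: le_trans (fourier_bound x m0 _) _; rewrite N10 ?mule0.
Qed.

Lemma inLp1 (f : Rd R d -> R[i]) : inLp 1 f <-> Cmeasurable f /\ (N1 f < +oo)%E.
Proof.
rewrite /inLp /Lpnorm Lnorm1.
by under eq_integral do rewrite abse_EFin ger0_norm ?cabs_ge0//.
Qed.

End FourierL1.

(** * Extension to L^2 and L^p *)

Section FourierL2.
Variables (R : realType) (d : nat).
Local Notation mu := (lebd R d).
Implicit Types f g h u w : Rd R d -> R[i].
Local Open Scope complex_scope.

(** The real constant (2 pi)^n, n = [d.-1.+1] being the number of coordinates of [Rd R d], times 2
    for treating the real and imaginary parts of f separately. *)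
Definition plancherel_const : R := 2 * (2 * pi) ^+ d.-1.+1.

Lemma plancherel_const_ge0 : 0 <= plancherel_const.
Proof. by rewrite mulr_ge0// exprn_ge0// mulr_ge0// pi_ge0. Qed.

Lemma measurable_sqr_cabs f : Cmeasurable f ->
  measurable_fun setT (fun x => (cabs (f x) ^+ 2)%:E).
Proof. by move=> mf; apply/measurable_EFinP; apply: measurable_funX; exact: measurable_cabs. Qed.

Lemma N2_ge0 f : (0 <= N2 f)%E.
Proof. by apply: integral_ge0 => x _; rewrite lee_fin sqr_ge0. Qed.

Lemma cabsN1 : cabs (-1 : R[i]) = 1.
Proof. by rewrite cabsN cabsE Normc.normc1. Qed.

Lemma eq_N2 f g : f =1 g -> N2 f = N2 g.
Proof. by move=> /funext ->. Qed.

Lemma N2_0 : N2 ((fun=> 0) : Rd R d -> R[i]) = 0%E.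
Proof. by apply: integral0_eq => x _; rewrite cabs0 expr0n. Qed.

Lemma N2D f g : Cmeasurable f -> Cmeasurable g ->
  (N2 (fun x => f x + g x)%R <= 2%:E * N2 f + 2%:E * N2 g)%E.
Proof.
move=> mf mg; have m2f := measurable_sqr_cabs mf; have m2g := measurable_sqr_cabs mg.
rewrite -!ge0_integralZl_EFin//; [|by move=> x _; rewrite lee_fin sqr_ge0..].
rewrite -ge0_integralD//; [|by move=> x _; rewrite mule_ge0 ?lee_fin ?sqr_ge0
  |exact: emeasurable_funM|by move=> x _; rewrite mule_ge0 ?lee_fin ?sqr_ge0|exact: emeasurable_funM].
apply: ge0_le_integral_nomeas => x; first by rewrite lee_fin sqr_ge0.
by rewrite -!EFinM -EFinD lee_fin sqr_cabsD.
Qed.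

Lemma N2Z a f : Cmeasurable f -> N2 (fun x => a * f x) = ((cabs a ^+ 2)%:E * N2 f)%E.
Proof.
move=> mf; rewrite -ge0_integralZl_EFin ?sqr_ge0//; last 2 first.
- by move=> x _; rewrite lee_fin sqr_ge0.
- exact: measurable_sqr_cabs.
by apply: eq_integral => x _; rewrite cabsM exprMn EFinM.
Qed.

Lemma N2_eq0 f : Cmeasurable f -> N2 f = 0%E -> {ae mu, forall x, f x = 0}.
Proof.
move=> mf f0.
have : (\int[mu]_x `|(cabs (f x) ^+ 2)%:E| = 0)%E.
  by rewrite -f0; apply: eq_integral => x _; rewrite abse_EFin ger0_norm ?sqr_ge0.
move=> /(ae_eq_integral_abs mu measurableT (measurable_sqr_cabs mf)).
apply: filterS => x /(_ I) /= [] /eqP; rewrite expf_eq0/= => /eqP.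
exact: cabs_eq0.
Qed.

Lemma ae_N2 f g : Cmeasurable f -> Cmeasurable g ->
  {ae mu, forall x, f x = g x} -> N2 f = N2 g.
Proof.
move=> mf mg fg; apply: ge0_ae_eq_integral => //.
- exact: measurable_sqr_cabs.
- exact: measurable_sqr_cabs.
- by move=> x _; rewrite lee_fin sqr_ge0.
- by move=> x _; rewrite lee_fin sqr_ge0.
- by apply: filterS fg => x -> _.
Qed.

Lemma plancherel f : Cmeasurable f -> (N1 f < +oo)%E ->
  (N2 (fourier f) <= plancherel_const%:E * N2 f)%E.
Proof.
move=> mf f1; have [mr mi] := mf.
pose fr t := complex.Re (f t); pose fi t := complex.Im (f t).
have ifr : mu.-integrable setT (EFin \o fr) by exact: Re_integrable.
have ifi : mu.-integrable setT (EFin \o fi) by exact: Im_integrable.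
pose Pr x := (cos_transform fr x ^+ 2 + sin_transform fr x ^+ 2).
pose Pi x := (cos_transform fi x ^+ 2 + sin_transform fi x ^+ 2).
have Pr0 x : 0 <= Pr x by rewrite addr_ge0 ?sqr_ge0.
have Pi0 x : 0 <= Pi x by rewrite addr_ge0 ?sqr_ge0.
have mPr : measurable_fun setT (fun x => (2 * Pr x)%:E).
  apply/measurable_EFinP; apply: measurable_funM => //; apply: measurable_funD; apply: measurable_funX.
    exact: measurable_cos_transform.
  exact: measurable_sin_transform.
have mPi : measurable_fun setT (fun x => (2 * Pi x)%:E).
  apply/measurable_EFinP; apply: measurable_funM => //; apply: measurable_funD; apply: measurable_funX.
    exact: measurable_cos_transform.
  exact: measurable_sin_transform.
apply: (@le_trans _ _ (\int[mu]_x ((2 * Pr x)%:E + (2 * Pi x)%:E))%E).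
  apply: ge0_le_integral_nomeas => x; first by rewrite lee_fin sqr_ge0.
  rewrite -EFinD lee_fin sqr_cabs Re_fourier// Im_fourier// -/fr -/fi /Pr /Pi.
  have := sqr_ge0 (cos_transform fr x - sin_transform fi x).
  have := sqr_ge0 (cos_transform fi x + sin_transform fr x).
  move: (cos_transform fr x) (sin_transform fr x) (cos_transform fi x) (sin_transform fi x) => a b a' b'.
  lra.
rewrite ge0_integralD//; [|by move=> x _; rewrite lee_fin mulr_ge0|by move=> x _; rewrite lee_fin mulr_ge0].
under eq_integral do rewrite EFinM.
under [X in (_ + X <= _)%E]eq_integral do rewrite EFinM.
have mPr' : measurable_fun setT (fun x => (Pr x)%:E).
  apply/measurable_EFinP; apply: measurable_funD; apply: measurable_funX.
    exact: measurable_cos_transform.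
  exact: measurable_sin_transform.
have mPi' : measurable_fun setT (fun x => (Pi x)%:E).
  apply/measurable_EFinP; apply: measurable_funD; apply: measurable_funX.
    exact: measurable_cos_transform.
  exact: measurable_sin_transform.
rewrite !ge0_integralZl_EFin//; [|by move=> x _; rewrite lee_fin|by move=> x _; rewrite lee_fin].
have m2r : measurable_fun setT (fun t => (fr t ^+ 2)%:E).
  by apply/measurable_EFinP; exact: measurable_funX.
have m2i : measurable_fun setT (fun t => (fi t ^+ 2)%:E).
  by apply/measurable_EFinP; exact: measurable_funX.
have c0 : (0 <= ((2 * pi) ^+ d.-1.+1 : R)%:E)%E.
  by rewrite lee_fin exprn_ge0// mulr_ge0// pi_ge0.
have -> : N2 f = (\int[mu]_t (fr t ^+ 2)%:E + \int[mu]_t (fi t ^+ 2)%:E)%E.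
  rewrite -ge0_integralD//; [|by move=> x _; rewrite lee_fin sqr_ge0..].
  by apply: eq_integral => t _; rewrite sqr_cabs EFinD.
have i0r : (0 <= \int[mu]_t (fr t ^+ 2)%:E)%E by apply: integral_ge0 => t _; rewrite lee_fin sqr_ge0.
have i0i : (0 <= \int[mu]_t (fi t ^+ 2)%:E)%E by apply: integral_ge0 => t _; rewrite lee_fin sqr_ge0.
rewrite [leRHS]ge0_muleDr//.
rewrite (_ : plancherel_const%:E = 2%:E * ((2 * pi) ^+ d.-1.+1)%:E)%E//.
rewrite -!muleA.
by apply: leeD; apply: lee_wpmul2l => //; exact: plancherel_le.
Qed.

Lemma N1_truncate f (s : R) : Cmeasurable f -> 0 < s -> (N2 f < +oo)%E ->
  (N1 (fun x => if s < cabs (f x) then f x else 0)%R < +oo)%E.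
Proof.
move=> mf s0 f2.
apply: (@le_lt_trans _ _ ((s^-1)%:E * N2 f)%E); last first.
  by apply: lte_mul_pinfty => //; rewrite lee_fin invr_ge0 ltW.
rewrite -ge0_integralZl_EFin ?invr_ge0 ?(ltW s0)//; last 2 first.
- by move=> x _; rewrite lee_fin sqr_ge0.
- exact: measurable_sqr_cabs.
apply: ge0_le_integral_nomeas => x; first by rewrite lee_fin cabs_ge0.
rewrite -EFinM lee_fin; case: ltP => h; last by rewrite cabs0 mulr_ge0 ?sqr_ge0 ?invr_ge0// ltW.
by rewrite ler_pdivlMl// expr2 ler_wpM2r ?cabs_ge0// ltW.
Qed.

Lemma measurable_gt_cabs f (s : R) : Cmeasurable f ->
  measurable_fun setT (fun x => s < cabs (f x)).
Proof. by move=> mf; apply: measurable_fun_ltr => //; exact: measurable_cabs. Qed.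

(** Discarding the values of modulus at most 1/(n+1) already gives integrable functions, since |f|
    <= (n+1)|f|^2 on the rest; the error tends to 0 by dominated convergence. *)
Lemma L2_approx f (e : R) : Cmeasurable f -> (N2 f < +oo)%E -> 0 < e ->
  exists h, [/\ Cmeasurable h, (N1 h < +oo)%E & (N2 (fun x => f x - h x)%R <= e%:E)%E].
Proof.
move=> mf f2 e0.
pose h (n : nat) x := if n.+1%:R^-1 < cabs (f x) then f x else 0.
have mh n : Cmeasurable (h n) by apply: Cmeasurable_if => //; exact: measurable_gt_cabs.
have m2f := measurable_sqr_cabs mf.
have i2f : mu.-integrable setT (fun x => (cabs (f x) ^+ 2)%:E).
  apply/integrableP; split => //.
  by under eq_integral do rewrite abse_EFin ger0_norm ?sqr_ge0//.
have fh n x : cabs (f x - h n x) ^+ 2 = cabs (f x) ^+ 2 * (cabs (f x) <= n.+1%:R^-1)%R%:R.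
  by rewrite /h; case: ltP => _; rewrite ?subrr ?cabs0 ?subr0 ?mulr0 ?mulr1 ?expr0n.
have : N2 (fun x => f x - h n x) @[n --> \oo] --> (\int[mu]_(x in setT) (cst 0 x))%E.
  apply: (@dominated_cvg _ _ _ mu setT measurableT (fun n x => (cabs (f x - h n x) ^+ 2)%:E)
    (cst 0%E) (fun x => (cabs (f x) ^+ 2)%:E)) => //.
  - by move=> n; apply: measurable_sqr_cabs; exact: CmeasurableB.
  - move=> x _; apply: cvg_EFin; first by near=> n.
    have := cabs_ge0 (f x); rewrite le_eqVlt => /predU1P[fx0|fx].
      rewrite (_ : _ \o _ = cst 0); first exact: cvg_cst.
      by apply/funext => n /=; rewrite fh -fx0 expr0n mul0r.
    apply: (@cvg_trans _ (cst (0 : R) @ \oo)); last exact: cvg_cst.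
    apply: near_eq_cvg.
    have /cvgrPdist_lt /(_ _ fx) := @cvg_harmonic R.
    apply: filterS => n; rewrite sub0r normrN /harmonic/= ger0_norm ?invr_ge0// => fn.
    by rewrite fh leNgt fn mulr0.
  - move=> n x _; rewrite abse_EFin lee_fin fh normrM ger0_norm ?sqr_ge0//.
    by rewrite ler_piMr ?sqr_ge0//; case: (cabs _ <= n.+1%:R^-1); rewrite ?normr1 ?normr0.
rewrite integral0 => /fine_cvgP[nfin /cvgrPdist_lt /(_ e e0)] hh.
have [n [nf ne]] : exists n, N2 (fun x => f x - h n x) \is a fin_num /\
    `|0 - fine (N2 (fun x => f x - h n x))| < e.
  have : \forall n \near \oo, N2 (fun x => f x - h n x) \is a fin_num /\
    `|0 - fine (N2 (fun x => f x - h n x))| < e by near=> n; split; near: n.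
  by move=> /filter_ex.
exists (h n); split=> //.
  by apply: N1_truncate => //; rewrite invr_gt0.
rewrite -(fineK nf) lee_fin ltW//; move: ne.
by rewrite sub0r normrN ger0_norm// fine_ge0// N2_ge0.
Unshelve. all: by end_near. Qed.

(* [u] is the Fourier transform of [h] in the sense of L^2: the pair is a limit
   of pairs [(h', fourier h')] with [h'] integrable. *)
Definition fourierL2 h u : Prop :=
  [/\ Cmeasurable h, Cmeasurable u &
    forall e : R, 0 < e -> exists h', [/\ Cmeasurable h', (N1 h' < +oo)%E,
      (N2 (fun x => h x - h' x)%R <= e%:E)%E &
      (N2 (fun x => u x - fourier h' x)%R <= e%:E)%E]].

(** The relation only asks for h - h' to be small in L^2, so h' = h serves for every integrable h,
    square integrable or not. This is what compares the two theories in [fourier12_unique]. *)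
Lemma fourierL2_L1 h : Cmeasurable h -> (N1 h < +oo)%E -> fourierL2 h (fourier h).
Proof.
move=> mh h1; split=> //; first exact: Cmeasurable_fourier.
move=> e e0; exists h; split=> //; rewrite (eq_N2 (g := fun=> 0)) ?N2_0 ?lee_fin ?(ltW e0)//;
  by move=> x; rewrite subrr.
Qed.

Lemma fourierL2_linear a h u h' u' : fourierL2 h u -> fourierL2 h' u' ->
  fourierL2 (fun x => a * h x + h' x) (fun x => a * u x + u' x).
Proof.
move=> [mh mu_ hu] [mh' mu' hu']; split.
- by apply: CmeasurableD => //; exact: CmeasurableZ.
- by apply: CmeasurableD => //; exact: CmeasurableZ.
move=> e e0.
pose c := 2 * cabs a ^+ 2 + 2.
have c0 : 0 < c by rewrite ltr_wpDl// mulr_ge0// sqr_ge0.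
have ec0 : 0 < e / c by rewrite divr_gt0.
have [g [mg g1 hg ug]] := hu _ ec0.
have [g' [mg' g1' hg' ug']] := hu' _ ec0.
have bound f1 f2 : Cmeasurable f1 -> Cmeasurable f2 -> (N2 f1 <= (e / c)%:E)%E ->
    (N2 f2 <= (e / c)%:E)%E -> (N2 (fun x => a * f1 x + f2 x)%R <= e%:E)%E.
  move=> m1 m2 n1 n2; apply: le_trans (N2D (CmeasurableZ a m1) m2) _.
  rewrite N2Z// muleA -EFinM.
  apply: (@le_trans _ _ ((2 * cabs a ^+ 2)%:E * (e / c)%:E + 2%:E * (e / c)%:E)%E).
    by apply: leeD; apply: lee_wpmul2l => //; rewrite lee_fin mulr_ge0// sqr_ge0.
  by rewrite -!EFinM -EFinD lee_fin -mulrDl -/c mulrC divfK// gt_eqF.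
exists (fun x => a * g x + g' x); split.
- by apply: CmeasurableD => //; exact: CmeasurableZ.
- exact: N1_linear.
- rewrite (eq_N2 (g := fun x => a * (h x - g x) + (h' x - g' x))); last first.
    by move=> x; rewrite mulrBr opprD addrACA.
  exact: (bound _ _ (CmeasurableB mh mg) (CmeasurableB mh' mg') hg hg').
- rewrite (eq_N2 (g := fun x => a * (u x - fourier g x) + (u' x - fourier g' x))).
    exact: (bound _ _ (CmeasurableB mu_ (Cmeasurable_fourier mg g1))
      (CmeasurableB mu' (Cmeasurable_fourier mg' g1')) ug ug').
  by move=> x; rewrite fourier_linear// mulrBr opprD addrACA.
Qed.

(** An integrable g close to h is inserted, with [N2D] used once for u and once for g, hence the 4.
    The denominator [c] collects the errors: 2 from u - fourier g and 4 times the Plancherel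
    constant from h - g. *)
Lemma fourierL2_bound h u : fourierL2 h u -> (N2 u <= (4 * plancherel_const)%:E * N2 h)%E.
Proof.
move=> [mh mu_ hu]; apply/lee_addgt0Pr => e e0.
pose c := 2 + 4 * plancherel_const.
have c0 : 0 < c by rewrite ltr_pwDl// mulr_ge0// plancherel_const_ge0.
have ec0 : 0 < e / c by rewrite divr_gt0.
have [g [mg g1 hg ug]] := hu _ ec0.
have mFg := Cmeasurable_fourier mg g1.
have s1 : (N2 u <= 2%:E * N2 (fun x => u x - fourier g x)%R + 2%:E * N2 (fourier g))%E.
  rewrite [leLHS](eq_N2 (g := fun x => (u x - fourier g x) + fourier g x)); last by move=> x; rewrite subrK.
  by apply: N2D => //; exact: CmeasurableB.
have s2 : (N2 g <= 2%:E * N2 (fun x => h x - g x)%R + 2%:E * N2 h)%E.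
  rewrite [leLHS](eq_N2 (g := fun x => -1 * (h x - g x) + h x)); last by move=> x; ring.
  apply: le_trans (N2D (CmeasurableZ (-1) (CmeasurableB mh mg)) mh) _.
  by rewrite (N2Z (-1) (CmeasurableB mh mg)) cabsN1 expr1n mul1e.
apply: (le_trans s1).
apply: (@le_trans _ _ (2%:E * (e / c)%:E + 2%:E * (plancherel_const%:E * (2%:E * (e / c)%:E + 2%:E * N2 h)))%E).
  apply: leeD; first exact: lee_wpmul2l.
  apply: lee_wpmul2l => //; apply: le_trans (plancherel mg g1) _.
  apply: lee_wpmul2l; first by rewrite lee_fin plancherel_const_ge0.
  by apply: le_trans s2 _; apply: leeD => //; exact: lee_wpmul2l.
have K0 := plancherel_const_ge0; have N0 := N2_ge0 h.
have a0 : (0 <= (2 * (e / c))%:E)%E by rewrite lee_fin mulr_ge0// ltW.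
have b0 : (0 <= 2%:E * N2 h)%E by rewrite mule_ge0.
have a1 : (0 <= plancherel_const%:E * (2 * (e / c))%:E)%E by rewrite mule_ge0.
have b1 : (0 <= plancherel_const%:E * (2%:E * N2 h))%E by rewrite mule_ge0.
rewrite -EFinM (ge0_muleDr _ a0 b0) (ge0_muleDr _ a1 b1).
rewrite muleA -EFinM (muleA plancherel_const%:E) -(EFinM plancherel_const) muleA -(EFinM 2) addeA -EFinD addeC.
rewrite le_eqVlt; apply/orP; left; apply/eqP; congr (_%:E * _ + _%:E)%E; first by ring.
rewrite (_ : _ + _ = c * (e / c)); last by rewrite /c; ring.
by rewrite mulrC divfK// gt_eqF.
Qed.

Lemma fourierL2_unique h u h' u' : fourierL2 h u -> fourierL2 h' u' ->
  {ae mu, forall x, h x = h' x} -> {ae mu, forall x, u x = u' x}.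
Proof.
move=> hu hu' hh'.
have D := fourierL2_linear (-1) hu' hu.
have [mD mU _] := D.
have := fourierL2_bound D.
rewrite (ae_N2 (g := fun=> 0) mD); last 2 first.
- by split; exact: measurable_cst.
- by apply: filterS hh' => x ->; ring.
rewrite N2_0 mule0 => le0.
have /(N2_eq0 mU) : N2 (fun x => -1 * u' x + u x)%R = 0%E by apply/eqP; rewrite eq_le le0 N2_ge0.
by apply: filterS => x /eqP; rewrite mulN1r addrC subr_eq0 => /eqP.
Qed.

(** Transforms of integrable approximants form a Cauchy sequence by [plancherel]; their real and
    imaginary parts are completed separately. *)
Lemma fourierL2_exists h : Cmeasurable h -> (N2 h < +oo)%E -> exists u, fourierL2 h u.
Proof.
move=> mh h2.
have K0 := plancherel_const_ge0.
(* Chosen so that the transforms are Cauchy at the rate [del k <= 8^(-k)] required by [L2_complete];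
   the added 1 makes the denominator positive and at least 1. *)
pose eps (k : nat) : R := (8 ^+ k)^-1 / (4 * plancherel_const + 1).
have c0 : 0 < 4 * plancherel_const + 1 by rewrite ltr_wpDl// mulr_ge0.
have eps0 k : 0 < eps k by rewrite divr_gt0// invr_gt0 exprn_gt0.
have /choice[g gP] : forall k, exists g, [/\ Cmeasurable g, (N1 g < +oo)%E &
    (N2 (fun x => h x - g x)%R <= (eps k)%:E)%E].
  by move=> k; exact: L2_approx.
have mg k : Cmeasurable (g k) by have [] := gP k.
have g1 k : (N1 (g k) < +oo)%E by have [] := gP k.
have hg k : (N2 (fun x => h x - g k x)%R <= (eps k)%:E)%E by have [] := gP k.
have epsle k m : (k <= m)%N -> eps m <= eps k.
  move=> km; rewrite ler_pM2r ?invr_gt0// lef_pV2 ?posrE ?exprn_gt0//.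
  by rewrite ler_eXn2l// ltr1n.
pose del k : R := 4 * plancherel_const * eps k.
have delle k : del k <= (8 ^+ k)^-1.
  rewrite /del /eps mulrCA ler_piMr ?invr_ge0 ?exprn_ge0// ler_pdivrMr// mul1r lerDl//.
have cau k m : (k <= m)%N ->
    (N2 (fun x => fourier (g m) x - fourier (g k) x)%R <= (del k)%:E)%E.
  move=> km.
  rewrite (eq_N2 (g := fourier (fun x => -1 * g k x + g m x))); last first.
    by move=> x; rewrite fourier_linear//; ring.
  have md : Cmeasurable (fun x => -1 * g k x + g m x).
    by apply: CmeasurableD => //; exact: CmeasurableZ.
  apply: le_trans (plancherel md (N1_linear _ _ _ _ _)) _ => //.
  rewrite (eq_N2 (g := fun x => (h x - g k x) + -1 * (h x - g m x))); last by move=> x; ring.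
  apply: (@le_trans _ _ (plancherel_const%:E * (2%:E * (eps k)%:E + 2%:E * (eps k)%:E))%E).
    apply: lee_wpmul2l => //; apply: le_trans (N2D _ _) _.
    - exact: CmeasurableB.
    - by apply: CmeasurableZ; exact: CmeasurableB.
    rewrite (N2Z (-1) (CmeasurableB mh (mg m))) cabsN1 expr1n mul1e.
    apply: leeD; apply: lee_wpmul2l => //.
    by apply: (le_trans (hg m)); rewrite lee_fin epsle.
  change ((plancherel_const * (2 * eps k + 2 * eps k))%:E <= (del k)%:E)%E.
  by rewrite lee_fin /del le_eqVlt; apply/orP; left; apply/eqP; ring.
have mF k := Cmeasurable_fourier (mg k) (g1 k).
have [ur mur urP] : exists2 v : Rd R d -> R, measurable_fun setT v &
    forall k, (\int[mu]_x ((v x - complex.Re (fourier (g k) x)) ^+ 2)%:E <= (del k)%:E)%E.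
  apply: L2_complete => // [k|k m km]; first by case: (mF k).
  apply: le_trans (cau k m km); apply: ge0_le_integral_nomeas => x; first by rewrite lee_fin sqr_ge0.
  by rewrite lee_fin sqr_cabs ReD ReN lerDl sqr_ge0.
have [ui mui uiP] : exists2 v : Rd R d -> R, measurable_fun setT v &
    forall k, (\int[mu]_x ((v x - complex.Im (fourier (g k) x)) ^+ 2)%:E <= (del k)%:E)%E.
  apply: L2_complete => // [k|k m km]; first by case: (mF k).
  apply: le_trans (cau k m km); apply: ge0_le_integral_nomeas => x; first by rewrite lee_fin sqr_ge0.
  by rewrite lee_fin sqr_cabs ImD ImN lerDr sqr_ge0.
exists (fun x => Complex (ur x) (ui x)); split=> // e e0.
have [k ke] : exists k : nat, 2 * (8 ^+ k)^-1 <= e.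
  have h8 : `|8^-1 : R| < 1 by rewrite ger0_norm// invf_lt1// ltr1n.
  have /cvgrPdist_lt /(_ _ e0) := cvg_geometric 2 h8.
  move=> /filter_ex[k]; rewrite sub0r normrN /geometric/= => ek; exists k.
  by move: ek; rewrite ger0_norm ?mulr_ge0 ?exprn_ge0// exprVn => /ltW.
exists (g k); split=> //.
  apply: (le_trans (hg k)); rewrite lee_fin; apply: le_trans ke.
  rewrite /eps ler_pdivrMr// mulrAC ler_peMl ?invr_ge0 ?exprn_ge0//.
  lra.
have mdr : measurable_fun setT (fun x => ((ur x - complex.Re (fourier (g k) x)) ^+ 2)%:E).
  by apply/measurable_EFinP; apply: measurable_funX; apply: measurable_funB => //; case: (mF k).
have mdi : measurable_fun setT (fun x => ((ui x - complex.Im (fourier (g k) x)) ^+ 2)%:E).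
  by apply/measurable_EFinP; apply: measurable_funX; apply: measurable_funB => //; case: (mF k).
rewrite /N2; under eq_integral do rewrite sqr_cabs ReD ImD ReN ImN EFinD.
rewrite ge0_integralD//; [|by move=> x _; rewrite lee_fin sqr_ge0..].
apply: (@le_trans _ _ ((del k)%:E + (del k)%:E)%E); first exact: leeD.
rewrite -EFinD lee_fin; apply: le_trans ke; have := delle k; lra.
Qed.

(* [w] is the Fourier transform of [f] in the sense of L^1 + L^2. *)
Definition fourier12 f w : Prop := Cmeasurable w /\ exists g h u,
  [/\ Cmeasurable g, (N1 g < +oo)%E, fourierL2 h u,
      {ae mu, forall x, f x = g x + h x} &
      {ae mu, forall x, w x = fourier g x + u x}].

(** From g + h = g' + h' the function g - g' = h' - h is integrable and also a difference of
    functions with an L^2 transform. By [fourierL2_unique] the two transforms of it agree. *)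
Lemma fourier12_unique f w f' w' : fourier12 f w -> fourier12 f' w' ->
  {ae mu, forall x, f x = f' x} -> {ae mu, forall x, w x = w' x}.
Proof.
move=> [_ [g [h [u [mg g1 hu fgh wgu]]]]] [_ [g' [h' [u' [mg' g1' hu' fgh' wgu']]]]] ff'.
have md : Cmeasurable (fun x => -1 * g' x + g x).
  by apply: CmeasurableD => //; exact: CmeasurableZ.
have L := fourierL2_L1 md (N1_linear _ mg' mg g1' g1).
have D := fourierL2_linear (-1) hu hu'.
have E : {ae mu, forall x, -1 * g' x + g x = -1 * h x + h' x}.
  apply: filterS3 ff' fgh fgh' => x -> e1 e2.
  have : g x + h x = g' x + h' x by rewrite -e1 -e2.
  move=> e; have -> : g x = g' x + h' x - h x by rewrite -e addrK.
  by ring.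
apply: filterS3 (fourierL2_unique L D E) wgu wgu' => x e1 -> ->.
move: e1; rewrite fourier_linear// !mulN1r => e1.
by rewrite -(addNKr (fourier g' x) (fourier g x)) e1; ring.
Qed.

Lemma fourier12_linear a f w f' w' : fourier12 f w -> fourier12 f' w' ->
  fourier12 (fun x => a * f x + f' x) (fun x => a * w x + w' x).
Proof.
move=> [mw [g [h [u [mg g1 hu fgh wgu]]]]] [mw' [g' [h' [u' [mg' g1' hu' fgh' wgu']]]]].
split; first by apply: CmeasurableD => //; exact: CmeasurableZ.
exists (fun x => a * g x + g' x), (fun x => a * h x + h' x), (fun x => a * u x + u' x); split.
- by apply: CmeasurableD => //; exact: CmeasurableZ.
- exact: N1_linear.
- exact: fourierL2_linear.
- by apply: filterS2 fgh fgh' => x -> ->; rewrite mulrDr addrACA.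
- by apply: filterS2 wgu wgu' => x -> ->; rewrite fourier_linear// mulrDr addrACA.
Qed.

Lemma fourier12_L1 f : Cmeasurable f -> (N1 f < +oo)%E -> fourier12 f (fourier f).
Proof.
move=> mf f1; split; first exact: Cmeasurable_fourier.
have m0 : Cmeasurable ((fun=> 0) : Rd R d -> R[i]) by split; exact: measurable_cst.
have N10 : N1 ((fun=> 0) : Rd R d -> R[i]) = 0%E.
  by apply: integral0_eq => x _; rewrite cabs0.
exists f, (fun=> 0), (fourier (fun=> 0)); split => //.
- by apply: fourierL2_L1 => //; rewrite N10.
- by apply: aeW => x; rewrite addr0.
- by apply: aeW => x; rewrite fourier0 addr0.
Qed.

(** * Cutting at a height, Paley's inequality and the operator on L^p *)

Section Lp.
Variable p : R.
Hypotheses (p1 : 1 < p) (p2 : p < 2).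

Definition Np f : \bar R := (\int[mu]_x (cabs (f x) `^ p)%:E)%E.

Lemma LpnormE f : Lpnorm p f = (Np f `^ p^-1)%E.
Proof.
rewrite /Lpnorm unlock /Np; congr (_ `^ _)%E.
by apply: eq_integral => x _; rewrite abse_EFin ger0_norm ?cabs_ge0.
Qed.

Lemma Np_ge0 f : (0 <= Np f)%E.
Proof. by apply: integral_ge0 => x _; rewrite lee_fin powR_ge0. Qed.

Lemma inLpP f : inLp p f <-> Cmeasurable f /\ (Np f < +oo)%E.
Proof.
have pi0 : 0 < p^-1 by rewrite invr_gt0 (lt_trans _ p1).
split=> -[mf fp]; split => //; move: fp; rewrite LpnormE.
- by apply: lty_poweRy; rewrite gt_eqF.
- by move=> fp; rewrite poweR_lty.
Qed.

Lemma measurable_powR_cabs f : Cmeasurable f -> measurable_fun setT (fun x => (cabs (f x) `^ p)%:E).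
Proof.
move=> mf; apply/measurable_EFinP; apply: (measurableT_comp (measurable_powR _)).
exact: measurable_cabs.
Qed.

Definition big_part (s : R) f x := if s < cabs (f x) then f x else 0.
Definition small_part (s : R) f x := if cabs (f x) <= s then f x else 0.

Lemma Cmeasurable_big s f : Cmeasurable f -> Cmeasurable (big_part s f).
Proof. by move=> mf; apply: Cmeasurable_if => //; exact: measurable_gt_cabs. Qed.

Lemma Cmeasurable_small s f : Cmeasurable f -> Cmeasurable (small_part s f).
Proof.
move=> mf; apply: Cmeasurable_if => //.
by apply: measurable_fun_ler => //; exact: measurable_cabs.
Qed.

Lemma big_small s f x : f x = big_part s f x + small_part s f x.
Proof. by rewrite /big_part /small_part; case: ltP => _; rewrite ?addr0 ?add0r. Qed.

(** Above height s one has |f| <= s^(1-p) |f|^p because p > 1. In [N2_small], |f|^2 <= s^(2-p) |f|^p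
    below height s because p < 2. *)
Lemma N1_big s f : Cmeasurable f -> (Np f < +oo)%E -> 0 < s -> (N1 (big_part s f) < +oo)%E.
Proof.
move=> mf fp s0.
apply: (@le_lt_trans _ _ ((s `^ (1 - p))%:E * Np f)%E); last first.
  by apply: lte_mul_pinfty => //; rewrite lee_fin powR_ge0.
rewrite -ge0_integralZl_EFin ?powR_ge0//; last 2 first.
- by move=> x _; rewrite lee_fin powR_ge0.
- exact: measurable_powR_cabs.
apply: ge0_le_integral_nomeas => x; first by rewrite lee_fin cabs_ge0.
rewrite -EFinM lee_fin /big_part; case: ltP => h; last by rewrite cabs0 mulr_ge0 ?powR_ge0.
have f0 : 0 < cabs (f x) by exact: lt_trans h.
rewrite -{1}[cabs (f x)]powRr1 ?cabs_ge0// (_ : 1 = (1 - p) + p); last by rewrite subrK.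
rewrite powRD ?(gt_eqF f0) ?implybT//; apply: ler_wpM2r; first exact: powR_ge0.
rewrite subrK -(opprB p 1) !powRN lef_pV2 ?posrE ?powR_gt0//.
by rewrite ge0_ler_powR ?nnegrE ?subr_ge0 ?(ltW p1) ?(ltW s0) ?(ltW f0) ?(ltW h).
Qed.

Lemma N2_small s f : Cmeasurable f -> (Np f < +oo)%E -> 0 < s -> (N2 (small_part s f) < +oo)%E.
Proof.
move=> mf fp s0.
apply: (@le_lt_trans _ _ ((s `^ (2 - p))%:E * Np f)%E); last first.
  by apply: lte_mul_pinfty => //; rewrite lee_fin powR_ge0.
rewrite -ge0_integralZl_EFin ?powR_ge0//; last 2 first.
- by move=> x _; rewrite lee_fin powR_ge0.
- exact: measurable_powR_cabs.
apply: ge0_le_integral_nomeas => x; first by rewrite lee_fin sqr_ge0.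
rewrite -EFinM lee_fin /small_part; case: (leP (cabs (f x)) s) => h; last by rewrite cabs0 expr0n mulr_ge0 ?powR_ge0.
have := cabs_ge0 (f x); rewrite le_eqVlt => /predU1P[<-|f0].
  by rewrite expr0n/= mulr_ge0 ?powR_ge0.
rewrite -powR_mulrn ?cabs_ge0// (_ : 2%:R = (2 - p) + p); last by rewrite subrK.
rewrite powRD ?(gt_eqF f0) ?implybT//; apply: ler_wpM2r; first exact: powR_ge0.
by rewrite ?addrK ge0_ler_powR ?nnegrE ?subr_ge0 ?(ltW p2) ?(ltW s0) ?(ltW f0) ?h// ltW.
Qed.

Lemma powRD_le (x y : R) : 0 <= x -> 0 <= y ->
  (x + y) `^ p <= 2 `^ p * (x `^ p + y `^ p).
Proof.
have p0 : 0 <= p by rewrite ltW// (lt_trans _ p1).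
move=> x0 y0; wlog xy : x y x0 y0 / x <= y.
  move=> h; have [/h|/ltW /h] := leP x y; first exact.
  by rewrite addrC [x `^ p + _]addrC; exact.
apply: (@le_trans _ _ ((2 * y) `^ p)).
  by rewrite ge0_ler_powR ?nnegrE ?addr_ge0 ?mulr_ge0//; lra.
by rewrite powRM// ler_wpM2l ?powR_ge0// lerDr powR_ge0.
Qed.

Lemma inLp_linear a f g : inLp p f -> inLp p g -> inLp p (fun y => a * f y + g y).
Proof.
have p0 : 0 <= p by rewrite ltW// (lt_trans _ p1).
move=> /inLpP[mf fp] /inLpP[mg gp]; apply/inLpP; split.
  by apply: CmeasurableD => //; exact: CmeasurableZ.
have mfp := measurable_powR_cabs mf; have mgp := measurable_powR_cabs mg.
pose c : R := 2 `^ p * cabs a `^ p.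
have c0 : 0 <= c by rewrite mulr_ge0 ?powR_ge0.
apply: (@le_lt_trans _ _ (c%:E * Np f + (2 `^ p)%:E * Np g)%E); last first.
  apply: lte_add_pinfty; apply: lte_mul_pinfty.
  - by rewrite lee_fin.
  - by [].
  - exact: fp.
  - by rewrite lee_fin powR_ge0.
  - by [].
  - exact: gp.
have f0 x : (0 <= (cabs (f x) `^ p)%:E)%E by rewrite lee_fin powR_ge0.
have g0 x : (0 <= (cabs (g x) `^ p)%:E)%E by rewrite lee_fin powR_ge0.
rewrite -!ge0_integralZl_EFin ?powR_ge0// -ge0_integralD//; last 4 first.
- by move=> x _; rewrite mule_ge0.
- exact: emeasurable_funM.
- by move=> x _; rewrite mule_ge0// lee_fin powR_ge0.
- exact: emeasurable_funM.
apply: ge0_le_integral_nomeas => x; first by rewrite lee_fin powR_ge0.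
rewrite -!EFinM -EFinD lee_fin /c -mulrA -powRM ?cabs_ge0// -cabsM -mulrDr.
apply: le_trans (powRD_le (cabs_ge0 _) (cabs_ge0 _)).
by rewrite ge0_ler_powR ?nnegrE ?addr_ge0 ?cabs_ge0// cabsD.
Qed.

Lemma fourier12_split s f : inLp p f -> 0 < s -> exists w u,
  [/\ fourier12 f w, fourierL2 (small_part s f) u, Cmeasurable w &
      {ae mu, forall x, w x = fourier (big_part s f) x + u x}].
Proof.
move=> /inLpP[mf fp] s0.
have [u hu] := fourierL2_exists (Cmeasurable_small s mf) (N2_small mf fp s0).
have mF := Cmeasurable_fourier (Cmeasurable_big s mf) (N1_big mf fp s0).
have mw : Cmeasurable (fun x => fourier (big_part s f) x + u x).
  by apply: CmeasurableD => //; case: hu.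
exists (fun x => fourier (big_part s f) x + u x), u; split => //; last by apply: aeW.
split => //; exists (big_part s f), (small_part s f), u; split => //.
- exact: Cmeasurable_big.
- exact: N1_big.
- by apply: aeW => x; exact: big_small.
- exact: aeW.
Qed.

(** The constant of [marcinkiewicz] with M = 2 from [fourier_bound] and K = 4 [plancherel_const]
    from [fourierL2_bound]. *)
Definition paley_const : R := 2 * 2 * p / (p - 1) + 2 * (4 * plancherel_const) * p / (2 - p).

Lemma paley_const_ge0 : 0 <= paley_const.
Proof.
have p0 : 0 < p by exact: lt_trans p1.
rewrite addr_ge0// divr_ge0 ?subr_ge0 ?(ltW p1) ?(ltW p2)// ?mulr_ge0 ?(ltW p0) ?plancherel_const_ge0//.
by rewrite exprn_ge0// mulr_ge0// pi_ge0.
Qed.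

Lemma marcinkiewicz_leb (v phi : Rd R d -> R) (M K : R) :
  measurable_fun setT v -> measurable_fun setT phi -> (forall x, 0 <= phi x) ->
  0 < M -> 0 <= K ->
  (forall s, 0 < s -> exists v' : Rd R d -> R, [/\ measurable_fun setT v', (forall x, 0 <= v' x),
      {ae mu, forall x, ((v x)%:E <=
         M%:E * \int[mu]_x (phi x * (s < phi x)%R%:R)%:E + (v' x)%:E)%E} &
      (\int[mu]_x (v' x ^+ 2)%:E <= K%:E * \int[mu]_x (phi x ^+ 2 * (phi x <= s)%R%:R)%:E)%E]) ->
  (\int[@lebesgue_measure R]_(t in `]0%R, +oo[)
     (((t `^ (conjexp p)^-1)%:E * decr_rearr mu v t) `^ p * (t^-1)%:E) <=
   (2 * M * p / (p - 1) + 2 * K * p / (2 - p))%:E * \int[mu]_x (phi x `^ p)%:E)%E.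
Proof.
rewrite /lebd -leb_sfiniteE => mv mphi phi0 M0 K0 split.
exact: marcinkiewicz.
Qed.

(** For each s the given w agrees almost everywhere with the transform built from the cut at height
    s, by uniqueness; so one w satisfies the splitting hypothesis at all heights. *)
Lemma fourier12_lorentz f w : inLp p f -> fourier12 f w ->
  (lorentz_norm (conjexp p) p w <= (paley_const `^ p^-1)%:E * Lpnorm p f)%E.
Proof.
move=> Lf fw; have [mf fp] := (inLpP f).1 Lf.
have p0 : 0 < p by exact: lt_trans p1.
rewrite LpnormE -poweR_EFin -poweRM ?Np_ge0 ?lee_fin ?paley_const_ge0//.
rewrite /lorentz_norm; apply: gt0_ler_poweR => //.
- by rewrite invr_ge0 ltW.
- by rewrite in_itv/= leey andbT integral_ge0// => t /=; rewrite in_itv/= andbT => t0;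
    rewrite mule_ge0 ?poweR_ge0// lee_fin invr_ge0 ltW.
- by rewrite in_itv/= leey andbT mule_ge0 ?Np_ge0// lee_fin paley_const_ge0.
apply: (marcinkiewicz_leb (v := fun x => cabs (w x)) (phi := fun x => cabs (f x)) (M := 2) (K := 4 * plancherel_const)).
- by apply: measurable_cabs; case: fw.
- exact: measurable_cabs.
- by move=> x; exact: cabs_ge0.
- by [].
- by rewrite mulr_ge0// plancherel_const_ge0.
move=> s s0.
have [w' [u [fw' hu mw' wu]]] := fourier12_split Lf s0.
have mu_ : Cmeasurable u by case: hu.
exists (fun x => cabs (u x)); split.
- exact: measurable_cabs.
- by move=> x; exact: cabs_ge0.
- have ww' : {ae mu, forall x, w x = w' x} by apply: fourier12_unique fw fw' _; exact: aeW.
  apply: filterS2 ww' wu => x -> ->.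
  apply: (@le_trans _ _ ((cabs (fourier (big_part s f) x))%:E + (cabs (u x))%:E)%E).
    by rewrite -EFinD lee_fin cabsD.
  apply: leeD => //; apply: le_trans (fourier_bound _ (Cmeasurable_big s mf) (N1_big mf fp s0)) _.
  rewrite le_eqVlt; apply/orP; left; apply/eqP; congr (_ * _)%E.
  apply: eq_integral => t _; rewrite /big_part.
  by case: ltP => _; rewrite ?mulr1 ?mulr0 ?cabs0.
- apply: le_trans (fourierL2_bound hu) _.
  rewrite le_eqVlt; apply/orP; left; apply/eqP; congr (_ * _)%E.
  apply: eq_integral => t _; rewrite /small_part.
  by case: ifP => _; rewrite ?mulr1 ?mulr0 ?cabs0 ?expr0n.
Qed.

Lemma fourier_operator_exists : exists T, @fourier_operator R d p T.
Proof.
have ex f : exists w, inLp p f -> fourier12 f w.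
  (* Outside L^p the function itself is taken as a default value. *)
  have [Lf|nLf] := pselect (inLp p f); last by exists f.
  by have [w [u [fw _ _ _]]] := fourier12_split Lf (@ltr01 R); exists w.
have /choice[T TP] := ex.
exists T; split.
- by move=> f g Lf Lg fg; exact: fourier12_unique (TP _ Lf) (TP _ Lg) fg.
- move=> a f g Lf Lg.
  have Lfg := inLp_linear a Lf Lg.
  apply: fourier12_unique (TP _ Lfg) (fourier12_linear a (TP _ Lf) (TP _ Lg)) _.
  exact: aeW.
- exists (paley_const `^ p^-1) => f Lf.
  have b := fourier12_lorentz Lf (TP _ Lf).
  split=> //; split; first by case: (TP _ Lf).
  apply: (le_lt_trans b); apply: lte_mul_pinfty => //; first by rewrite lee_fin powR_ge0.
  by case: Lf.
- move=> f Lf /inLp1[mf f1].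
  apply: fourier12_unique (TP _ Lf) (fourier12_L1 mf f1) _; exact: aeW.
Qed.

End Lp.

End FourierL2.

(** * Integrals against indicators of sets of finite measure *)

Section IndicatorIntegral.
Context d (T : measurableType d) (R : realType) (mu : {measure set T -> \bar R}).
Variables (E : set T) (e : R).
Hypotheses (mE : measurable E) (muE : mu E = e%:E).

Lemma integrable_indic_fin : mu.-integrable setT (EFin \o (\1_E : T -> R)).
Proof.
apply/integrableP; split; first exact/measurable_EFinP.
under eq_integral => x _ do rewrite abse_EFin ger0_norm//.
by rewrite integral_indic// setIT muE ltry.
Qed.

Lemma Rintegral_indic_fin : Rintegral mu setT (\1_E : T -> R) = e.
Proof. by rewrite /Rintegral integral_indic// setIT muE. Qed.

Variable g : T -> R.
Hypotheses (mg : measurable_fun setT g) (g1 : forall x, `|g x| <= 1).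

Lemma Rintegral_indic_le : `|Rintegral mu setT (fun x => \1_E x * g x)| <= e.
Proof.
have iEg := integrable_bounded_factor integrable_indic_fin mg g1.
apply: le_trans (le_normr_Rintegral _ iEg) _ => //.
rewrite -[leRHS]Rintegral_indic_fin; apply: le_Rintegral => //.
- exact: (integrable_norm iEg).
- exact: integrable_indic_fin.
- by move=> x _; rewrite normrM ger0_norm// ler_piMr.
Qed.

Lemma Rintegral_indic_ge (b : R) : (forall x, E x -> b <= g x) ->
  b * e <= Rintegral mu setT (fun x => \1_E x * g x).
Proof.
move=> gb; have iEg := integrable_bounded_factor integrable_indic_fin mg g1.
rewrite -[e]Rintegral_indic_fin -RintegralZl//; last exact: integrable_indic_fin.
apply: le_Rintegral => //.
  exact: (integrableZl _ _ integrable_indic_fin).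
move=> x _; rewrite indicE; case: (boolP (x \in E)) => [/set_mem/gb|_].
  by rewrite mulr1 mul1r.
by rewrite mulr0 mul0r.
Qed.

End IndicatorIntegral.

(** * Fourier transforms of dilated boxes *)

Section Blocks.
Variable R : realType.
Local Notation lam := (@lebesgue_measure R).

(** The squared modulus of the Fourier transform of a real function. *)
Definition sqr_ft n (a : Rn R n -> R) (x : Rn R n) : R := cos_transform a x ^+ 2 + sin_transform a x ^+ 2.

Lemma measurable_cosdot n (x : Rn R n) : measurable_fun setT (fun t => cos (dotR x t)).
Proof.
apply: (measurableT_comp (f := cos)); last exact: measurable_dotR1.
by apply: continuous_measurable_fun; exact: continuous_cos.
Qed.

Lemma measurable_sindot n (x : Rn R n) : measurable_fun setT (fun t => sin (dotR x t)).
Proof.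
apply: (measurableT_comp (f := sin)); last exact: measurable_dotR1.
by apply: continuous_measurable_fun; exact: continuous_sin.
Qed.

Lemma cos_ge_cos1 (y : R) : 0 <= y <= 1 -> cos 1 <= cos y.
Proof.
move=> /andP[y0 y1]; have := @pi_ge2 R => pi2.
by rewrite le_eqVlt; case: (ltgtP y 1) y1 => // [y1 _|->]; rewrite ?eqxx// ltr_cos ?in_itv/= ?y1 ?orbT//; apply/andP; split; lra.
Qed.

Lemma integral_cos_block (s x : R) : 0 < s -> x != 0 ->
  Rintegral lam setT (fun t => \1_(`[s, 2 * s]%classic) t * cos (x * t)) = (sin (x * (2 * s)) - sin (x * s)) / x.
Proof.
move=> s0 x0.
have F (t : R) : is_derive t 1 (fun t : R => sin (x * t) / x) (cos (x * t)).
  apply: is_derive_eq.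
  by rewrite scaler0 add0r /GRing.scale /=; field.
have Fc (t : R) : {for t, continuous (fun t : R => sin (x * t) / x)}.
  by apply/differentiable_continuous/derivable1_diffP; have [] := F t.
rewrite (_ : Rintegral _ _ _ = Rintegral lam `[s, 2 * s]%classic (fun t => cos (x * t))); last first.
  rewrite [RHS]Rintegral_mkcond; apply: eq_Rintegral => t _.
  by rewrite patchE indicE; case: (t \in _); rewrite ?mul1r ?mul0r.
rewrite /Rintegral (@continuous_FTC2 _ _ (fun t : R => sin (x * t) / x)).
- by rewrite -EFinB/= mulrBl.
- by lra.
- apply: continuous_subspaceT => t; apply: continuous_comp; last exact: continuous_cos.
  by apply: cvgM; [exact: cvg_cst|exact: cvg_id].
- split.
  + by move=> t _; have [] := F t.
  + exact: (cvg_at_right_filter (Fc s)).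
  + exact: (cvg_at_left_filter (Fc (2 * s))).
- by move=> t _; rewrite derive1E; have [] := F t.
Qed.

Lemma integral_sin_block (s x : R) : 0 < s -> x != 0 ->
  Rintegral lam setT (fun t => \1_(`[s, 2 * s]%classic) t * sin (x * t)) = (cos (x * s) - cos (x * (2 * s))) / x.
Proof.
move=> s0 x0.
have F (t : R) : is_derive t 1 (fun t : R => - cos (x * t) / x) (sin (x * t)).
  apply: is_derive_eq.
  by rewrite scaler0 add0r /GRing.scale /=; field.
have Fc (t : R) : {for t, continuous (fun t : R => - cos (x * t) / x)}.
  by apply/differentiable_continuous/derivable1_diffP; have [] := F t.
rewrite (_ : Rintegral _ _ _ = Rintegral lam `[s, 2 * s]%classic (fun t => sin (x * t))); last first.
  rewrite [RHS]Rintegral_mkcond; apply: eq_Rintegral => t _.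
  by rewrite patchE indicE; case: (t \in _); rewrite ?mul1r ?mul0r.
rewrite /Rintegral (@continuous_FTC2 _ _ (fun t : R => - cos (x * t) / x)).
- by rewrite -EFinB/=; field.
- by lra.
- apply: continuous_subspaceT => t; apply: continuous_comp; last exact: continuous_sin.
  by apply: cvgM; [exact: cvg_cst|exact: cvg_id].
- split.
  + by move=> t _; have [] := F t.
  + exact: (cvg_at_right_filter (Fc s)).
  + exact: (cvg_at_left_filter (Fc (2 * s))).
- by move=> t _; rewrite derive1E; have [] := F t.
Qed.

Lemma sqr_ft_le n (E : set (Rn R n)) (e : R) (x : Rn R n) : measurable E -> leb R n E = e%:E ->
  sqr_ft (\1_E) x <= (2 * e) ^+ 2.
Proof.
move=> mE muE.
have e0 : 0 <= e by rewrite -lee_fin -muE.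
have hc := Rintegral_indic_le mE muE (measurable_cosdot x) (fun t => cos_max _).
have hs := Rintegral_indic_le mE muE (measurable_sindot x) (fun t => sin_max _).
have sq (u : R) : `|u| <= e -> u ^+ 2 <= e ^+ 2.
  by move=> ue; rewrite -[leLHS]real_normK ?num_real// ler_sqr ?nnegrE.
apply: le_trans (lerD (sq _ hc) (sq _ hs)) _.
by rewrite exprMn; have := sqr_ge0 e; lra.
Qed.

Lemma sqr_ft_ge n (E : set (Rn R n)) (e b : R) (x : Rn R n) : measurable E -> leb R n E = e%:E ->
  0 <= b -> (forall t, E t -> b <= cos (dotR x t)) -> (b * e) ^+ 2 <= sqr_ft (\1_E) x.
Proof.
move=> mE muE b0 Eb.
have e0 : 0 <= e by rewrite -lee_fin -muE.
have h := Rintegral_indic_ge mE muE (measurable_cosdot x) (fun t => cos_max _) Eb.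
rewrite (le_trans (_ : _ <= cos_transform (\1_E) x ^+ 2))//; last by rewrite lerDl sqr_ge0.
by rewrite ler_sqr ?nnegrE ?mulr_ge0// (le_trans _ h)// mulr_ge0.
Qed.

Lemma leb_itv (a b : R) : a <= b -> lam `[a, b]%classic = (b - a)%:E.
Proof.
move=> ab; rewrite lebesgue_measure_itv/= lte_fin; case: ltP => // ba.
by rewrite (@le_anti _ _ a b) ?ab// subrr.
Qed.

(** The addition formulas and Fubini give cc' - ss' and sc' + cs' for the two components, whose
    squares add up to (c^2 + s^2)(c'^2 + s'^2). *)
Lemma sqr_ft_prod n (E : set (Rn R n)) (F : set R) (e f : R) (x : Rn R n.+1) :
  measurable E -> measurable (F : set (measurableTypeR R)) -> leb R n E = e%:E -> lam F = f%:E ->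
  @sqr_ft n.+1 (\1_(E `*` F)) x = @sqr_ft n (\1_E) x.1 * @sqr_ft 0 (\1_F) x.2.
Proof.
move=> mE mF muE muF.
pose c1 (t : Rn R n) : R := \1_E t * cos (dotR x.1 t).
pose s1 (t : Rn R n) : R := \1_E t * sin (dotR x.1 t).
pose c2 (t : Rn R 0) : R := \1_F t * cos (@dotR R 0 x.2 t).
pose s2 (t : Rn R 0) : R := \1_F t * sin (@dotR R 0 x.2 t).
have ic1 : (leb R n).-integrable setT (EFin \o c1).
  exact: integrable_bounded_factor (integrable_indic_fin mE muE) (measurable_cosdot x.1) (fun t => cos_max _).
have is1 : (leb R n).-integrable setT (EFin \o s1).
  exact: integrable_bounded_factor (integrable_indic_fin mE muE) (measurable_sindot x.1) (fun t => sin_max _).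
have ic2 : (leb R 0).-integrable setT (EFin \o c2).
  exact: (@integrable_bounded_factor _ _ (Rn R 0) (leb R 0) _ _
    (@integrable_indic_fin _ (Rn R 0) R (leb R 0) _ _ mF muF) (@measurable_cosdot 0 _) (fun t => cos_max _)).
have is2 : (leb R 0).-integrable setT (EFin \o s2).
  exact: (@integrable_bounded_factor _ _ (Rn R 0) (leb R 0) _ _
    (@integrable_indic_fin _ (Rn R 0) R (leb R 0) _ _ mF muF) (@measurable_sindot 0 _) (fun t => sin_max _)).
have E1 (t : Rn R n.+1) : \1_(E `*` F) t = \1_E t.1 * \1_F t.2 :> R.
  by rewrite !indicE in_setX; case: (_ \in E); case: (_ \in F); rewrite /= ?mulr1 ?mulr0.
have cE : @cos_transform R n.+1 (\1_(E `*` F)) x =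
    cos_transform (\1_E) x.1 * @cos_transform R 0 (\1_F) x.2 - sin_transform (\1_E) x.1 * @sin_transform R 0 (\1_F) x.2.
  rewrite /cos_transform /sin_transform.
  rewrite (_ : (fun t : Rn R n.+1 => _) = (fun t : Rn R n.+1 => c1 t.1 * c2 t.2 - s1 t.1 * s2 t.2)); last first.
    apply/funext => t; rewrite E1 /c1 /c2 /s1 /s2 /= cosD; ring.
  move: ic1 is1; rewrite /= -leb_sfiniteE => ic1 is1.
  rewrite RintegralB//; last 2 first.
  - exact: (integrable_prodM (mx := leb_sfinite R n) (my := lam)).
  - exact: (integrable_prodM (mx := leb_sfinite R n) (my := lam)).
  by rewrite /Rintegral (integral_prodM (mx := leb_sfinite R n) (my := lam))// (integral_prodM (mx := leb_sfinite R n) (my := lam)).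
have sE : @sin_transform R n.+1 (\1_(E `*` F)) x =
    sin_transform (\1_E) x.1 * @cos_transform R 0 (\1_F) x.2 + cos_transform (\1_E) x.1 * @sin_transform R 0 (\1_F) x.2.
  rewrite /cos_transform /sin_transform.
  rewrite (_ : (fun t : Rn R n.+1 => _) = (fun t : Rn R n.+1 => s1 t.1 * c2 t.2 + c1 t.1 * s2 t.2)); last first.
    apply/funext => t; rewrite E1 /c1 /c2 /s1 /s2 /= sinD; ring.
  move: ic1 is1; rewrite /= -leb_sfiniteE => ic1 is1.
  rewrite RintegralD//; last 2 first.
  - exact: (integrable_prodM (mx := leb_sfinite R n) (my := lam)).
  - exact: (integrable_prodM (mx := leb_sfinite R n) (my := lam)).
  by rewrite /Rintegral (integral_prodM (mx := leb_sfinite R n) (my := lam))// (integral_prodM (mx := leb_sfinite R n) (my := lam)).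
by rewrite /sqr_ft cE sE; ring.
Qed.

Lemma leb_prod n (E : set (Rn R n)) (F : set R) :
  measurable E -> measurable (F : set (measurableTypeR R)) ->
  leb R n.+1 (E `*` F) = (leb R n E * lam F)%E.
Proof. by move=> mE mF; exact: product_measure1E. Qed.

Lemma blocks n : exists (E A : R -> set (Rn R n)) (b B : R), [/\ 0 < b, 0 < B &
  forall s, 0 < s ->
  [/\ measurable (E s) /\ measurable (A s), leb R n (E s) = s%:E, leb R n (A s) = (s^-1 / 4)%:E,
   (forall r, 4 * s <= r -> E s `&` E r = set0) &
   forall x, A s x -> (b * s) ^+ 2 <= sqr_ft (\1_(E s)) x /\
     forall r, 0 < r -> sqr_ft (\1_(E r)) x <= (B * Num.min r s) ^+ 2]].
Proof.
have c1 := @cos1_gt0 R.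
elim: n => [|n [E [A [b [B [b0 B0 EA]]]]]].
  (* For x in A_s and t in E_s the product xt lies in [1/4, 1], so the cosine is at least cos 1. The
     value 16 covers both upper bounds: 2r when r <= s, and two components of size at most 8s when r
     > s. *)
  exists (fun s => `[s, 2 * s]%classic), (fun s => `[s^-1 / 4, s^-1 / 2]%classic), (cos 1), 16.
  split => // s s0; have si0 : 0 < s^-1 by rewrite invr_gt0.
  have mE r : 0 < r -> leb R 0 `[r, 2 * r]%classic = r%:E.
    by move=> r0; rewrite /= leb_itv; [congr EFin; ring|lra].
  split.
  - by split; exact: measurable_itv.
  - exact: mE.
  - by rewrite /= leb_itv; [congr EFin; field; rewrite gt_eqF|lra].
  - move=> r sr; rewrite -subset0 => x [] /=; rewrite !in_itv/=; lra.
  move=> x /=; rewrite in_itv/= => /andP[x1 x2]; split.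
    apply: (sqr_ft_ge (n := 0) (measurable_itv `[s, 2 * s]) (mE _ s0) (ltW c1)).
    move=> t /=; rewrite in_itv/= => /andP[t1 t2]; apply: cos_ge_cos1.
    rewrite mulr_ge0//=; [|lra|lra].
    rewrite (le_trans (ler_pM _ _ x2 t2))//; [lra|lra|].
    by rewrite (_ : _ * _ = 1)//; field; rewrite gt_eqF.
  have x0 : 0 < x by lra.
  move=> r r0; rewrite minEle; case: ifPn => rs.
    apply: le_trans (sqr_ft_le (n := 0) x (measurable_itv `[r, 2 * r]) (mE _ r0)) _.
    by rewrite ler_sqr ?nnegrE; lra.
  rewrite /sqr_ft /cos_transform /sin_transform /= integral_cos_block ?gt_eqF// integral_sin_block ?gt_eqF//.
  (* For r > s the explicit transform of an interval decays like 2/x in each component, and points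
     of A_s are at least 1/(4s). *)
  have xi : x^-1 <= 4 * s.
    by rewrite -[4 * s]invrK lef_pV2 ?posrE ?invr_gt0 ?mulr_gt0// invfM mulrC.
  have K (u v : R) : `|u| <= 1 -> `|v| <= 1 -> ((u - v) / x) ^+ 2 <= (8 * s) ^+ 2.
    move=> u1 v1; rewrite -[leLHS]real_normK ?num_real// ler_sqr ?nnegrE//; last by lra.
    rewrite normrM (_ : 8 * s = 2 * (4 * s)); last by ring.
    apply: ler_pM => //; last by rewrite ger0_norm ?invr_ge0 ?(ltW x0).
    by rewrite (le_trans (ler_normB _ _))//; lra.
  apply: le_trans (lerD (K _ _ (sin_max _) (sin_max _)) (K _ _ (cos_max _) (cos_max _))) _.
  by rewrite !exprMn; have := sqr_ge0 s; lra.
pose I : set R := `[0, 1]%classic.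
have mI : measurable (I : set (measurableTypeR R)) by exact: measurable_itv.
have muI : lam I = 1%:E by rewrite leb_itv// subr0.
(* The extra coordinate contributes a factor independent of s: at least (cos 1)^2 since products of
   points of [0, 1] stay in [0, 1], and at most 2^2 by the trivial bound. *)
exists (fun s => E s `*` I), (fun s => A s `*` I), (b * cos 1), (B * 2).
split; [exact: mulr_gt0|exact: mulr_gt0|] => s s0.
have [[mE mA] muE muA dE EAs] := EA _ s0.
split.
- by split; exact: measurableX.
- by rewrite leb_prod// muE muI mule1.
- by rewrite leb_prod// muA muI mule1.
- move=> r sr; rewrite -subset0 => -[x y] [/= [Ex _] [Er _]].
  by rewrite -[False]/(set0 x) -(dE _ sr).
move=> x [/EAs[lo up] Ix]; split.
  rewrite (sqr_ft_prod _ mE mI muE muI) mulrAC exprMn.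
  apply: ler_pM; [exact: sqr_ge0|exact: sqr_ge0|exact: lo|].
  rewrite -[cos 1]mulr1; apply: (@sqr_ft_ge 0 _ 1) => //; first exact: ltW.
  move=> t It; apply: cos_ge_cos1; move: It Ix; rewrite /I /= !in_itv/= => /andP[t0 t1] /andP[y0 y1].
  by rewrite mulr_ge0//= mulr_ile1.
move=> r r0; have [[mEr _] muEr _ _ _] := EA _ r0.
rewrite (sqr_ft_prod _ mEr mI muEr muI) mulrAC exprMn; apply: ler_pM.
- by rewrite addr_ge0 ?sqr_ge0.
- by rewrite addr_ge0 ?sqr_ge0.
- exact: up.
- by apply: le_trans (sqr_ft_le (n := 0) _ mI muI) _; rewrite mulr1.
Qed.

End Blocks.

(** * Lacunary sums *)

Section LacunarySums.
Variable R : realType.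

Definition natdist (l m : nat) : nat := (l - m + (m - l))%N.

Lemma sum_geom_natdist (m N : nat) :
  \sum_(l < N | (l : nat) != m) (4^-1 : R) ^+ natdist l m <= 1.
Proof.
have h0 k : 0 <= (4^-1 : R) ^+ k by rewrite exprn_ge0.
(* The induction needs the exact partial sums: a geometric sum increasing towards m while N <= m,
   then its mirror image beyond m, with total 2/3. *)
suff : \sum_(l < N | (l : nat) != m) (4^-1 : R) ^+ natdist l m <=
    (if (N <= m)%N then 4^-1 ^+ (m - N) / 3 else 2 / 3 - 4^-1 ^+ (N - m).-1 / 3).
  move=> /le_trans; apply; case: ifP => _; last by have := h0 (N - m).-1; lra.
  have : (4^-1 : R) ^+ (m - N) <= 1 by rewrite exprn_ile1// invf_le1// ler1n.
  by have := h0 (m - N)%N; lra.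
elim: N => [|N IH].
  by rewrite big_ord0 leq0n divr_ge0.
rewrite big_mkcond big_ord_recr/= -big_mkcond/=.
apply: le_trans (lerD IH (lexx _)) _.
case: (ltngtP N m) => [Nm|mN|->].
- rewrite /natdist (_ : (N - m)%N = 0%N) ?add0n; last by apply/eqP; rewrite subn_eq0 ltnW.
  by rewrite -(subnSK Nm) exprS/=; move: (_ ^+ _) => u; lra.
- rewrite /natdist (_ : (m - N)%N = 0%N) ?addn0; last by apply/eqP; rewrite subn_eq0 ltnW.
  rewrite subSn ?(ltnW mN)//= -(prednK (n := (N - m))) ?subn_gt0//= exprS; move: (_ ^+ _) => u; lra.
- by rewrite subnn subSn// subnn /= expr0; lra.
Qed.

Variable p : R.
Hypothesis p1 : 1 < p.

(** Every z_i is at most the l^p norm of z, and so is an average with total weight at most 1. *)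
Lemma powR_sum_le (I : finType) (P : pred I) (w z : I -> R) :
  (forall i, 0 <= w i) -> (forall i, 0 <= z i) -> \sum_(i | P i) w i <= 1 ->
  (\sum_(i | P i) w i * z i) `^ p <= \sum_(i | P i) z i `^ p.
Proof.
have p0 : 0 < p by exact: lt_trans p1.
move=> w0 z0 w1; set S := \sum_(i | P i) z i `^ p.
have S0 : 0 <= S by apply: sumr_ge0 => i _; exact: powR_ge0.
have SE : S = (S `^ p^-1) `^ p by rewrite -powRrM mulVf ?gt_eqF// powRr1.
rewrite SE ge0_ler_powR ?nnegrE ?powR_ge0 ?(ltW p0)//; last first.
  apply: (@le_trans _ _ (\sum_(i | P i) w i * S `^ p^-1)); last first.
    by rewrite -mulr_suml ler_piMl// powR_ge0.
  apply: ler_sum => i Pi; rewrite ler_wpM2l//.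
  have -> : z i = (z i `^ p) `^ p^-1 by rewrite -powRrM mulfV ?gt_eqF// powRr1.
  rewrite ge0_ler_powR ?nnegrE ?powR_ge0 ?invr_ge0 ?(ltW p0)//.
  by rewrite /S (bigD1 i)//= lerDl sumr_ge0// => k _; exact: powR_ge0.
by apply: sumr_ge0 => i _; rewrite mulr_ge0.
Qed.

(** A matrix with diagonal b and off-diagonal entries B rho^|l-m| is bounded below on l^p once rho
    is small: the off-diagonal part [v] has p-th power sum at most B^p eta times that of y, and 2^p
    times this is at most half of b^p times the latter. *)
Lemma lacunary_sum (b B : R) : 0 < b -> 0 < B -> exists2 rho : R, 0 < rho <= 2^-1 &
  forall (N : nat) (y : nat -> R), (forall m, 0 <= y m) ->
  b `^ p * \sum_(m < N) y m `^ p <= 2 * 2 `^ p *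
    \sum_(m < N) Num.max 0 (b * y m - B * \sum_(l < N | (l : nat) != m) rho ^+ natdist l m * y l) `^ p.
Proof.
move=> b0 B0; have p0 : 0 < p by exact: lt_trans p1.
have c0 : 0 < b `^ p / (2 * 2 `^ p * B `^ p) by rewrite divr_gt0 ?mulr_gt0 ?powR_gt0.
(* The second entry is what lets the off-diagonal part be absorbed. With rho = eta/16 one has 4 rho
   = eta/4, so a geometric weight 4^(-k) and a factor [eta] remain after 4^(-k) has been split off
   from rho^k. *)
pose eta := Num.min 1 (b `^ p / (2 * 2 `^ p * B `^ p)).
have eta0 : 0 < eta by rewrite lt_min ltr01.
have eta1 : eta <= 1 by rewrite ge_min lexx.
have etaB : 2 * 2 `^ p * (B `^ p * eta) <= b `^ p.
  rewrite mulrA mulrC -ler_pdivlMr ?mulr_gt0 ?powR_gt0//.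
  by rewrite ge_min lexx orbT.
exists (eta / 16); first by apply/andP; split; lra.
move=> N y y0.
have pp0 : 0 < 2 `^ p :> R by rewrite powR_gt0.
set rho := eta / 16.
pose v m := B * \sum_(l < N | (l : nat) != m) rho ^+ natdist l m * y l.
pose S := \sum_(m < N) y m `^ p.
have h0 k : 0 <= (4^-1 : R) ^+ k by rewrite exprn_ge0.
have r40 k : 0 <= (4 * rho) ^+ k by rewrite exprn_ge0// mulr_ge0// divr_ge0// ltW.
have v0 m : 0 <= v m.
  by rewrite mulr_ge0 ?(ltW B0)//; apply: sumr_ge0 => l _; rewrite mulr_ge0 ?exprn_ge0// divr_ge0 ?(ltW eta0).
have dpos l m : (l : nat) != m -> (0 < natdist l m)%N.
  by move=> lm; rewrite addn_gt0 !subn_gt0 orbC -neq_ltn.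
have r4 k : (0 < k)%N -> (4 * rho) ^+ k <= eta * 4^-1 ^+ k.
  move=> k0; rewrite (_ : 4 * rho = eta * 4^-1); last by rewrite /rho; field.
  rewrite exprMn ler_wpM2r// -(prednK k0) exprS ler_piMr ?(ltW eta0)//.
  by rewrite exprn_ile1 ?(ltW eta0).
have vp (m : nat) : v m `^ p <= B `^ p * \sum_(l < N | (l : nat) != m) eta * 4^-1 ^+ natdist l m * y l `^ p.
  rewrite powRM ?(ltW B0)//; last first.
    by apply: sumr_ge0 => l _; rewrite mulr_ge0 ?exprn_ge0// divr_ge0 ?(ltW eta0).
  rewrite ler_wpM2l ?powR_ge0//.
  (* rho^k = 4^(-k) (4 rho)^k: the first factor is the weight for [powR_sum_le], the second keeps
     enough decay for the later sum over m. *)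
  rewrite (eq_bigr (fun l : 'I_N => 4^-1 ^+ natdist l m * ((4 * rho) ^+ natdist l m * y l))); last first.
    by move=> l _; rewrite mulrA -exprMn mulKf.
  apply: le_trans (powR_sum_le _ _ _) _.
  - by move=> l; exact: h0.
  - by move=> l; rewrite mulr_ge0.
  - exact: sum_geom_natdist.
  apply: ler_sum => l lm; rewrite powRM// ler_wpM2r ?powR_ge0//.
  apply: le_trans (r4 _ (dpos _ _ lm)).
  rewrite ge1r_powR ?(ltW p1)//; apply/andP; split.
    by rewrite exprn_gt0// mulr_gt0// divr_gt0.
  by rewrite exprn_ile1// /rho; lra.
have vS : \sum_(m < N) v m `^ p <= B `^ p * eta * S.
  apply: (@le_trans _ _ (\sum_(m < N) B `^ p * \sum_(l < N | (l : nat) != m) eta * 4^-1 ^+ natdist l m * y l `^ p)).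
    by apply: ler_sum => m _; exact: vp.
  rewrite -mulr_sumr -mulrA ler_wpM2l ?powR_ge0//.
  under eq_bigr do rewrite big_mkcond/=.
  rewrite exchange_big/= /S mulr_sumr; apply: ler_sum => l _.
  rewrite -big_mkcond/=.
  rewrite (eq_bigr (fun m : 'I_N => eta * y l `^ p * 4^-1 ^+ natdist m l)); last first.
    by move=> m _; rewrite /natdist addnC mulrAC.
  rewrite -mulr_sumr ler_piMr ?mulr_ge0 ?powR_ge0 ?(ltW eta0)//.
  by under eq_bigl do rewrite eq_sym; exact: sum_geom_natdist.
pose x m := Num.max 0 (b * y m - v m).
have x0 m : 0 <= x m by rewrite le_max lexx.
have bx m : b `^ p * y m `^ p <= 2 `^ p * (x m `^ p + v m `^ p).
  rewrite -powRM ?(ltW b0)//; apply: le_trans (powRD_le p1 (x0 m) (v0 m)).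
  rewrite ge0_ler_powR ?nnegrE ?(mulr_ge0 (ltW b0) (y0 m)) ?(addr_ge0 (x0 m) (v0 m)) ?(ltW p0)//.
  by rewrite -lerBlDr le_max lexx orbT.
have : b `^ p * S <= 2 `^ p * (\sum_(m < N) x m `^ p + \sum_(m < N) v m `^ p).
  by rewrite -big_split/= !mulr_sumr; apply: ler_sum => m _; exact: bx.
have S0 : 0 <= S by apply: sumr_ge0 => m _; exact: powR_ge0.
have : 2 * (2 `^ p * \sum_(m < N) v m `^ p) <= b `^ p * S.
  apply: le_trans (ler_wpM2r S0 etaB).
  by rewrite -!mulrA ler_wpM2l// ler_wpM2l ?(ltW pp0)// mulrA.
rewrite mulrDr -/S -/(x _) -mulrA.
move: (b `^ p * S) (2 `^ p * _) (2 `^ p * _) => u1 u2 u3; lra.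
Qed.

End LacunarySums.

Lemma powR_exprn (R : realType) (x r : R) n : 0 <= x -> (x ^+ n) `^ r = (x `^ r) ^+ n.
Proof.
move=> x0; elim: n => [|n IH]; first by rewrite !expr0 powR1.
by rewrite !exprS powRM ?exprn_ge0// IH.
Qed.

(** * Lower bounds for the Lorentz norm *)

Section LorentzLowerBound.
Variables (R : realType) (d : nat).
Local Notation mu := (lebd R d).
Local Notation lam := (@lebesgue_measure R).

Lemma ae_le_lebd (S S' : set (Rd R d)) : measurable S -> measurable S' ->
  {ae mu, forall x, S x -> S' x} -> (mu S <= mu S')%E.
Proof. by rewrite /lebd -leb_sfiniteE; exact: ae_le_measure. Qed.

Lemma rearr_ge (w : Rd R d -> R[i]) (S : set (Rd R d)) (h t : R) :
  Cmeasurable w -> measurable S -> {ae mu, forall x, S x -> h <= cabs (w x)} ->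
  (t%:E < mu S)%E -> (h%:E <= rearr w t)%E.
Proof.
move=> mw mS Sh tS; apply/ereal_infP => _ [tau /= [tau0 dt] <-].
rewrite lee_fin leNgt; apply/negP => tauh; move: tS; rewrite ltNge => /negP; apply.
apply: le_trans dt; apply: ae_le_lebd => //.
  rewrite -[X in measurable X]setTI; apply: (measurable_fun_ltr (f := cst tau)) => //.
  exact: measurable_cabs.
by apply: filterS Sh => x h1 /h1; exact: lt_le_trans.
Qed.

Variables (p kappa rho sigma : R).
Local Notation q := (conjexp p).
Hypotheses (p1 : 1 < p) (kappa0 : 0 < kappa) (rho0 : 0 < rho) (sigma0 : 0 < sigma)
  (sigma2 : sigma <= 2^-1) (rhoE : sigma `^ q^-1 = rho).

(** For t just below |A_m| the rearrangement is at least rho^m h_m, and t^(1/q) is at least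
    (kappa/2)^(1/q) rho^(-m) since sigma^(1/q) = rho. The powers of rho cancel, and dt/t has mass at
    least 1/2 on the range of t used. *)
Lemma lorentz_lower (w : Rd R d -> R[i]) (A : nat -> set (Rd R d)) (h : nat -> R) (N : nat) :
  Cmeasurable w -> (forall m, measurable (A m)) ->
  (forall m, mu (A m) = (kappa / sigma ^+ m)%:E) -> (forall m, 0 <= h m) ->
  (forall m, (m < N)%N -> {ae mu, forall x, A m x -> rho ^+ m * h m <= cabs (w x)}) ->
  ((((kappa / 2) `^ q^-1) `^ p / 2 * \sum_(m < N) h m `^ p)%:E <=
   \int[lam]_(t in `]0%R, +oo[) (((t `^ q^-1)%:E * rearr w t) `^ p * (t^-1)%:E))%E.
Proof.
move=> mw mA muA h0 Aw; have p0 : 0 < p by exact: lt_trans p1.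
have q0 : 0 < q^-1 by rewrite invr_gt0 /conjexp divr_gt0// subr_gt0.
pose k := (kappa / 2) `^ q^-1; have k0 : 0 <= k by exact: powR_ge0.
pose a m := kappa / sigma ^+ m.
have a0 m : 0 < a m by rewrite divr_gt0// exprn_gt0.
have aS m : a m <= a m.+1 / 2.
  have -> : a m = a m.+1 * sigma by rewrite /a exprS; field; rewrite expf_neq0 ?gt_eqF.
  by rewrite ler_wpM2l// ltW.
have aD m j : (m < j)%N -> a m <= a j / 2.
  elim: j => // j IH; rewrite ltnS leq_eqVlt => /predU1P[->//|/IH aj].
  by apply: le_trans (aS j); apply: le_trans aj _; rewrite ler_pdivrMr// ler_peMr ?(ltW (a0 j))// ler1n.
(* Disjoint for distinct m because a_m = |A_m| at least doubles at each step; the open right end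
   gives the strict inequality t < |A_m| needed by [rearr_ge]. *)
pose I m : set R := `[a m / 2, a m[%classic.
pose C m := (k * h m) `^ p / a m.
have C0 m : 0 <= C m by rewrite divr_ge0 ?powR_ge0// ltW.
have mI m : measurable (I m : set (measurableTypeR R)) by exact: measurable_itv.
have muI m : lam (I m) = (a m / 2)%:E.
  rewrite /I lebesgue_measure_itv/= lte_fin.
  by rewrite (_ : a m / 2 < a m) ?EFinN; [congr EFin|]; have := a0 m; lra.
have Idisj m j t : I m t -> I j t -> m = j.
  rewrite /I /= !in_itv/= => /andP[m1 m2] /andP[j1 j2].
  case: (ltngtP m j) => // /aD le.
    by move: (lt_le_trans m2 (le_trans le j1)); rewrite ltxx.
  by move: (lt_le_trans j2 (le_trans le m1)); rewrite ltxx.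
apply: (@le_trans _ _ (\int[lam]_t (\sum_(m < N) C m * \1_(I m) t)%:E)%E).
  under eq_integral do rewrite -sumEFin.
  rewrite ge0_integral_sum//; last 2 first.
  - move=> m; apply/measurable_EFinP; exact: measurable_funM.
  - by move=> m t _; rewrite lee_fin mulr_ge0.
  rewrite (eq_bigr (fun m : 'I_N => (k `^ p / 2 * h m `^ p)%:E)); last first.
    move=> m _; under eq_integral do rewrite EFinM.
    rewrite ge0_integralZl_EFin//; last exact/measurable_EFinP.
    transitivity ((C m)%:E * (a m / 2)%:E)%E.
      by congr (_ * _)%E; rewrite (integral_indic lam measurableT (mI m)) setIT; exact: muI.
    rewrite -EFinM; congr EFin; rewrite /C powRM//; field.
    by rewrite gt_eqF.
  by rewrite sumEFin lee_fin mulr_sumr.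
rewrite [leRHS]integral_mkcond; apply: ge0_le_integral_nomeas => t.
  by rewrite lee_fin sumr_ge0// => m _; rewrite mulr_ge0.
have F0 : (0 <= ((fun t => ((t `^ q^-1)%:E * rearr w t) `^ p * (t^-1)%:E) \_ `]0%R, +oo[) t)%E.
  rewrite patchE; case: ifPn => // /set_mem/=; rewrite in_itv/= andbT => t0.
  by rewrite mule_ge0 ?poweR_ge0// lee_fin invr_ge0 ltW.
have [[m Im]|nI] := pselect (exists m : 'I_N, I m t); last first.
  rewrite big1// => m _; rewrite indicE (_ : (t \in _) = false) ?mulr0//.
  by apply/negbTE/negP => /set_mem Im; apply: nI; exists m.
rewrite (bigD1 m)//= big1 ?addr0; last first.
  move=> j jm; rewrite indicE (_ : (t \in _) = false) ?mulr0//.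
  apply/negbTE/negP => /set_mem Ij; move/eqP: jm; apply; apply/val_inj; exact: Idisj Ij Im.
rewrite indicE (mem_set Im) mulr1.
have [t1 t2] : a m / 2 <= t /\ t < a m by move: Im; rewrite /I /= in_itv/= => /andP[].
have t0 : 0 < t by have := a0 m; lra.
rewrite patchE mem_set/=; last by rewrite in_itv/= t0.
have rh : ((rho ^+ m * h m)%:E <= rearr w t)%E.
  apply: rearr_ge (mA m) (Aw m (ltn_ord m)) _ => //.
  by rewrite muA lte_fin.
rewrite /C EFinM; apply: lee_pmul.
- by rewrite lee_fin powR_ge0.
- by rewrite lee_fin invr_ge0 ltW.
- rewrite -poweR_EFin; apply: gt0_ler_poweR.
  + exact: ltW.
  + by rewrite in_itv/= leey andbT lee_fin mulr_ge0.
  + rewrite in_itv/= leey andbT mule_ge0 ?lee_fin ?powR_ge0//.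
    by apply: le_trans rh; rewrite lee_fin mulr_ge0 ?exprn_ge0 ?(ltW rho0).
  have -> : k * h m = (a m / 2) `^ q^-1 * (rho ^+ m * h m).
    rewrite mulrA; congr (_ * _).
    rewrite /k /a -rhoE -powR_exprn ?(ltW sigma0)// -powRM.
    - by congr (_ `^ _); field; rewrite expf_neq0// gt_eqF.
    - by rewrite divr_ge0// (ltW (a0 m)).
    - by rewrite exprn_ge0// ltW.
  rewrite EFinM; apply: lee_pmul => //.
  + by rewrite lee_fin powR_ge0.
  + by rewrite lee_fin mulr_ge0 ?exprn_ge0 ?(ltW rho0).
  + rewrite lee_fin; apply: ge0_ler_powR; rewrite ?nnegrE ?(ltW q0) ?(ltW t0)//.
    by rewrite divr_ge0// ltW.
- by rewrite lee_fin lef_pV2 ?posrE// ltW.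
Qed.

End LorentzLowerBound.

(** * The lacunary span *)

Section LacunarySpan.
Variables (R : realType) (d : nat) (p : R).
Local Notation mu := (lebd R d).
Local Notation q := (conjexp p).
Hypotheses (p1 : 1 < p) (p2 : p < 2).

Local Open Scope complex_scope.

Variables (E A : R -> set (Rd R d)) (b B rho : R).
Hypotheses (b0 : 0 < b) (B0 : 0 < B).
Hypothesis EA : forall s, 0 < s ->
  [/\ measurable (E s) /\ measurable (A s), mu (E s) = s%:E, mu (A s) = (s^-1 / 4)%:E,
   (forall r, 4 * s <= r -> E s `&` E r = set0) &
   forall x, A s x -> (b * s) ^+ 2 <= sqr_ft (\1_(E s)) x /\
     forall r, 0 < r -> sqr_ft (\1_(E r)) x <= (B * Num.min r s) ^+ 2].
Hypothesis rho02 : 0 < rho <= 2^-1.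
Hypothesis lac : forall (N : nat) (y : nat -> R), (forall m, 0 <= y m) ->
  b `^ p * \sum_(m < N) y m `^ p <= 2 * 2 `^ p *
    \sum_(m < N) Num.max 0 (b * y m - B * \sum_(l < N | (l : nat) != m) rho ^+ natdist l m * y l) `^ p.

(** The scale ratio is tied to the error ratio by sigma^(1/q) = rho, as [lorentz_lower] requires;
    [omega] is then the p-th root of [sigma], since (q - 1)p = q. *)
Let sigma := rho `^ q.
Let omega := sigma / rho.

Let p0 : 0 < p. Proof. exact: lt_trans p1. Qed.
Let rho0 : 0 < rho. Proof. by case/andP: rho02. Qed.
Let sigma0 : 0 < sigma. Proof. exact: powR_gt0. Qed.
Let omega0 : 0 < omega. Proof. exact: divr_gt0. Qed.

Let q0 : 0 < q. Proof. by rewrite divr_gt0// subr_gt0. Qed.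

(** The conjugate exponent q is at least 2, because p < 2, and rho < 1. *)
Let sigma_rho2 : sigma <= rho ^+ 2.
Proof.
have /andP[_ rho2] := rho02.
rewrite /sigma -powR_mulrn ?(ltW rho0)//; apply: ger_powR.
  by rewrite rho0; lra.
rewrite /conjexp ler_pdivlMr ?subr_gt0// mulrBr mulr1 lerBlDr mulr_natl mulr2n.
by rewrite lerD2l ltW.
Qed.

Let sigma4 : sigma <= 4^-1.
Proof.
apply: le_trans sigma_rho2 _; have /andP[_ rho2] := rho02.
have : rho ^+ 2 <= 2^-1 ^+ 2 by rewrite ler_sqr ?nnegrE ?(ltW rho0)// invr_ge0.
by rewrite expr2 => /le_trans; apply; lra.
Qed.

Let rhoE : sigma `^ q^-1 = rho.
Proof. by rewrite /sigma -powRrM mulfV ?gt_eqF// powRr1// ltW. Qed.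

Let omegap : omega `^ p = sigma.
Proof.
have -> : omega = rho `^ (q - 1).
  by rewrite powRD ?(gt_eqF rho0) ?implybT// powRN powRr1// ltW.
rewrite -powRrM; congr (_ `^ _); rewrite /conjexp; field.
by rewrite subr_eq0 gt_eqF.
Qed.

Let ES m := E (sigma ^+ m).
Let AS m := A (sigma ^+ m).
Let sm0 m : 0 < sigma ^+ m. Proof. exact: exprn_gt0. Qed.
Let mES m : measurable (ES m). Proof. by have [[]] := EA (sm0 m). Qed.
Let mAS m : measurable (AS m). Proof. by have [[]] := EA (sm0 m). Qed.
Let muES m : mu (ES m) = (sigma ^+ m)%:E. Proof. by have [] := EA (sm0 m). Qed.
Let muAS m : mu (AS m) = (4^-1 / sigma ^+ m)%:E.
Proof. by have [_ _ h _ _] := EA (sm0 m); rewrite /AS h mulrC. Qed.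

Lemma ES_disjoint m j x : ES m x -> ES j x -> m = j.
Proof.
have K i k : (i < k)%N -> ES i x -> ES k x -> False.
  move=> ik Ei Ek; have [_ _ _ dE _] := EA (sm0 k).
  suff : 4 * sigma ^+ k <= sigma ^+ i.
    by move=> /dE; rewrite -subset0 => /(_ x); apply; split.
  rewrite -(subnK (ltnW ik)) exprD mulrA ler_piMl ?(ltW (sm0 i))//.
  rewrite -(subnSK ik) exprS mulrA mulr_ile1 ?mulr_ge0 ?exprn_ge0 ?(ltW sigma0)//.
    by have := sigma4; lra.
  by rewrite exprn_ile1 ?(ltW sigma0)//; have := sigma4; lra.
move=> Em Ej; case: (ltngtP m j) => // h; exfalso.
  exact: K h Em Ej.
exact: K h Ej Em.
Qed.

Definition block_ind m (x : Rd R d) : R[i] := Complex (\1_(ES m) x) 0.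

Definition comb N (c : nat -> R[i]) (x : Rd R d) : R[i] := \sum_(m < N) c m * block_ind m x.

Lemma Cmeasurable_ind m : Cmeasurable (block_ind m).
Proof.
split; last exact: measurable_cst.
exact: measurable_indic (mES m).
Qed.

Lemma cabs_ind m x : cabs (block_ind m x) = \1_(ES m) x.
Proof. by rewrite /cabs /block_ind/= expr0n/= addr0 sqrtr_sqr ger0_norm. Qed.

Lemma N1_ind m : N1 (block_ind m) = (sigma ^+ m)%:E.
Proof.
rewrite /N1; under eq_integral do rewrite cabs_ind.
by rewrite integral_indic// setIT muES.
Qed.

Lemma combS N c : comb N.+1 c = (fun x => c N * block_ind N x + comb N c x).
Proof. by apply/funext => x; rewrite /comb big_ord_recr addrC. Qed.

Lemma comb0 c : comb 0 c = (fun=> 0).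
Proof. by apply/funext => x; rewrite /comb big_ord0. Qed.

Lemma comb_L1 N c : Cmeasurable (comb N c) /\ (N1 (comb N c) < +oo)%E.
Proof.
elim: N => [|N [mf f1]].
  rewrite comb0; split; first by split; exact: measurable_cst.
  by rewrite (_ : N1 _ = 0%E)//; apply: integral0_eq => x _; rewrite cabs0.
rewrite combS; split.
  by apply: CmeasurableD => //; apply: CmeasurableZ; exact: Cmeasurable_ind.
by apply: N1_linear => //; [exact: Cmeasurable_ind|rewrite N1_ind ltry].
Qed.

Lemma fourier_comb N c x : fourier (comb N c) x = \sum_(m < N) c m * fourier (block_ind m) x.
Proof.
elim: N => [|N IH]; first by rewrite comb0 fourier0 big_ord0.
have [mf f1] := comb_L1 N c.
rewrite combS fourier_linear//; last 2 first.
- exact: Cmeasurable_ind.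
- by rewrite N1_ind ltry.
by rewrite IH big_ord_recr addrC.
Qed.

Lemma cabs_comb N c x :
  cabs (comb N c x) `^ p = \sum_(m < N) cabs (c m) `^ p * \1_(ES m) x.
Proof.
have E0 m : ~ ES m x -> \1_(ES m) x = 0 :> R.
  by move=> nE; rewrite indicE (_ : (x \in _) = false)//; apply/negbTE/negP => /set_mem.
have [[m Em]|nE] := pselect (exists m : 'I_N, ES m x); last first.
  have nE' (m : 'I_N) : \1_(ES m) x = 0 :> R by apply: E0 => Em; apply: nE; exists m.
  rewrite big1 => [|m _]; last by rewrite nE' mulr0.
  rewrite /comb big1 => [|m _]; first by rewrite cabs0 powR0// gt_eqF.
  by rewrite /block_ind nE' -/(0 : R[i]) mulr0.
have nE (j : 'I_N) : j != m -> \1_(ES j) x = 0 :> R.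
  move=> jm; apply: E0 => Ej; move/eqP: jm; apply; apply/val_inj; exact: ES_disjoint Ej Em.
rewrite (bigD1 m)//= [X in _ + X]big1 ?addr0; last by move=> j jm; rewrite nE ?mulr0.
rewrite /comb (bigD1 m)//= [X in _ + X]big1 ?addr0; last first.
  by move=> j jm; rewrite /block_ind nE// -/(0 : R[i]) mulr0.
by rewrite cabsM cabs_ind indicE (mem_set Em) !mulr1.
Qed.

(** The L^p norm of the m-th term, as |E_{sigma^m}| = sigma^m = omega^(pm). In these coordinates the
    span is isometric to finitely supported sequences in l^p. *)
Let y (c : nat -> R[i]) m := cabs (c m) * omega ^+ m.

Let y0 c m : 0 <= y c m.
Proof. by rewrite mulr_ge0 ?cabs_ge0// exprn_ge0// ltW. Qed.

Lemma Np_comb N c : Np p (comb N c) = (\sum_(m < N) y c m `^ p)%:E.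
Proof.
rewrite /Np; under eq_integral do rewrite cabs_comb -sumEFin.
rewrite ge0_integral_sum//; last 2 first.
- by move=> m; apply/measurable_EFinP; apply: measurable_funM.
- by move=> m t _; rewrite lee_fin mulr_ge0 ?powR_ge0.
rewrite -sumEFin; apply: eq_bigr => m _.
under eq_integral do rewrite EFinM.
rewrite ge0_integralZl_EFin ?powR_ge0//; last first.
  by apply/measurable_EFinP; exact: measurable_indic (mES m).
rewrite integral_indic// setIT muES -EFinM; congr EFin.
rewrite /y powRM ?cabs_ge0 ?exprn_ge0 ?(ltW omega0)//; congr (_ * _).
by rewrite powR_exprn ?omegap// ltW.
Qed.

Lemma inLp_comb N c : inLp p (comb N c).
Proof. by apply/inLpP => //; split; [case: (comb_L1 N c)|rewrite Np_comb ltry]. Qed.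

Lemma cabs_fourier_ind m x : cabs (fourier (block_ind m) x) ^+ 2 = sqr_ft (\1_(ES m)) x.
Proof.
have f1 : (N1 (block_ind m) < +oo)%E by rewrite N1_ind ltry.
have z0 (g : Rd R d -> R) : Rintegral mu setT (fun t => 0 * g t) = 0.
  by rewrite /Rintegral integral0_eq// => t _; rewrite mul0r.
rewrite sqr_cabs Re_fourier ?Im_fourier//; [|exact: Cmeasurable_ind|exact: Cmeasurable_ind].
have s0 : sin_transform (fun t => complex.Im (block_ind m t)) x = 0 := z0 _.
have c0 : cos_transform (fun t => complex.Im (block_ind m t)) x = 0 := z0 _.
by rewrite s0 c0 addr0 sub0r sqrrN.
Qed.

(** The l-th term has modulus at least b |c_l| sigma^l = rho^l b y_l. The others are bounded by B
    min(sigma^m, sigma^l) <= B rho^l rho^|m-l| omega^m: for m > l this holds with equality in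
    sigma^m, for m <= l it is sigma <= rho^2. *)
Lemma comb_lower N c l x : (l < N)%N -> AS l x ->
  rho ^+ l * Num.max 0 (b * y c l - B * \sum_(m < N | (m : nat) != l) rho ^+ natdist m l * y c m)
  <= cabs (fourier (comb N c) x).
Proof.
move=> lN Ax; have [_ _ _ _ /(_ x Ax)[lo up]] := EA (sm0 l).
have omr k : omega ^+ k * rho ^+ k = sigma ^+ k by rewrite -exprMn divfK// gt_eqF.
have rk k : 0 <= rho ^+ k by rewrite exprn_ge0// ltW.
have ok k : 0 <= omega ^+ k by rewrite exprn_ge0// ltW.
pose F m := cabs (fourier (block_ind m) x).
have Fl : b * sigma ^+ l <= F l.
  rewrite -ler_sqr ?nnegrE ?cabs_ge0 ?mulr_ge0 ?(ltW b0) ?(ltW (sm0 l))//.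
  by rewrite cabs_fourier_ind.
have Fm m : F m <= B * (rho ^+ l * rho ^+ natdist m l * omega ^+ m).
  apply: (@le_trans _ _ (B * Num.min (sigma ^+ m) (sigma ^+ l))).
    rewrite -ler_sqr ?nnegrE ?cabs_ge0//.
      by rewrite cabs_fourier_ind; exact: up.
    by rewrite mulr_ge0 ?(ltW B0)// le_min !ltW.
  rewrite ler_wpM2l ?(ltW B0)//; have [ml|lm] := leqP m l.
    rewrite ge_min; apply/orP; right.
    rewrite /natdist (_ : (m - l)%N = 0%N) ?add0n; last by apply/eqP; rewrite subn_eq0.
    have -> : sigma ^+ l = sigma ^+ (l - m) * (omega ^+ m * rho ^+ m) by rewrite omr -exprD subnK.
    have -> : rho ^+ l = rho ^+ (l - m) * rho ^+ m by rewrite -exprD subnK.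
    have -> : rho ^+ (l - m) * rho ^+ m * rho ^+ (l - m) * omega ^+ m =
        (rho ^+ 2) ^+ (l - m) * (omega ^+ m * rho ^+ m) by rewrite exprAC expr2; ring.
    by rewrite ler_wpM2r ?mulr_ge0// lerXn2r ?nnegrE ?(ltW sigma0) ?sqr_ge0.
  rewrite ge_min; apply/orP; left.
  rewrite /natdist (_ : (l - m)%N = 0%N) ?addn0; last by apply/eqP; rewrite subn_eq0 ltnW.
  by rewrite -exprD subnKC 1?ltnW// mulrC omr.
rewrite -ler_pdivlMl ?exprn_gt0// ge_max; apply/andP; split.
  by rewrite mulr_ge0 ?cabs_ge0// invr_ge0.
rewrite ler_pdivlMl ?exprn_gt0//.
rewrite fourier_comb [X in _ <= cabs X](bigD1 (Ordinal lN))//=.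
pose r : R[i] := \sum_(i < N | i != Ordinal lN) c i * fourier (block_ind i) x.
rewrite -/r.
have rle : cabs r <= \sum_(m < N | (m : nat) != l) cabs (c m) * F m.
  apply: (big_ind2 (fun u v => cabs u <= v)) => [|u1 v1 u2 v2 h1 h2|m _].
  - by rewrite cabs0.
  - by apply: le_trans (cabsD _ _) _; exact: lerD.
  - by rewrite cabsM.
have : cabs (c l) * F l <= cabs (c l * fourier (block_ind l) x + r) + cabs r.
  rewrite -cabsM -[X in cabs X <= _](addrK r) -(cabsN r); exact: cabsD.
rewrite -lerBlDr; apply: le_trans.
rewrite mulrBr; apply: lerB.
  rewrite /y mulrCA [_ * (_ * omega ^+ l)]mulrCA [rho ^+ l * omega ^+ l]mulrC omr mulrCA.
  by rewrite ler_wpM2l ?cabs_ge0.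
apply: (le_trans rle); rewrite mulrCA !mulr_sumr; apply: ler_sum => m _.
apply: le_trans (ler_wpM2l (cabs_ge0 _) (Fm m)) _.
by rewrite /y le_eqVlt; apply/orP; left; apply/eqP; ring.
Qed.

(** The constant of [lorentz_lower] at kappa = 1/4, from |A_s| = 1/(4s), times that of
    [lacunary_sum]. *)
Let k0 : R := ((4^-1 / 2) `^ q^-1) `^ p / 2 * (b `^ p / (2 * 2 `^ p)).

Let k00 : 0 < k0.
Proof. by rewrite !mulr_gt0 ?invr_gt0 ?mulr_gt0 ?powR_gt0. Qed.

Lemma lorentz_comb N c (w : Rd R d -> R[i]) : Cmeasurable w ->
  {ae mu, forall x, w x = fourier (comb N c) x} ->
  ((k0 `^ p^-1)%:E * Lpnorm p (comb N c) <= lorentz_norm q p w)%E.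
Proof.
move=> mw ww; rewrite LpnormE// Np_comb -poweR_EFin -poweRM ?lee_fin ?(ltW k00)//; last first.
  by apply: sumr_ge0 => m _; exact: powR_ge0.
rewrite /lorentz_norm; apply: gt0_ler_poweR => //.
- by rewrite invr_ge0 ltW.
- rewrite in_itv/= leey andbT mule_ge0 ?lee_fin ?(ltW k00)//.
  by apply: sumr_ge0 => m _; exact: powR_ge0.
- by rewrite in_itv/= leey andbT integral_ge0// => t /=; rewrite in_itv/= andbT => t0;
    rewrite mule_ge0 ?poweR_ge0// lee_fin invr_ge0 ltW.
pose h m := Num.max 0 (b * y c m - B * \sum_(l < N | (l : nat) != m) rho ^+ natdist l m * y c l).
have low := @lorentz_lower R d p 4^-1 rho sigma p1 _ rho0 sigma0 _ rhoE w AS h N mw mAS muAS.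
apply: le_trans (low _ _ _ _).
- rewrite -EFinM lee_fin /k0 -!mulrA ler_wpM2l ?powR_ge0// ler_wpM2l//.
  by rewrite mulrCA ler_pdivrMl ?mulr_gt0 ?powR_gt0// lac.
- by [].
- by apply: le_trans sigma4 _; lra.
- by move=> m; rewrite le_max lexx.
- move=> m mN; apply: filterS ww => x -> Ax; exact: comb_lower.
Qed.

Lemma comb_widen N M c : (N <= M)%N ->
  comb N c = comb M (fun m => if (m < N)%N then c m else 0).
Proof.
move=> NM; apply/funext => x; rewrite /comb (big_ord_widen M (fun m => c m * block_ind m x) NM).
by rewrite big_mkcond; apply: eq_bigr => m _; case: ifP => // _; rewrite mul0r.
Qed.

Lemma comb_linear N a c c' :
  (fun x => a * comb N c x + comb N c' x) = comb N (fun m => a * c m + c' m).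
Proof.
apply/funext => x; rewrite /comb mulr_sumr -big_split; apply: eq_bigr => m _ /=.
by rewrite mulrDl mulrA.
Qed.

(** A combination vanishing almost everywhere has zero L^p norm; by [Np_comb] every y_m, hence every
    coefficient, is then 0. *)
Lemma comb_infinite_dim : infinite_dim (fun f => exists N c, f = comb N c).
Proof.
move=> [|k].
  by exists (fun i => fun=> 0); split; [case|move=> c _ []].
exists (fun i => block_ind i); split.
  move=> i; exists k.+1, (fun m => (m == i :> nat)%:R); apply/funext => x.
  rewrite /comb (bigD1 i)//= eqxx mul1r big1 ?addr0// => j ji.
  by rewrite (_ : (j == i :> nat) = false) ?mul0r//; exact: negbTE.
move=> c c0 i; pose c' m := c (inord m).
have e x : comb k.+1 c' x = \sum_(j < k.+1) c j * block_ind j x.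
  by apply: eq_bigr => j _; rewrite /c' inord_val.
have N0 : Np p (comb k.+1 c') = 0%E.
  have [mf _] := comb_L1 k.+1 c'.
  apply/eqP; rewrite eq_le Np_ge0 andbT.
  apply: (@le_trans _ _ (\int[mu]_x (cst 0%E x))%E); last by rewrite integral0.
  apply: ae_ge0_le_integral => //.
  - by move=> x _; rewrite lee_fin powR_ge0.
  - exact: measurable_powR_cabs.
  - by apply: filterS c0 => x c0 _; rewrite e c0 cabs0 powR0 ?gt_eqF.
move: N0; rewrite Np_comb => -[] /eqP.
rewrite psumr_eq0; last by move=> j _; exact: powR_ge0.
move=> /allP /(_ i (mem_index_enum _)) /= /eqP /powR_eq0_eq0 /eqP.
by rewrite mulf_eq0 expf_eq0 (gt_eqF omega0) andbF orbF /c' inord_val => /eqP /cabs_eq0.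
Qed.

(** The upper estimate is the boundedness of T. For the lower one, combinations of blocks are
    integrable, so T acts on them as the Fourier integral and [lorentz_comb] applies. *)
Lemma fourier_not_strictly_singular (T : (Rd R d -> R[i]) -> (Rd R d -> R[i])) :
  fourier_operator p T -> ~ strictly_singular p q T.
Proof.
move=> [_ _ [C TC] TF]; apply; exists (fun f => exists N c, f = comb N c); split.
- split.
  + by move=> _ [N [c ->]]; exact: inLp_comb.
  + by exists 0%N, (fun=> 0); rewrite comb0.
  + move=> a _ _ [N [c ->]] [N' [c' ->]].
    rewrite (comb_widen c (leq_maxl N N')) (comb_widen c' (leq_maxr N N')) comb_linear.
    by exists (maxn N N'); eexists.
- exact: comb_infinite_dim.
exists (k0 `^ p^-1), C; split; first exact: powR_gt0.
move=> _ [N [c ->]]; have Lf := inLp_comb N c; have [[mT _] TfC] := TC _ Lf; split => //.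
apply: lorentz_comb => //; apply: TF => //.
by apply/inLp1; exact: comb_L1.
Qed.

End LacunarySpan.

Theorem theorem3p3 (R : realType) (d : nat) (p : R) :
  (1 <= d)%N -> 1 < p < 2 ->
  (exists T, @fourier_operator R d p T) /\
  (forall T, @fourier_operator R d p T -> ~ @strictly_singular R d p (conjexp p) T).
Proof.
move=> _ /andP[p1 p2]; split=> [|T FT]; first exact: fourier_operator_exists.
have [E [A [b [B [b0 B0 EA]]]]] := blocks R d.-1.
have [rho rho02 lac] := lacunary_sum p1 b0 B0.
exact (fourier_not_strictly_singular p1 p2 b0 B0 EA rho02 lac FT).
Qed.
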